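(* The locus $\theta_{\rm null}^{g-1}$ is a proper subset of $\theta_{\rm null}$: $$\theta_{\rm null}^{g-1}\subsetneq\theta_{\rm null}.$$
   Context: $\mathcal{H}_g$ is the Siegel upper half-space of symmetric complex $g\times g$ matrices $\tau$ with positive definite imaginary part, and $\mathcal{A}_g=\mathcal{H}_g/\operatorname{Sp}(g,\mathbb{Z})$ is the moduli space of complex principally polarized abelian varieties of dimension $g$, with $\tau$ corresponding to $\mathbb{C}^g/(\tau\mathbb{Z}^g+\mathbb{Z}^g)$. For $\varepsilon,\delta\in(\mathbb{Z}/2\mathbb{Z})^g$, thought of as vectors of zeros and ones, $\tau\in\mathcal{H}_g$ and $z\in\mathbb{C}^g$, the theta function with characteristic $[\varepsilon,\delta]$ is $$\theta\left[\begin{matrix}\varepsilon\\ \delta\end{matrix}\right](\tau,z)=\sum_{m\in\mathbb{Z}^g}\exp \pi i\left[{}^t(m+\tfrac{\varepsilon}{2})\tau(m+\tfrac{\varepsilon}{2})+2\,{}^t(m+\tfrac{\varepsilon}{2})(z+\tfrac{\delta}{2})\right].$$ The characteristic is even if $\varepsilon\cdot\delta=0\in\mathbb{Z}/2\mathbb{Z}$ (equivalently, the function is even in $z$). The theta constant is the value at $z=0$, written $\theta\left[\begin{matrix}\varepsilon\\ \delta\end{matrix}\right](\tau)$. The theta-null divisor $\theta_{\rm null}\subset\mathcal{A}_g$ is the zero locus of the product of all even theta constants. For $h=0,\dots,g$, $\theta_{\rm null}^h$ is the locus of those $\tau$ for which there exists an even $[\varepsilon,\delta]$ with $$\theta\left[\begin{matrix}\varepsilon\\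 \delta\end{matrix}\right](\tau)=0\quad\text{and}\quad \operatorname{rk}\left(\frac{\partial^2\theta\left[\begin{matrix}\varepsilon\\ \delta\end{matrix}\right](\tau,z)}{\partial z_j\,\partial z_k}\Big|_{z=0}\right)_{1\le j,k\le g}\le h.$$ This locus is invariant under $\operatorname{Sp}(g,\mathbb{Z})$, so $\theta_{\rm null}^h$ is regarded as a subset of $\mathcal{A}_g$.
   Formalization: The formal theorem assumes g ≥ 2; for g = 1 the even theta constants never vanish, so both loci are empty and the strict inclusion is false. *)

(* Defs.v *)
From HB Require Import structures.
From mathcomp Require Import all_boot all_order all_algebra.
From mathcomp Require Import complex.
From mathcomp Require Import all_classical all_reals all_analysis.
From mathcomp.analysis.showcase Require summability.

Set Implicit Arguments.
Unset Strict Implicit.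
Unset Printing Implicit Defensive.

Import Order.TTheory GRing.Theory Num.Theory.
Import numFieldNormedType.Exports.

Local Open Scope classical_set_scope.
Local Open Scope complex_scope.
Local Open Scope ring_scope.

(* Typed as a numFieldType so that the library's topology and normed-module
   structures on an arbitrary numFieldType apply to it. *)
Definition Cx (R : realType) : numFieldType := R[i].

Section Moduli.
Variables (R : realType) (g : nat).

Definition siegel_upper_half_space : set 'M[Cx R]_g :=
  [set tau | tau^T = tau /\
     forall x : 'cV[R]_g, x != 0 ->
       0 < (x^T *m map_mx (@complex.Im R) tau *m x) 0 0].

Definition symplectic_form : 'M[int]_(g + g) :=
  block_mx 0 1%:M (- 1%:M) 0.

Definition symplectic_group : set 'M[int]_(g + g) :=
  [set M | M *m symplectic_form *m M^T = symplectic_form].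

(* (A tau + B) (C tau + D)^-1, where A, B, C, D are the g x g blocks of M. *)
Definition siegel_action (M : 'M[int]_(g + g)) (tau : 'M[Cx R]_g) :
    'M[Cx R]_g :=
  let N := map_mx (intr : int -> Cx R) M in
  (ulsubmx N *m tau + ursubmx N) *m invmx (dlsubmx N *m tau + drsubmx N).

Definition siegel_orbit (tau : 'M[Cx R]_g) : set 'M[Cx R]_g :=
  [set siegel_action M tau | M in symplectic_group].

(* The quotient A_g of the half-space by Sp(g, Z); its points are orbits. *)
Definition moduli_ppav : set (set 'M[Cx R]_g) :=
  siegel_orbit @` siegel_upper_half_space.

(* The image in A_g of a locus L of matrices in the half-space: the points of
   A_g having a representative in L. *)
Definition moduli_locus (L : set 'M[Cx R]_g) : set (set 'M[Cx R]_g) :=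
  [set p | moduli_ppav p /\ p `&` L !=set0].

End Moduli.

Definition cexp (R : realType) (z : Cx R) : Cx R :=
  (expR (complex.Re z) * cos (complex.Im z)) +i*
  (expR (complex.Re z) * sin (complex.Im z)).

Section Theta.
Variables (R : realType) (g : nat).

(* The pair (epsilon, delta). *)
Definition characteristic := ('cV['F_2]_g * 'cV['F_2]_g)%type.

Definition even_char (c : characteristic) : bool := (c.1^T *m c.2) 0 0 == 0.

(* e / 2, the entries of e being lifted to the complex numbers 0 and 1. *)
Definition half_char (e : 'cV['F_2]_g) : 'cV[Cx R]_g :=
  \col_i ((e i 0 : nat)%:R / 2).

Definition theta_term (c : characteristic) (tau : 'M[Cx R]_g)
    (z : 'cV[Cx R]_g) (m : 'cV[int]_g) : Cx R :=
  let x := map_mx (intr : int -> Cx R) m + half_char c.1 in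
  cexp ((0 +i* pi : Cx R) *
        ((x^T *m tau *m x) 0 0 + 2 * (x^T *m (z + half_char c.2)) 0 0)).

(* [summability.sum] is the unordered sum: the limit of the finite partial
   sums along the directed set of finite subsets of Z^g. *)
Definition theta (c : characteristic) (tau : 'M[Cx R]_g)
    (z : 'cV[Cx R]_g) : Cx R :=
  summability.sum (theta_term c tau z).

Definition theta_const (c : characteristic) (tau : 'M[Cx R]_g) : Cx R :=
  theta c tau 0.

(* ['D_v] is the derivative in direction v over the field Cx R, so these are
   the holomorphic second partial derivatives at z = 0. *)
Definition theta_hessian (c : characteristic) (tau : 'M[Cx R]_g) :
    'M[Cx R]_g :=
  \matrix_(j, k)
    'D_(delta_mx j 0) ('D_(delta_mx k 0) (theta c tau)) (0 : 'cV[Cx R]_g).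

Definition theta_null : set (set 'M[Cx R]_g) :=
  moduli_locus [set tau |
    \prod_(c : characteristic | even_char c) theta_const c tau = 0].

Definition theta_null_rank (h : nat) : set (set 'M[Cx R]_g) :=
  moduli_locus [set tau | exists c : characteristic,
    [/\ even_char c, theta_const c tau = 0 &
        (\rank (theta_hessian c tau) <= h)%N]].

End Theta.

Arguments theta_null : clear implicits.
Arguments theta_null_rank : clear implicits.

(* Main.v *)
Require Import Defs.
From HB Require Import structures.
From mathcomp Require Import all_boot all_order all_algebra.
From mathcomp Require Import complex finmap ring lra zify.
From mathcomp Require Import all_classical all_reals all_analysis.
From mathcomp.analysis.showcase Require summability.

Set Implicit Arguments.
Unset Strict Implicit.
Unset Printing Implicit Defensive.

Import Order.TTheory GRing.Theory Num.Theory.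
Import numFieldNormedType.Exports.

Local Open Scope classical_set_scope.
Local Open Scope complex_scope.
Local Open Scope ring_scope.

(* Let M be in Sp(g, Z).  After the linear change of variable by
   (C tau + D)^T and multiplication by the exponential of a quadratic form,
   theta[c](M tau, z) has the quasi-periods of a theta function with
   characteristic c' for tau, and entire functions with these quasi-periods
   are proportional.  Comparing Taylor expansions at 0, the vanishing of an
   even theta constant and the rank of its Hessian depend on the orbit of tau
   only, up to relabelling the characteristics.  It is thus enough to find one
   tau at which a single even theta constant vanishes, with a Hessian of
   rank g.

   Take tau = i (t Q + p P) with t large.  The form Q is chosen so that on
   Z^g + epsilon/2 it has a unique minimal vector up to sign unless
   epsilon = (1, ..., 1), in which case the minimal vectors are, up to sign,
   v_0/2 = (1/2, ..., 1/2) and the g - 1 vectors v_i/2 obtained by changing the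
   sign of entry i >= 1.  Hence the even theta constants with
   epsilon <> (1, ..., 1) do not vanish, and the others are, up to a nonzero
   factor and an exponentially small error, 1 + y sum_(i >= 1) (-1)^delta_i
   with y = exp (- pi p).  If all these delta_i are 1 this is 1 - (g - 1) y,
   which changes sign with p, and the intermediate value theorem gives an exact
   zero, with y close to 1 / (g - 1).  There the other theta constants are
   nonzero, and the Hessian is proportional, up to a small error, to the
   nondegenerate matrix v_0 v_0^T - y sum_(i >= 1) v_i v_i^T. *)

(** * Unordered sums and the complex exponential *)

(** The point found must avoid [theta_null_rank] for all even characteristics and all
    representatives of its orbit; hence the control of every even theta constant, and not only of
    the vanishing one. In the transport along the orbit, the factor of the transformation formula
    enters only as a nonzero constant, and the new characteristic is read off from an exponent that
    is additive modulo 2. Proportionality of functions with equal quasi-periods is classically a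
    comparison of Fourier coefficients. Here integrals over the torus become means over grids with N
    + 1 points per coordinate, holomorphy becomes the expansion [tame], and a function whose
    coefficients all tend to zero is evaluated at a point by a trigonometric kernel peaked there.
    The form P is -2 x_0 (x_0 + ... + x_(g-1)). It equals -g/2 at v_0/2 and 1 - g/2 at every other
    v_i/2, so p tunes the ratio y while t suppresses all other vectors. The estimates in t are
    uniform for bounded p, so that p can be chosen after t. *)

Section ComplexModulus.
Variable R : realType.
Implicit Types (z w : Cx R) (x y : R).

Definition cabs z : R := ComplexField.Normc.normc z.
Definition rc x : Cx R := x%:C.

Lemma normCx z : `|z| = rc (cabs z).
Proof. by []. Qed.

Lemma cabsE z : cabs z = Num.sqrt (complex.Re z ^+ 2 + complex.Im z ^+ 2).
Proof. by case: z. Qed.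

Lemma cabs_ge0 z : 0 <= cabs z.
Proof. by rewrite cabsE sqrtr_ge0. Qed.

Lemma cabsM z w : cabs (z * w) = cabs z * cabs w.
Proof. exact: ComplexField.Normc.normcM. Qed.

Lemma cabs0 : cabs 0 = 0.
Proof. exact: ComplexField.Normc.normc0. Qed.

Lemma cabs1 : cabs 1 = 1.
Proof. exact: ComplexField.Normc.normc1. Qed.

Lemma cabsN z : cabs (- z) = cabs z.
Proof. exact: (@normcN R z). Qed.

Lemma cabsD z w : cabs (z + w) <= cabs z + cabs w.
Proof. exact: (@le_normcD R z w). Qed.

Lemma cabsB z w : cabs (z - w) <= cabs z + cabs w.
Proof. by rewrite -(cabsN w) cabsD. Qed.

Lemma cabsBC z w : cabs (z - w) = cabs (w - z).
Proof. by rewrite -cabsN opprB. Qed.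

Lemma cabs_triangle u z w : cabs (z - w) <= cabs (z - u) + cabs (u - w).
Proof. by rewrite (le_trans _ (cabsD _ _)) // addrA subrK. Qed.

Lemma cabs_eq0 z : (cabs z == 0) = (z == 0).
Proof.
apply/eqP/eqP => [|->]; last exact: cabs0.
exact: ComplexField.Normc.eq0_normc.
Qed.

Lemma cabs_gt0 z : (0 < cabs z) = (z != 0).
Proof. by rewrite lt_neqAle cabs_ge0 andbT eq_sym cabs_eq0. Qed.

Lemma cabsV z : cabs z^-1 = (cabs z)^-1.
Proof. exact: ComplexField.Normc.normcV. Qed.

Lemma cabsX z n : cabs (z ^+ n) = cabs z ^+ n.
Proof. by elim: n => [|n IH]; rewrite ?cabs1 // !exprS cabsM IH. Qed.

Lemma cabs_sum (I : Type) (r : seq I) (P : pred I) (F : I -> Cx R) :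
  cabs (\sum_(i <- r | P i) F i) <= \sum_(i <- r | P i) cabs (F i).
Proof.
elim/big_ind2: _ => [|x1 x2 y1 y2 h1 h2|//]; first by rewrite cabs0.
by rewrite (le_trans (cabsD _ _)) // lerD.
Qed.

Lemma rc0 : rc 0 = 0. Proof. by []. Qed.
Lemma rc1 : rc 1 = 1. Proof. by []. Qed.
Lemma rcD x y : rc (x + y) = rc x + rc y. Proof. exact: rmorphD. Qed.
Lemma rcN x : rc (- x) = - rc x. Proof. exact: rmorphN. Qed.
Lemma rcM x y : rc (x * y) = rc x * rc y. Proof. exact: rmorphM. Qed.
Lemma rc_nat n : rc n%:R = n%:R. Proof. exact: rmorph_nat. Qed.
Lemma rc_int (n : int) : rc n%:~R = n%:~R. Proof. exact: rmorph_int. Qed.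
Lemma rcV x : rc x^-1 = (rc x)^-1. Proof. exact: fmorphV. Qed.

Lemma rc_sum (I : Type) (r : seq I) (P : pred I) (F : I -> R) :
  rc (\sum_(i <- r | P i) F i) = \sum_(i <- r | P i) rc (F i).
Proof. exact: rmorph_sum. Qed.

Lemma cabs_rc x : cabs (rc x) = `|x|.
Proof. by rewrite cabsE /= expr0n /= addr0 sqrtr_sqr. Qed.

Lemma cabs_nat n : cabs n%:R = n%:R.
Proof. by rewrite -rc_nat cabs_rc ger0_norm. Qed.

Lemma ReD z w : complex.Re (z + w) = complex.Re z + complex.Re w.
Proof. by case: z w => [a b] [c d]. Qed.

Lemma ImD z w : complex.Im (z + w) = complex.Im z + complex.Im w.
Proof. by case: z w => [a b] [c d]. Qed.

Lemma Re_sum (I : Type) (r : seq I) (P : pred I) (F : I -> Cx R) :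
  complex.Re (\sum_(i <- r | P i) F i) = \sum_(i <- r | P i) complex.Re (F i).
Proof. exact: (big_morph _ ReD). Qed.

Lemma Im_sum (I : Type) (r : seq I) (P : pred I) (F : I -> Cx R) :
  complex.Im (\sum_(i <- r | P i) F i) = \sum_(i <- r | P i) complex.Im (F i).
Proof. exact: (big_morph _ ImD). Qed.

Lemma Re_le_cabs z : `|complex.Re z| <= cabs z.
Proof. by rewrite cabsE -sqrtr_sqr ler_wsqrtr // lerDl sqr_ge0. Qed.

Lemma Im_le_cabs z : `|complex.Im z| <= cabs z.
Proof. by rewrite cabsE -sqrtr_sqr ler_wsqrtr // lerDr sqr_ge0. Qed.

Lemma complex_split z : z = rc (complex.Re z) + (0 +i* 1) * rc (complex.Im z).
Proof. exact: complexE. Qed.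

End ComplexModulus.

Section UnorderedSums.
Variables (R : realType) (I : choiceType).
Implicit Types (f g : I -> Cx R) (l : Cx R) (J : {fset I}).

(** Convergence along finite sets with a real modulus and a real tolerance; [has_sumE] identifies
    the limit with [summability.sum]. *)
Definition has_sum f l := forall e : R, 0 < e ->
  exists J0 : {fset I}, forall J : {fset I}, (J0 `<=` J)%fset ->
    cabs (\sum_(i <- J) f i - l) <= e.

Definition abs_bounded f (B : R) :=
  forall J : {fset I}, \sum_(i <- J) cabs (f i) <= B.

Lemma has_sum_uniq f l l' : has_sum f l -> has_sum f l' -> l = l'.
Proof.
move=> hl hl'; apply/eqP; rewrite -subr_eq0 -cabs_eq0 eq_le cabs_ge0 andbT.
apply/ler_addgt0Pr => e e0; rewrite add0r.
have [J hJ] := hl _ (divr_gt0 e0 (ltr0Sn R 1)).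
have [J' hJ'] := hl' _ (divr_gt0 e0 (ltr0Sn R 1)).
rewrite (le_trans (cabs_triangle (\sum_(i <- (J `|` J')%fset) f i) _ _)) //.
rewrite [leRHS](splitr e) lerD // ?(cabsBC l).
  by apply: hJ; rewrite fsubsetUl.
by apply: hJ'; rewrite fsubsetUr.
Qed.

Lemma eq_has_sum f g l : f =1 g -> has_sum f l -> has_sum g l.
Proof. by move=> /funext ->. Qed.

#[local] Existing Instance summability.totally_filter.

Lemma has_sumE f l : has_sum f l -> summability.sum f = l.
Proof.
move=> hl; apply: cvg_lim; first exact: norm_hausdorff.
apply/cvgrPdist_le => e e0.
(* In the order on complex numbers, [0 < e] includes that [e] is real. *)
have e0' : 0 < complex.Re e /\ e = rc (complex.Re e).
  move: e0; rewrite ltcE /= => /andP[/eqP h1 h2]; split=> //.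
  by rewrite [LHS]complex_split /= h1 rc0 mulr0 addr0.
have [J hJ] := hl _ e0'.1.
exists J => //= J' JJ' /=.
rewrite /summability.partial_sum -(big_seq_fsetE _ _ xpredT) /=.
by rewrite e0'.2 normCx lecR cabsBC hJ.
Qed.

Lemma has_sumD f g l l' :
  has_sum f l -> has_sum g l' -> has_sum (fun i => f i + g i) (l + l').
Proof.
move=> hl hl' e e0.
have [J hJ] := hl _ (divr_gt0 e0 (ltr0Sn R 1)).
have [J' hJ'] := hl' _ (divr_gt0 e0 (ltr0Sn R 1)).
exists (J `|` J')%fset => K hK; rewrite big_split /= opprD addrACA.
rewrite (le_trans (cabsD _ _)) // (splitr e) lerD //.
  by apply: hJ; rewrite (fsubset_trans _ hK) // fsubsetUl.
by apply: hJ'; rewrite (fsubset_trans _ hK) // fsubsetUr.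
Qed.

Lemma has_sumZ f l a : has_sum f l -> has_sum (fun i => a * f i) (a * l).
Proof.
move=> hl e e0; have [->|a0] := eqVneq a 0.
  exists fset0 => J _; under eq_bigr do rewrite mul0r.
  by rewrite big1 // mul0r subrr cabs0 ltW.
have d0 : 0 < e / cabs a by rewrite divr_gt0 // cabs_gt0.
have [J hJ] := hl _ d0.
by exists J => K /hJ; rewrite -mulr_sumr -mulrBr cabsM [cabs a * _]mulrC ler_pdivlMr ?cabs_gt0.
Qed.

Lemma has_sum0 : has_sum (fun=> 0) 0.
Proof. by move=> e e0; exists fset0 => J _; rewrite big1 // subr0 cabs0 ltW. Qed.

Lemma has_sumN f l : has_sum f l -> has_sum (fun i => - f i) (- l).
Proof.
move=> /(has_sumZ (-1)); rewrite mulN1r; apply: eq_has_sum => i.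
by rewrite mulN1r.
Qed.

Lemma has_sumB f g l l' :
  has_sum f l -> has_sum g l' -> has_sum (fun i => f i - g i) (l - l').
Proof. by move=> h /has_sumN; exact: has_sumD. Qed.

Lemma has_sum_sum (T : Type) (r : seq T) (F : T -> I -> Cx R) (L : T -> Cx R) :
  (forall t, has_sum (F t) (L t)) ->
  has_sum (fun i => \sum_(t <- r) F t i) (\sum_(t <- r) L t).
Proof.
move=> h; elim: r => [|t r IH].
  rewrite big_nil; apply: eq_has_sum has_sum0 => i; by rewrite big_nil.
rewrite big_cons; apply: eq_has_sum (has_sumD (h t) IH) => i.
by rewrite big_cons.
Qed.

(** Partial sums over sets containing [S] differ from the sum over [S] only by terms outside [S].
    This isolates the main terms of a series in [theta_mean] and [dominance]. *)
Lemma has_sum_close f l S (B : R) : has_sum f l ->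
  (forall J, [disjoint J & S]%fset -> \sum_(i <- J) cabs (f i) <= B) ->
  cabs (l - \sum_(i <- S) f i) <= B.
Proof.
move=> hl hB; apply/ler_addgt0Pr => e e0.
have [J hJ] := hl _ e0.
rewrite [leRHS]addrC (le_trans (cabs_triangle (\sum_(i <- (J `|` S)%fset) f i) _ _)) //.
rewrite lerD //; first by rewrite cabsBC hJ // fsubsetUl.
rewrite (@big_fsetID _ _ _ _ (mem S) (J `|` S)%fset) /=.
have -> : \sum_(i <- [fset x in (J `|` S)%fset | x \in S]%fset) f i =
    \sum_(i <- S) f i.
  by apply: eq_fbigl => i; rewrite !inE /= andb_orl andbb; case: (i \in S); rewrite ?orbT ?andbF.
rewrite addrC addrK (le_trans (cabs_sum _ _ _)) // hB //.
by apply/fdisjointP => i; rewrite !inE /= => /andP[].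
Qed.

Lemma has_sum_le f l (B : R) : has_sum f l -> abs_bounded f B -> cabs l <= B.
Proof.
move=> hl hB; have := has_sum_close (S := fset0) hl (fun J _ => hB J).
by rewrite big_seq_fset0 subr0.
Qed.

Lemma real_has_sum (h : I -> R) (B : R) : (forall i, 0 <= h i) ->
  (forall J, \sum_(i <- J) h i <= B) -> exists s : R, has_sum (fun i => rc (h i)) (rc s).
Proof.
move=> h0 hB.
pose E := [set s : R | exists J : {fset I}, s = \sum_(i <- J) h i].
have supE : has_sup E.
  split; first by exists (\sum_(i <- fset0) h i), fset0.
  by exists B => _ [J ->].
exists (sup E) => e e0.
have [_ [J ->] hJ] := sup_adherent e0 supE.
exists J => K JK; rewrite -rc_sum -rcN -rcD cabs_rc distrC ger0_norm.
  rewrite lerBlDr -lerBlDl (le_trans (ltW hJ)) //.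
  rewrite (@big_fsetID _ _ _ _ (mem J) K) /= (_ : \sum_(i <- [fset x in K | x \in J]%fset) h i =
    \sum_(i <- J) h i).
    by rewrite lerDl sumr_ge0.
  apply: eq_fbigl => i; rewrite !inE /= andbC.
  by case: (boolP (i \in J)) => //= /(fsubsetP JK).
by rewrite subr_ge0 ub_le_sup //; [exact: supE.2 | exists K].
Qed.

Lemma abs_bounded_has_sum f B :
  abs_bounded f B -> has_sum f (summability.sum f).
Proof.
move=> fB.
(* Real and imaginary parts are differences of the two nonnegative families [cabs + u] and [cabs],
   whose sums are suprema. *)
have key (u : Cx R -> R) : (forall z, `|u z| <= cabs z) ->
    exists s : R, has_sum (fun i => rc (u (f i))) (rc s).
  move=> hu.
  have [a ha] := @real_has_sum (fun i => cabs (f i)) B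
    (fun i => cabs_ge0 _) fB.
  have [||b hb] := @real_has_sum (fun i => cabs (f i) + u (f i)) (B + B).
  - by move=> i; have := hu (f i); rewrite ler_norml => /andP[+ _]; rewrite -subr_ge0 opprK addrC.
  - move=> J; rewrite big_split /= lerD // (le_trans _ (fB J)) // ler_sum // => i _.
    exact: le_trans (ler_norm _) (hu _).
  exists (b - a); rewrite rcD rcN; apply: eq_has_sum (has_sumB hb ha) => i.
  by rewrite rcD addrC addKr.
have [a ha] := key _ (@Re_le_cabs R).
have [b hb] := key _ (@Im_le_cabs R).
have hl : has_sum f (rc a + (0 +i* 1) * rc b).
  apply: eq_has_sum (has_sumD ha (has_sumZ (0 +i* 1) hb)) => i.
  by rewrite [RHS]complex_split.
by rewrite (has_sumE hl).
Qed.

Lemma has_sum_reindex (u v : I -> I) f l : cancel u v -> cancel v u ->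
  has_sum f l -> has_sum (f \o u) l.
Proof.
move=> uK vK hl e e0; have [J hJ] := hl _ e0.
exists (v @` J)%fset => K hK.
have -> : \sum_(i <- K) (f \o u) i = \sum_(i <- (u @` K)%fset) f i.
  by rewrite big_imfset //= => i j _ _; exact: (can_inj uK).
apply: hJ; apply/fsubsetP => i iJ; apply/imfsetP; exists (v i); last by rewrite vK.
by apply: (fsubsetP hK); apply/imfsetP; exists i.
Qed.

End UnorderedSums.

Section ComplexExponential.
Variable R : realType.
Implicit Types (a b z : Cx R) (s : R).

Lemma cexpD a b : cexp (a + b) = cexp a * cexp b.
Proof.
rewrite /cexp ReD ImD expRD cosD sinD; case: a b => [x y] [u v] /=.
by apply/eqP; rewrite eq_complex /=; apply/andP; split; apply/eqP; ring.
Qed.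

Lemma cexp0 : cexp (0 : Cx R) = 1.
Proof. by rewrite /cexp /= expR0 cos0 sin0 !mul1r. Qed.

Lemma cexpN a : cexp (- a) = (cexp a)^-1.
Proof.
have h : cexp (- a) * cexp a = 1 by rewrite -cexpD addNr cexp0.
have a0 : cexp a != 0 by apply: contra_eq_neq h => ->; rewrite mulr0 eq_sym oner_eq0.
by apply: (mulIf a0); rewrite h mulVf.
Qed.

Lemma cexp_neq0 a : cexp a != 0.
Proof.
have h : cexp (- a) * cexp a = 1 by rewrite -cexpD addNr cexp0.
by apply: contra_eq_neq h => ->; rewrite mulr0 eq_sym oner_eq0.
Qed.

Lemma cabs_cexp a : cabs (cexp a) = expR (complex.Re a).
Proof.
rewrite cabsE /cexp /= !exprMn -mulrDr cos2Dsin2 mulr1 sqrtr_sqr.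
by rewrite ger0_norm // expR_ge0.
Qed.

Lemma cabs_cexp_le a : cabs (cexp a) <= expR (cabs a).
Proof. by rewrite cabs_cexp ler_expR (le_trans _ (Re_le_cabs a)) // ler_norm. Qed.

Definition has_cderiv (f f' : R -> Cx R) := forall s,
  is_derive s 1 (fun t => complex.Re (f t)) (complex.Re (f' s)) /\
  is_derive s 1 (fun t => complex.Im (f t)) (complex.Im (f' s)).

Lemma cderiv_mean_value f f' (M : R) : has_cderiv f f' ->
  (forall s, 0 <= s <= 1 -> cabs (f' s) <= M) -> cabs (f 1 - f 0) <= M.
Proof.
move=> ff' fM; set d := f 1 - f 0.
have [->|d0] := eqVneq d 0.
  by rewrite cabs0 (le_trans (cabs_ge0 (f' 0))) // fM // lexx ler01.
(* Project [f] on the direction of its increment [d]. *)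
pose psi (w : Cx R) := complex.Re d * complex.Re w + complex.Im d * complex.Im w.
have psiE w : psi w = complex.Re (d^*%C * w).
  by rewrite /psi; case: (d) w => [x y] [u v] /=; ring.
have psi_le w : psi w <= cabs d * cabs w.
  rewrite psiE (le_trans (ler_norm _)) // (le_trans (Re_le_cabs _)) // cabsM.
  by case: (d) => x y; rewrite /= !cabsE /= sqrrN.
have dpsi s : is_derive s 1 (fun t => psi (f t)) (psi (f' s)).
  have [h1 h2] := ff' s.
  have := is_deriveD (is_deriveZ (complex.Re d) h1) (is_deriveZ (complex.Im d) h2).
  exact.
have [|c c01 hc] := @MVT_segment R (fun t => psi (f t)) (fun t => psi (f' t)) 0 1 ler01.
  apply: derivable_within_continuous => x _.
  by have [] := dpsi x.
have psid : psi d = cabs d ^+ 2.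
  by rewrite cabsE sqr_sqrtr ?addr_ge0 ?sqr_ge0 // /psi !expr2.
have : psi d <= cabs d * M.
  have -> : psi d = psi (f 1) - psi (f 0).
    by rewrite /d /psi; case: (f 1) (f 0) => [x y] [u v] /=; ring.
  rewrite hc subr0 mulr1 (le_trans (psi_le _)) // ler_wpM2l ?cabs_ge0 // fM //.
by rewrite psid expr2 ler_pM2l // cabs_gt0.
Qed.

Lemma has_cderiv_cexp a : has_cderiv (fun s => cexp (rc s * a)) (fun s => a * cexp (rc s * a)).
Proof.
have ReM s : complex.Re (rc s * a) = s * complex.Re a.
  by case: (a) => x y /=; rewrite mul0r subr0.
have ImM s : complex.Im (rc s * a) = s * complex.Im a.
  by case: (a) => x y /=; rewrite mul0r addr0.
move=> s; split; rewrite /cexp /=.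
- have -> : (fun t => expR (complex.Re (rc t * a)) * cos (complex.Im (rc t * a))) =
      (fun t => expR (t * complex.Re a) * cos (t * complex.Im a)).
    by apply/funext => t; rewrite ReM ImM.
  apply: is_derive_eq; rewrite ReM ImM /GRing.scale /=.
  case: a {ReM ImM} => x y /=; ring.
- have -> : (fun t => expR (complex.Re (rc t * a)) * sin (complex.Im (rc t * a))) =
      (fun t => expR (t * complex.Re a) * sin (t * complex.Im a)).
    by apply/funext => t; rewrite ReM ImM.
  apply: is_derive_eq; rewrite ReM ImM /GRing.scale /=.
  case: a {ReM ImM} => x y /=; ring.
Qed.

Lemma has_cderivB f f' h h' : has_cderiv f f' -> has_cderiv h h' ->
  has_cderiv (fun s => f s - h s) (fun s => f' s - h' s).
Proof.
have ReB (z w : Cx R) : complex.Re (z - w) = complex.Re z - complex.Re w.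
  by case: z w => [? ?] [? ?].
have ImB (z w : Cx R) : complex.Im (z - w) = complex.Im z - complex.Im w.
  by case: z w => [? ?] [? ?].
move=> hf hh s; have [h1 h2] := hf s; have [h3 h4] := hh s.
split.
- rewrite ReB (_ : (fun t => complex.Re (f t - h t)) =
    (fun t => complex.Re (f t) - complex.Re (h t))); last by apply/funext => t.
  exact: is_deriveB.
- rewrite ImB (_ : (fun t => complex.Im (f t - h t)) =
    (fun t => complex.Im (f t) - complex.Im (h t))); last by apply/funext => t.
  exact: is_deriveB.
Qed.

Lemma has_cderiv_cst a : has_cderiv (fun=> a) (fun=> 0).
Proof. by move=> s; split; exact: is_derive_cst. Qed.

Lemma has_cderiv_monomial a n :
  has_cderiv (fun s => rc (s ^+ n.+1) * a) (fun s => rc (s ^+ n) * (n.+1%:R * a)).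
Proof.
have ReM (t : R) : complex.Re (rc t * a) = t * complex.Re a.
  by case: (a) => x y /=; rewrite mul0r subr0.
have ImM (t : R) : complex.Im (rc t * a) = t * complex.Im a.
  by case: (a) => x y /=; rewrite mul0r addr0.
move=> s; rewrite mulrA -rc_nat -rcM.
have hn : is_derive s 1 (fun t => t ^+ n.+1) (s ^+ n * n.+1%:R).
  have := @is_deriveX R R id n.+1 s 1 1 (is_derive_id _ _).
  rewrite /GRing.scale /= mulr1 mulrC (_ : id ^+ n.+1 = fun t => t ^+ n.+1) //.
  by apply/funext => t; rewrite exprfctE.
split.
- rewrite ReM mulrC (_ : (fun t => complex.Re (rc (t ^+ n.+1) * a)) =
    complex.Re a *: (fun t => t ^+ n.+1)); first exact: is_deriveZ.
  by apply/funext => t; rewrite ReM mulrC.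
- rewrite ImM mulrC (_ : (fun t => complex.Im (rc (t ^+ n.+1) * a)) =
    complex.Im a *: (fun t => t ^+ n.+1)); first exact: is_deriveZ.
  by apply/funext => t; rewrite ImM mulrC.
Qed.

Lemma cabs_rcM s a : 0 <= s <= 1 -> cabs (rc s * a) <= cabs a.
Proof.
by case/andP=> s0 s1; rewrite cabsM cabs_rc ger0_norm // ler_piMl // cabs_ge0.
Qed.

(** Start of a chain of Taylor bounds: along s a, for s in [0, 1], the derivative of each remainder
    is [a] times the preceding remainder at s a, so the mean value inequality adds one factor
    [cabs a] each time. *)
Lemma cexp_sub1_le a : cabs (cexp a - 1) <= cabs a * expR (cabs a).
Proof.
have := cderiv_mean_value (M := cabs a * expR (cabs a))
  (has_cderivB (has_cderiv_cexp a) (has_cderiv_cst 1)).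
rewrite rc0 rc1 mul0r mul1r cexp0 subrr !subr0; apply => s s01.
rewrite subr0 cabsM ler_wpM2l ?cabs_ge0 // (le_trans (cabs_cexp_le _)) // ler_expR.
exact: cabs_rcM.
Qed.

Lemma cexp_taylor1 a : cabs (cexp a - 1 - a) <= cabs a ^+ 2 * expR (cabs a).
Proof.
have := cderiv_mean_value (M := cabs a ^+ 2 * expR (cabs a))
  (has_cderivB (has_cderivB (has_cderiv_cexp a) (has_cderiv_cst 1))
    (has_cderiv_monomial a 0)).
rewrite /= !expr1 rc0 rc1 !mul0r !mul1r cexp0 !subrr !subr0; apply => s s01.
rewrite subr0.
have -> : a * cexp (rc s * a) - a = a * (cexp (rc s * a) - 1) by ring.
rewrite cabsM expr2 -mulrA.
rewrite ler_wpM2l ?cabs_ge0 // (le_trans (cexp_sub1_le _)) //.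
by rewrite ler_pM ?cabs_ge0 ?expR_ge0 ?ler_expR ?cabs_rcM.
Qed.

Lemma cexp_taylor2 a :
  cabs (cexp a - 1 - a - a ^+ 2 / 2) <= cabs a ^+ 3 * expR (cabs a).
Proof.
have := cderiv_mean_value (M := cabs a ^+ 3 * expR (cabs a))
  (has_cderivB (has_cderivB (has_cderivB (has_cderiv_cexp a) (has_cderiv_cst 1))
    (has_cderiv_monomial a 0)) (has_cderiv_monomial (a ^+ 2 / 2) 1)).
rewrite /= !expr1 expr0n expr1n /= rc0 rc1 !mul0r !mul1r cexp0 !subrr !subr0; apply => s s01.
rewrite subr0.
have -> : a * cexp (rc s * a) - a - rc s * (2 * (a ^+ 2 / 2)) =
    a * (cexp (rc s * a) - 1 - rc s * a) by field.
rewrite cabsM (exprS _ 2) -mulrA.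
rewrite ler_wpM2l ?cabs_ge0 // (le_trans (cexp_taylor1 _)) //.
by rewrite ler_pM ?expR_ge0 ?exprn_ge0 ?lerXn2r ?nnegrE ?ler_expR ?cabs_rcM ?cabs_ge0.
Qed.

Definition ipi : Cx R := 0 +i* pi.

Lemma cexp_ipi_nat n : cexp (ipi * n%:R) = (-1) ^+ n.
Proof.
elim: n => [|n IH]; first by rewrite mulr0 cexp0.
rewrite exprS -IH -[n.+1]add1n natrD mulrDr cexpD mulr1; congr (_ * _).
rewrite /cexp /= expR0 cospi sinpi mulr0 mul1r.
by apply/eqP; rewrite eq_complex /= oppr0 !eqxx.
Qed.

Lemma cexp_ipi_int (n : int) : cexp (ipi * n%:~R) = (-1) ^+ `|n|%N.
Proof.
case: n => n; first by rewrite cexp_ipi_nat.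
rewrite NegzE mulrNz mulrN cexpN cexp_ipi_nat abszN absz_nat.
by rewrite -exprVn invrN1.
Qed.

Lemma cexp_ipi_even (n : int) : cexp (ipi * (2 * n%:~R)) = 1.
Proof.
have -> : 2 * n%:~R = (2 * n)%:~R :> Cx R by rewrite intrM.
rewrite cexp_ipi_int abszM /= -signr_odd oddM /= expr0 //.
Qed.

End ComplexExponential.

(** * Complex vectors: bilinear pairing, l1 norm and quadratic forms *)

Section Vectors.
Variables (R : realType) (g : nat).
Implicit Types (x y z : 'cV[Cx R]_g) (a : Cx R) (m n : 'cV[int]_g).

Definition dot x y : Cx R := (x^T *m y) 0 0.
Definition iv m : 'cV[Cx R]_g := map_mx (intr : int -> Cx R) m.
Definition n1 x : R := \sum_j cabs (x j 0).

Lemma dotE x y : dot x y = \sum_j x j 0 * y j 0.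
Proof. by rewrite /dot mxE; apply: eq_bigr => j _; rewrite mxE. Qed.

Lemma dotC x y : dot x y = dot y x.
Proof. by rewrite !dotE; apply: eq_bigr => j _; rewrite mulrC. Qed.

Lemma dotDl x y z : dot (x + y) z = dot x z + dot y z.
Proof. by rewrite /dot linearD /= mulmxDl mxE. Qed.

Lemma dotDr x y z : dot x (y + z) = dot x y + dot x z.
Proof. by rewrite /dot mulmxDr mxE. Qed.

Lemma dotZl a x y : dot (a *: x) y = a * dot x y.
Proof. by rewrite /dot linearZ /= -scalemxAl mxE. Qed.

Lemma dotZr a x y : dot x (a *: y) = a * dot x y.
Proof. by rewrite /dot -scalemxAr mxE. Qed.

Lemma dotNl x y : dot (- x) y = - dot x y.
Proof. by rewrite -scaleN1r dotZl mulN1r. Qed.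

Lemma dotNr x y : dot x (- y) = - dot x y.
Proof. by rewrite -scaleN1r dotZr mulN1r. Qed.

Lemma dot0r x : dot x 0 = 0.
Proof. by rewrite /dot mulmx0 mxE. Qed.

Lemma dot_delta x j : dot x (delta_mx j 0) = x j 0.
Proof.
rewrite dotE (bigD1 j) //= mxE !eqxx mulr1 big1 ?addr0 // => i /negPf h.
by rewrite mxE h mulr0.
Qed.

Lemma dot_mulmx (A : 'M[Cx R]_g) x y : dot x (A *m y) = dot (A^T *m x) y.
Proof. by rewrite /dot trmx_mul trmxK mulmxA. Qed.

Lemma ivD m n : iv (m + n) = iv m + iv n. Proof. exact: map_mxD. Qed.
Lemma ivN m : iv (- m) = - iv m. Proof. exact: map_mxN. Qed.
Lemma iv0 : iv 0 = 0. Proof. exact: map_mx0. Qed.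
Lemma iv_delta j : iv (delta_mx j 0) = delta_mx j 0.
Proof. by apply/matrixP => i k; rewrite !mxE; case: (_ && _). Qed.

Lemma n1_ge0 x : 0 <= n1 x.
Proof. by apply: sumr_ge0 => j _; exact: cabs_ge0. Qed.

Lemma n1D x y : n1 (x + y) <= n1 x + n1 y.
Proof.
by rewrite /n1 -big_split ler_sum // => j _; rewrite mxE cabsD.
Qed.

Lemma n1Z a x : n1 (a *: x) = cabs a * n1 x.
Proof. by rewrite /n1 mulr_sumr; apply: eq_bigr => j _; rewrite mxE cabsM. Qed.

Lemma n1N x : n1 (- x) = n1 x.
Proof. by rewrite -scaleN1r n1Z cabsN cabs1 mul1r. Qed.

Lemma n10 : n1 0 = 0.
Proof. by rewrite /n1 big1 // => j _; rewrite mxE cabs0. Qed.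

Lemma n1_delta j : n1 (delta_mx j 0) = 1.
Proof.
rewrite /n1 (bigD1 j) //= mxE !eqxx cabs1 big1 ?addr0 // => i /negPf h.
by rewrite mxE h cabs0.
Qed.

Lemma cabs_le_n1 x j : cabs (x j 0) <= n1 x.
Proof.
by rewrite /n1 (bigD1 j) //= lerDl sumr_ge0 // => i _; exact: cabs_ge0.
Qed.

Lemma cabs_dot x y : cabs (dot x y) <= n1 x * n1 y.
Proof.
rewrite dotE (le_trans (cabs_sum _ _ _)) // /n1 mulr_suml ler_sum // => j _.
by rewrite cabsM ler_wpM2l ?cabs_ge0 // cabs_le_n1.
Qed.

Lemma n1_mulmx (A : 'M[Cx R]_g) : exists2 C, 0 < C & forall x, n1 (A *m x) <= C * n1 x.
Proof.
exists (1 + \sum_i n1 (row i A)^T).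
  by rewrite ltr_pwDl // sumr_ge0 // => i _; exact: n1_ge0.
move=> x; rewrite mulrDl mul1r (le_trans _ (_ : (\sum_i n1 (row i A)^T) * n1 x <= _)) //; last first.
  by rewrite lerDr n1_ge0.
rewrite mulr_suml ler_sum // => i _.
suff -> : (A *m x) i 0 = dot (row i A)^T x by exact: cabs_dot.
by rewrite /dot trmxK mxE [RHS]mxE; apply: eq_bigr => j _; rewrite mxE.
Qed.

Definition qform (S : 'M[Cx R]_g) x : Cx R := dot x (S *m x).

Lemma qformD (S : 'M[Cx R]_g) x y : S^T = S ->
  qform S (x + y) = qform S x + 2 * dot x (S *m y) + qform S y.
Proof.
move=> hS; rewrite /qform mulmxDr !dotDl !dotDr.
rewrite [dot y (S *m x)]dot_mulmx hS [dot (S *m y) x]dotC; ring.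
Qed.

Lemma qformZ (S : 'M[Cx R]_g) a x : qform S (a *: x) = a ^+ 2 * qform S x.
Proof. by rewrite /qform -scalemxAr dotZl dotZr mulrA expr2. Qed.

End Vectors.

(** * Uniqueness of quasi-periodic functions *)

Section NullSequences.
Variable R : realType.
Implicit Types (u v : nat -> Cx R).

Definition null u := forall e : R, 0 < e ->
  exists N0, forall N, (N0 <= N)%N -> cabs (u N) <= e.

Lemma eq_null u v : u =1 v -> null u -> null v.
Proof. by move=> /funext ->. Qed.

Lemma null0 : null (fun=> 0).
Proof. by move=> e e0; exists 0%N => N _; rewrite cabs0 ltW. Qed.

Lemma nullD u v : null u -> null v -> null (fun N => u N + v N).
Proof.
move=> hu hv e e0; have e2 := divr_gt0 e0 (ltr0Sn R 1).
have [n hn] := hu _ e2; have [m hm] := hv _ e2.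
exists (maxn n m) => N; rewrite geq_max => /andP[h1 h2].
by rewrite (le_trans (cabsD _ _)) // (splitr e) lerD // ?hn ?hm.
Qed.

Lemma nullM u v (B : R) : null u -> (forall N, cabs (v N) <= B) ->
  null (fun N => u N * v N).
Proof.
move=> hu hv e e0; have B0 : 0 <= B := le_trans (cabs_ge0 _) (hv 0%N).
have B1 : 0 < B + 1 by rewrite ltr_wpDl.
have [n hn] := hu _ (divr_gt0 e0 B1); exists n => N /hn h.
rewrite cabsM -[e](divfK (lt0r_neq0 B1)) ler_pM ?cabs_ge0 //.
by rewrite (le_trans (hv N)) // lerDl.
Qed.

Lemma nullZ u a : null u -> null (fun N => a * u N).
Proof.
move=> hu; apply: (eq_null (u := fun N => u N * a)) => [N|]; first by rewrite mulrC.
exact: (nullM (B := cabs a) hu).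
Qed.

Lemma nullN u : null u -> null (fun N => - u N).
Proof. by move=> /(nullZ (-1)); apply: eq_null => N; rewrite mulN1r. Qed.

Lemma nullB u v : null u -> null v -> null (fun N => u N - v N).
Proof. by move=> hu /nullN; exact: nullD. Qed.

Lemma null_cst a : null (fun=> a) -> a = 0.
Proof.
move=> h; apply/eqP; rewrite -cabs_eq0 eq_le cabs_ge0 andbT.
apply/ler_addgt0Pr => e e0; rewrite add0r; have [N hN] := h e e0.
exact: hN (leqnn N).
Qed.

Lemma null_inv u (C : R) : (forall N, cabs (u N) <= C / N.+1%:R) -> null u.
Proof.
move=> hu e e0.
have [n hn] : exists n : nat, C / e <= n%:R.
  exists (Num.bound `|C / e|); rewrite (le_trans (ler_norm _)) // ltW //.
  exact: archi_boundP.
exists n => N nN; rewrite (le_trans (hu N)) // ler_pdivrMr // mulrC -ler_pdivrMr //.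
by rewrite (le_trans hn) // ler_nat leqW.
Qed.

End NullSequences.

(** * Means over finite grids of the torus *)

Section GridAverages.
Variables (R : realType) (g : nat).

Definition gpt N (k : {ffun 'I_g -> 'I_N.+1}) : 'cV[Cx R]_g :=
  \col_j rc ((k j)%:R / N.+1%:R).

(** Discrete stand-in for the integral over (R/Z)^g. *)
Definition gavg N (F : {ffun 'I_g -> 'I_N.+1} -> Cx R) : Cx R :=
  (N.+1%:R ^+ g)^-1 * \sum_k F k.

Lemma gavgD N (F G : {ffun 'I_g -> 'I_N.+1} -> Cx R) :
  gavg (fun k => F k + G k) = gavg F + gavg G.
Proof. by rewrite /gavg big_split mulrDr. Qed.

Lemma gavgZ N (F : {ffun 'I_g -> 'I_N.+1} -> Cx R) a :
  gavg (fun k => a * F k) = a * gavg F.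
Proof. by rewrite /gavg -mulr_sumr mulrCA. Qed.

Lemma eq_gavg N (F G : {ffun 'I_g -> 'I_N.+1} -> Cx R) : F =1 G -> gavg F = gavg G.
Proof. by move=> /funext ->. Qed.

Lemma gavgB N (F G : {ffun 'I_g -> 'I_N.+1} -> Cx R) :
  gavg (fun k => F k - G k) = gavg F - gavg G.
Proof.
rewrite (eq_gavg (G := fun k => F k + (-1) * G k)) => [|k]; last by rewrite mulN1r.
by rewrite gavgD gavgZ mulN1r.
Qed.

Lemma gavg_cst N a : gavg (fun _ : {ffun 'I_g -> 'I_N.+1} => a) = a.
Proof.
by rewrite /gavg sumr_const card_ffun !card_ord -[a *+ _]mulr_natl natrX mulKf.
Qed.

Lemma cabs_gavg N (F : {ffun 'I_g -> 'I_N.+1} -> Cx R) (u : _ -> R) :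
  (forall k, cabs (F k) <= u k) -> rc (cabs (gavg F)) <= gavg (fun k => rc (u k)).
Proof.
move=> h; have M0 : 0 <= (N.+1%:R ^+ g)^-1 :> R by rewrite invr_ge0 exprn_ge0.
have ME : ((N.+1%:R ^+ g)^-1 : Cx R) = rc ((N.+1%:R ^+ g)^-1).
  by rewrite rcV -!natrX rc_nat.
rewrite /gavg -rc_sum ME -rcM lecR cabsM cabs_rc ger0_norm // ler_wpM2l //.
by rewrite (le_trans (cabs_sum _ _ _)) // ler_sum.
Qed.

Lemma cabs_gavg_le N (F : {ffun 'I_g -> 'I_N.+1} -> Cx R) (B : R) :
  (forall k, cabs (F k) <= B) -> cabs (gavg F) <= B.
Proof. by move=> /cabs_gavg; rewrite gavg_cst lecR. Qed.

Lemma n1_gpt N (k : {ffun 'I_g -> 'I_N.+1}) : n1 (gpt k) <= g%:R.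
Proof.
rewrite /n1 (le_trans (_ : _ <= \sum_(j < g) 1)) //; last by rewrite sumr_const card_ord.
rewrite ler_sum // => j _; rewrite mxE cabs_rc ger0_norm ?divr_ge0 //.
by rewrite ler_pdivrMr // mul1r ler_nat ltnW.
Qed.

(** A shift by one mesh permutes the grid cyclically modulo integer vectors, which periodicity
    absorbs. *)
Lemma gavg_shift (f : 'cV[Cx R]_g -> Cx R) N z j :
  (forall m y, f (y + iv R m) = f y) ->
  gavg (fun k : {ffun 'I_g -> 'I_N.+1} => f (z + rc (N.+1%:R^-1) *: delta_mx j 0 + gpt k)) =
  gavg (fun k : {ffun 'I_g -> 'I_N.+1} => f (z + gpt k)).
Proof.
move=> fper; rewrite /gavg; congr (_ * _).
pose s (k : {ffun 'I_g -> 'I_N.+1}) := [ffun i => if i == j then ordS (k i) else k i].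
pose p (k : {ffun 'I_g -> 'I_N.+1}) := [ffun i => if i == j then ord_pred (k i) else k i].
have spK : cancel s p.
  by move=> k; apply/ffunP => i; rewrite !ffunE; case: eqP => // _; rewrite ordSK.
have psK : cancel p s.
  by move=> k; apply/ffunP => i; rewrite !ffunE; case: eqP => // _; rewrite ord_predK.
rewrite [RHS](reindex s) /=; last by exists p => k _; [exact: spK | exact: psK].
apply: eq_bigr => k _.
(* [m] is the carry, nonzero only when coordinate [j] wraps around. *)
pose m : 'cV[int]_g := if ((k j).+1 == N.+1)%N then delta_mx j 0 else 0.
rewrite -(fper m (z + gpt (s k))); congr f.
rewrite -!addrA; congr (_ + _); apply/matrixP => i i0; rewrite (ord1 i0) {i0}.
rewrite !mxE ffunE /m.
have M0 : (N.+1%:R : R) != 0 by rewrite pnatr_eq0.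
have [->|ij] := eqVneq i j; last first.
  rewrite (_ : (if _ then _ else _ : 'cV[int]_g) i 0 = 0); last first.
    by case: ifP => _; rewrite mxE // (negPf ij).
  by rewrite /= mulr0 add0r addr0.
rewrite /= mulr1 -rcD; case: ifP => [/eqP h|/negbT h].
  rewrite h modnn mxE !eqxx mul0r rc0 add0r -rc1; congr rc.
  by rewrite -[X in X + _]mul1r -mulrDl addrC natr1 h divff.
rewrite mxE addr0; congr rc; rewrite modn_small; last first.
  by rewrite ltn_neqAle h /= ltn_ord.
by rewrite -[(k j).+1%:R]natr1 mulrDl mul1r addrC.
Qed.

End GridAverages.

Section TestFunctions.
Variables (R : realType) (g : nat).
Variable G : forall N, {ffun 'I_g -> 'I_N.+1} -> Cx R.
Local Notation gridfun := (forall N, {ffun 'I_g -> 'I_N.+1} -> Cx R).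
Local Notation ipi := (ipi R).

(** Asymptotic vanishing of Fourier coefficients, one frequency at a time. Multiplying [phi] by a
    trigonometric polynomial mixes finitely many of them and so preserves the property. *)
Definition orthogonal_to_characters (phi : gridfun) := forall m : 'cV[int]_g,
  null (fun N => gavg (fun k => G k * phi N k * cexp (- (2 * ipi) * dot (iv R m) (gpt R k)))).

Definition cos2 N (j : 'I_g) (k : {ffun 'I_g -> 'I_N.+1}) : R :=
  cos (pi * ((k j)%:R / N.+1%:R)) ^+ 2.

Lemma cos2E N (j : 'I_g) (k : {ffun 'I_g -> 'I_N.+1}) :
  rc (cos2 j k) = (1 / 2) + (1 / 4) *
    (cexp (- (2 * ipi) * dot (iv R (delta_mx j 0)) (gpt R k)) +
     cexp (- (2 * ipi) * dot (iv R (- delta_mx j 0)) (gpt R k))).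
Proof.
rewrite ivN dotNl iv_delta dotC dot_delta mxE /cos2; set x := _ / _.
set E := cexp (ipi * rc x).
have E0 : E != 0 by exact: cexp_neq0.
have EE : cexp (- (2 * ipi) * - rc x) = E * E.
  by rewrite -cexpD; congr cexp; ring.
have EV : cexp (- (2 * ipi) * rc x) = E^-1 * E^-1.
  by rewrite -cexpN -cexpD; congr cexp; ring.
rewrite EE EV.
have ReE : ipi * rc x = 0 +i* (pi * x) :> Cx R.
  by apply/eqP; rewrite eq_complex /=; apply/andP; split; apply/eqP; ring.
have -> : rc (cos (pi * x) ^+ 2) = ((E + E^-1) / 2) ^+ 2.
  rewrite /E -cexpN ReE /cexp /= !oppr0 expR0 !mul1r cosN sinN expr2 rcM -expr2; congr (_ ^+ 2).
  have -> : (cos (pi * x) +i* sin (pi * x) + cos (pi * x) +i* - sin (pi * x) : Cx R) =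
      2 * rc (cos (pi * x)).
    by apply/eqP; rewrite eq_complex /=; apply/andP; split; apply/eqP; ring.
  by field.
by field.
Qed.

(** By [cos2E] the new coefficient at [m] combines the old ones at [m] and at [m] plus or minus the
    j-th basis vector. *)
Lemma orthogonal_mul_cos2 phi j : orthogonal_to_characters phi ->
  orthogonal_to_characters (fun N k => phi N k * rc (cos2 j k)).
Proof.
move=> h m.
pose u (n : 'cV[int]_g) N : Cx R := gavg (fun k : {ffun 'I_g -> 'I_N.+1} =>
  G k * phi N k * cexp (- (2 * ipi) * dot (iv R n) (gpt R k))).
apply: (eq_null (u := fun N => (1 / 2) * u m N +
  (1 / 4) * (u (m + delta_mx j 0) N + u (m + - delta_mx j 0) N))).
  move=> N; rewrite /u -gavgD -!gavgZ -gavgD; apply: eq_gavg => k.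
  have cD m1 m2 : cexp (- (2 * ipi) * dot (iv R (m1 + m2)) (gpt R k)) =
      cexp (- (2 * ipi) * dot (iv R m1) (gpt R k)) * cexp (- (2 * ipi) * dot (iv R m2) (gpt R k)).
    by rewrite ivD dotDl mulrDr cexpD.
  have alg (a b x y z : Cx R) : 1 / 2 * (a * b * x) + 1 / 4 * (a * b * (x * y) + a * b * (x * z)) =
      a * (b * (1 / 2 + 1 / 4 * (y + z))) * x by ring.
  rewrite cos2E; apply: etrans (alg _ _ _ _ _).
  by congr (_ + _ * (_ * _ + _ * _)); exact: cD.
apply: nullD; apply: nullZ; first exact: h.
by apply: nullD; exact: h.
Qed.

(** A nonnegative trigonometric polynomial that concentrates at the integer points as [n] grows. *)
Definition peak n N (k : {ffun 'I_g -> 'I_N.+1}) : R := \prod_j cos2 j k ^+ n.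

Lemma orthogonal_peak n : orthogonal_to_characters (fun N k => 1) ->
  orthogonal_to_characters (fun N k => rc (peak n k)).
Proof.
move=> h.
have hs (s : seq 'I_g) :
    orthogonal_to_characters (fun N k => rc (\prod_(j <- s) cos2 j k ^+ n)).
  elim: s => [|j s IH].
    rewrite (_ : (fun N (k : {ffun 'I_g -> 'I_N.+1}) => rc (\prod_(j <- [::]) _)) = fun N k => 1) //.
    by apply/functional_extensionality_dep => N; apply/funext => k; rewrite big_nil.
  have hn (p : nat) : orthogonal_to_characters
      (fun N k => rc (\prod_(j <- s) cos2 j k ^+ n) * rc (cos2 j k ^+ p)).
    elim: p => [|p IHp] m.
      by apply: eq_null (IH m) => N; apply: eq_gavg => k; rewrite expr0 rc1 mulr1.
    apply: eq_null (orthogonal_mul_cos2 j IHp m) => N; apply: eq_gavg => k.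
    by rewrite exprSr [in RHS]rcM !mulrA.
  move=> m; apply: eq_null (hn n m) => N; apply: eq_gavg => k.
  by rewrite big_cons [in RHS]rcM [in RHS](mulrC (rc (_ ^+ _))).
exact: hs.
Qed.

End TestFunctions.

Section PeakedKernel.
Variable R : realType.

Lemma cos2_far (eta x : R) : 0 < eta -> eta <= 2^-1 -> eta <= x <= 1 - eta ->
  cos (pi * x) ^+ 2 <= cos (pi * eta) ^+ 2.
Proof.
move=> e0 e1 /andP[h1 h2]; have pi0 := pi_gt0 R.
have ce : 0 <= cos (pi * eta).
  by apply: cos_ge0_pihalf; apply/andP; split; nra.
have mono a b : 0 <= a -> a <= b -> b <= pi -> cos b <= cos (a : R).
  move=> a0 ab bp; rewrite leNgt ltr_cos ?in_itv /=; last 2 first.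
  - by apply/andP; split; lra.
  - by apply/andP; split; lra.
  by rewrite -leNgt.
rewrite -[leLHS]real_normK ?num_real // lerXn2r ?nnegrE // ler_norml.
apply/andP; split; last by apply: mono; nra.
have -> : cos (pi * x) = - cos (pi * (1 - x)).
  by rewrite mulrBr mulr1 addrC cosDpi cosN opprK.
by rewrite lerN2; apply: mono; nra.
Qed.

Lemma cos2_far_lt1 (eta : R) : 0 < eta -> eta <= 2^-1 -> cos (pi * eta) ^+ 2 < 1.
Proof.
move=> e0 e1; have pi0 := pi_gt0 R.
have : 0 < sin (pi * eta) by apply: sin_gt0_pi; apply/andP; split; nra.
by move=> s0; rewrite cos2sin2 ltrBlDl ltrDr exprn_gt0.
Qed.

(** Far from the lattice the kernel is bounded through a single coordinate, whereas near it all [g]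
    factors must be bounded below; hence the power [g]. The strict inequality makes n-th powers of
    near values win over far ones. *)
Lemma cos2_near (g : nat) (rho : R) : rho < 1 ->
  exists2 q : nat, (1 < q)%N & rho < (cos (pi * q%:R^-1) ^+ 2) ^+ g.
Proof.
move=> rho1.
pose F (x : R) := cos (pi * x) ^+ (2 * g).
have Fc : {for 0, continuous F}.
  apply: (@continuous_comp _ _ _ (fun x => cos (pi * x)) (fun y => y ^+ (2 * g))).
    apply: (@continuous_comp _ _ _ (fun x => pi * x) cos); last exact: continuous_cos.
    exact: mulrl_continuous.
  exact: exprn_continuous.
have F0 : F 0 = 1 by rewrite /F mulr0 cos0 expr1n.
have := @cvgr_gt R R (nbhs (0 : R)) _ F (F 0) Fc rho.
rewrite F0 => /(_ _ rho1) /nbhs_ballP[/= d d0 hd].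
have [q hq] : exists q : nat, d^-1 < q%:R.
  exists (Num.bound `|d^-1|); rewrite (le_lt_trans (ler_norm _)) //.
  exact: archi_boundP.
have q0 : 0 < q%:R :> R by rewrite (lt_trans _ hq) // invr_gt0.
exists q.+2 => //; rewrite -exprM; apply: (hd).
rewrite /ball /= sub0r normrN ger0_norm ?invr_ge0 // invf_plt ?posrE //.
by rewrite (lt_trans hq) // ltr_nat ltnS leqnSn.
Qed.

End PeakedKernel.

Section GridUniqueness.
Variables (R : realType) (g : nat).
Local Notation grid N := ({ffun 'I_g -> 'I_N.+1}).

Lemma peak_ge0 n N (k : grid N) : 0 <= peak R n k.
Proof. by apply: prodr_ge0 => j _; rewrite exprn_ge0 // sqr_ge0. Qed.

Lemma cos2_le1 N j (k : grid N) : cos2 R j k <= 1.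
Proof. by rewrite /cos2 cos2sin2 gerBl sqr_ge0. Qed.

(** Nearness on the torus, where coordinates close to 1 are close to 0. *)
Definition near_origin (eta : R) N (k : grid N) :=
  [forall j, ((k j)%:R / N.+1%:R < eta) || (1 - eta < (k j)%:R / N.+1%:R)].

Lemma peak_far eta n N (k : grid N) : 0 < eta -> eta <= 2^-1 ->
  ~~ near_origin eta k -> peak R n k <= (cos (pi * eta) ^+ 2) ^+ n.
Proof.
move=> e0 e1 /forallPn[j]; rewrite negb_or -!leNgt => hj.
rewrite /peak (bigD1 j) //= -[leRHS]mulr1; apply: ler_pM.
- by rewrite /cos2 exprn_ge0 ?sqr_ge0.
- by apply: prodr_ge0 => i _; rewrite exprn_ge0 // sqr_ge0.
- by rewrite lerXn2r ?nnegrE ?sqr_ge0 // /cos2 cos2_far.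
rewrite -[leRHS](@big1_eq R 1 *%R _ (index_enum 'I_g) (fun i => i != j)).
by apply: ler_prod => i _; rewrite exprn_ge0 ?sqr_ge0 //= exprn_ile1 ?sqr_ge0 ?cos2_le1.
Qed.

Definition ravg N (u : grid N -> R) : R := (N.+1%:R ^+ g)^-1 * \sum_k u k.

Lemma rc_ravg N (u : grid N -> R) : rc (ravg u) = gavg (fun k => rc (u k)).
Proof. by rewrite /ravg /gavg rcM rcV -rc_sum -!natrX rc_nat. Qed.

(** The mean factors into [g] one-dimensional means. In each, more than (N + 1)/q indices i satisfy
    i/(N + 1) <= 1/q, where the squared cosine is at least [t]. The bound is uniform in [N]. *)
Lemma ravg_peak_ge (q n N : nat) : (1 < q)%N ->
  ((cos (pi * q%:R^-1 : R) ^+ 2) ^+ g) ^+ n * (q%:R ^+ g)^-1 <=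
  ravg (fun k : grid N => peak R n k).
Proof.
move=> q1; have qR : 0 < q%:R :> R by rewrite ltr0n ltnW.
set t : R := cos _ ^+ 2.
pose S : R := \sum_(i < N.+1) (cos (pi * (i%:R / N.+1%:R)) ^+ 2) ^+ n.
have -> : ravg (fun k : grid N => peak R n k) = (S / N.+1%:R) ^+ g.
  rewrite /ravg expr_div_n mulrC; congr (_ * _).
  rewrite /peak /cos2 /S.
  rewrite -(bigA_distr_bigA (fun (_ : 'I_g) (i : 'I_N.+1) => (cos (pi * (i%:R / N.+1%:R)) ^+ 2) ^+ n)).
  by rewrite prodr_const card_ord.
have M0 : 0 < N.+1%:R :> R by rewrite ltr0n.
pose s0 (i : 'I_N.+1) : bool := (i <= N.+1 %/ q)%N.
have t0 : 0 <= t by rewrite sqr_ge0.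
have ht (x : R) : 0 <= x -> x <= q%:R^-1 -> t <= cos (pi * x) ^+ 2.
  have q2 : q%:R^-1 <= 2^-1 :> R by rewrite lef_pV2 ?posrE // (ler_nat R 2).
  rewrite le_eqVlt => /orP[/eqP <- _|x0 xq].
    by rewrite mulr0 cos0 expr1n /t cos2sin2 gerBl sqr_ge0.
  by apply: cos2_far => //; [lra | apply/andP; split; lra].
rewrite -exprM mulnC exprM -exprVn -exprMn lerXn2r ?nnegrE //.
- by rewrite mulr_ge0 ?(exprn_ge0 _ t0) ?invr_ge0.
- by rewrite divr_ge0 // sumr_ge0 // => i _; rewrite exprn_ge0 // sqr_ge0.
rewrite ler_pdivlMr // -mulrA.
have h1 : \sum_(i < N.+1 | s0 i) t ^+ n <= S.
  rewrite /S [leRHS](bigID s0) /= -[leLHS]addr0 lerD //; last first.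
    by apply: sumr_ge0 => i _; rewrite exprn_ge0 // sqr_ge0.
  apply: ler_sum => i hi; rewrite lerXn2r ?nnegrE ?sqr_ge0 //.
  apply: ht; first by rewrite divr_ge0.
  rewrite ler_pdivrMr // mulrC ler_pdivlMr // -natrM ler_nat.
  by rewrite (leq_trans _ (leq_divM _ q)) // leq_mul2r (hi : (i <= N.+1 %/ q)%N) orbT.
apply: le_trans h1; rewrite sumr_const -[leRHS]mulr_natr ler_wpM2l ?(exprn_ge0 _ t0) //.
rewrite [leLHS]mulrC ler_pdivrMr // -natrM ler_nat.
have dN : (N.+1 %/ q < N.+1)%N by rewrite ltn_Pdiv.
rewrite (_ : #|_| = (N.+1 %/ q).+1); last first.
  have wi : injective (widen_ord dN) by move=> i j /(congr1 val) /= /val_inj.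
  rewrite -(card_ord (N.+1 %/ q).+1) -(fintype.card_image wi).
  apply: eq_card => i; apply/idP/fintype.imageP => [h|[j _ ->]].
    by exists (Ordinal (h : (i < (N.+1 %/ q).+1)%N)) => //; apply: val_inj.
  by rewrite -[_ \in _]/(j <= N.+1 %/ q)%N -ltnS.
by rewrite ltnW // ltn_ceil // ltnW.
Qed.

(** Approximate identity: the value at the origin times the mean of the kernel is the mean of [G]
    against the kernel, which tends to zero, minus that of the oscillation of [G], which is small
    near the origin by equicontinuity and tamed elsewhere by [peak_far]. *)
Lemma null_at_origin (G : forall N, grid N -> Cx R) (B : R) :
  (forall N k, cabs (G N k) <= B) ->
  (forall e : R, 0 < e -> exists2 eta : R, 0 < eta & forall N (k : grid N),
     near_origin eta k -> cabs (G N k - G N [ffun=> ord0]) <= e) ->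
  orthogonal_to_characters G (fun N k => 1) ->
  null (fun N => G N [ffun=> ord0]).
Proof.
move=> GB Gc Gorth e e0.
have e3 : 0 < e / 3 by rewrite divr_gt0.
have [eta1 eta1_gt0 heta1] := Gc _ e3.
pose eta := Num.min eta1 2^-1.
have eta0 : 0 < eta by rewrite lt_min eta1_gt0 invr_gt0 ltr0Sn.
have eta2 : eta <= 2^-1 by rewrite ge_min lexx orbT.
have heta N (k : grid N) : near_origin eta k -> cabs (G N k - G N [ffun=> ord0]) <= e / 3.
  move=> hk; apply: heta1; apply/forallP => j; have /forallP/(_ j) := hk.
  have h1 : eta <= eta1 by rewrite ge_min lexx.
  case/orP => h; apply/orP; [left | right]; first exact: lt_le_trans h h1.
  by apply: le_lt_trans h; rewrite lerD2l lerN2.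
set rho := cos (pi * eta) ^+ 2.
have rho1 : rho < 1 by exact: cos2_far_lt1.
have rho0 : 0 <= rho by rewrite sqr_ge0.
have [q q1 hq] := cos2_near g rho1.
set r := (_ ^+ 2) ^+ g in hq.
have r0 : 0 < r by exact: le_lt_trans hq.
have B0 : 0 <= B := le_trans (cabs_ge0 _) (GB 0%N [ffun=> ord0]).
have qg : 0 < q%:R ^+ g :> R by rewrite exprn_gt0 // ltr0n ltnW.
have rr0 : 0 <= rho / r by rewrite divr_ge0 // ltW.
have rr1 : `|rho / r| < 1 by rewrite ger0_norm // ltr_pdivrMr // mul1r.
(* This [n], chosen before [N], makes the far part negligible against the lower bound for the mean
   of the kernel. *)
have [n hn] : exists n, 2 * B * rho ^+ n <= e / 3 * (r ^+ n * (q%:R ^+ g)^-1).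
  have h := cvg_expr rr1.
  pose d := e / 3 * (q%:R ^+ g)^-1 / (2 * B + 1).
  have B1 : 0 < 2 * B + 1 by lra.
  have d0 : 0 < d by rewrite !divr_gt0 // mulr_gt0.
  have /cvgrPdist_le/(_ d d0)[n _ /(_ n (leqnn n))/=] := h.
  rewrite sub0r normrN ger0_norm ?exprn_ge0 // expr_div_n => hd.
  exists n; have rn : 0 < r ^+ n by rewrite exprn_gt0.
  move: hd; rewrite ler_pdivrMr // => hd.
  apply: le_trans (_ : (2 * B + 1) * rho ^+ n <= _).
    by rewrite ler_wpM2r ?(exprn_ge0 _ rho0) //; lra.
  rewrite -ler_pdivlMl //; apply: le_trans hd _; rewrite /d.
  by rewrite le_eqVlt; apply/orP; left; apply/eqP; field; rewrite !lt0r_neq0.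
set a := r ^+ n * _ in hn.
have a0 : 0 < a by rewrite mulr_gt0 ?invr_gt0 // exprn_gt0.
have [N0 hN0] := @orthogonal_peak R g G n Gorth 0 _ (mulr_gt0 e3 a0).
exists N0 => N /hN0; under eq_gavg do rewrite iv0 dotC dot0r mulr0 cexp0 mulr1.
set G0 := G N _ => hN.
pose K := ravg (fun k : grid N => peak R n k).
have aK : a <= K by exact: ravg_peak_ge.
have K0 : 0 < K := lt_le_trans a0 aK.
have split : G0 * rc K = gavg (fun k : grid N => G N k * rc (peak R n k)) -
    gavg (fun k : grid N => (G N k - G0) * rc (peak R n k)).
  rewrite -gavgB rc_ravg -gavgZ; apply: eq_gavg => k; ring.
have bound : cabs (gavg (fun k : grid N => (G N k - G0) * rc (peak R n k))) <=
    e / 3 * K + 2 * B * rho ^+ n.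
  have := @cabs_gavg R g N (fun k => (G N k - G0) * rc (peak R n k))
    (fun k => e / 3 * peak R n k + 2 * B * rho ^+ n).
  rewrite -rc_ravg lecR; have -> : ravg (fun k : grid N => e / 3 * peak R n k + 2 * B * rho ^+ n) =
      e / 3 * K + 2 * B * rho ^+ n.
    apply: complexI; rewrite -/(rc _) -/(rc _) rc_ravg rcD [rc (_ * K)]rcM rc_ravg.
    rewrite -gavgZ -[rc (2 * B * _)](@gavg_cst R g N) -gavgD.
    by apply: eq_gavg => k; rewrite rcD rcM.
  apply => k; rewrite cabsM cabs_rc ger0_norm ?peak_ge0 //.
  have [hk|hk] := boolP (near_origin eta k).
    rewrite -[leLHS]addr0 lerD ?ler_wpM2r ?peak_ge0 ?heta //.
    by rewrite !mulr_ge0 ?(exprn_ge0 _ rho0).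
  rewrite -[leLHS]add0r lerD ?(mulr_ge0 (ltW e3)) ?peak_ge0 //.
  rewrite ler_pM ?cabs_ge0 ?peak_ge0 ?peak_far //.
  by rewrite (le_trans (cabsB _ _)) // mulr2n mulrDl mul1r lerD ?GB.
have K_neq0 := lt0r_neq0 K0.
rewrite -(ler_pM2r K0); have -> : cabs G0 * K = cabs (G0 * rc K).
  by rewrite cabsM cabs_rc ger0_norm // ltW.
rewrite split (le_trans (cabsB _ _)) //.
apply: le_trans (lerD hN bound) _.
have h3 : e / 3 * a <= e / 3 * K by rewrite ler_wpM2l // ltW.
by lra.
Qed.

End GridUniqueness.

(** * Functions with complex first-order expansions, and their grid means *)

Section LocallyBoundedHolomorphy.
Variables (R : realType) (g : nat).
Implicit Types (f : 'cV[Cx R]_g -> Cx R) (y z v w : 'cV[Cx R]_g).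

(* First-order expansions along complex lines, with a remainder that is
   uniformly quadratic on bounded sets. *)
Definition tame f := forall r : R, exists C : R, forall z, n1 z <= r ->
  cabs (f z) <= C /\
  forall v, n1 v <= r -> exists l : Cx R, forall h : Cx R, cabs h <= 1 ->
    cabs (f (z + h *: v) - f z - l * h) <= C * cabs h ^+ 2.

Definition periodic f := forall (m : 'cV[int]_g) y, f (y + iv R m) = f y.

Lemma tame_lipschitz f r : tame f -> exists C : R, forall z, n1 z <= r ->
  cabs (f z) <= C /\ forall v h, n1 v <= 1 -> cabs h <= 1 ->
    cabs (f (z + h *: v) - f z) <= C * cabs h.
Proof.
move=> ft; pose r1 := Num.max (r + 1) 1.
have rr1 : r + 1 <= r1 by rewrite le_max lexx.
have r11 : 1 <= r1 by rewrite le_max lexx orbT.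
have [C hC] := ft r1.
exists (4 * C) => z zr.
have zr1 : n1 z <= r1 by rewrite (le_trans _ rr1) // (le_trans zr) // lerDl.
have [hz hv] := hC z zr1.
have C0 : 0 <= C := le_trans (cabs_ge0 _) hz.
split; first by rewrite (le_trans hz) //; lra.
move=> v h v1 h1; have [l hl] := hv v (le_trans v1 r11).
(* The expansion at h = 1 bounds the derivative by two values of [f] and a remainder. *)
have lC : cabs l <= 3 * C.
  have := hl 1; rewrite cabs1 scale1r mulr1 expr1n mulr1 => /(_ (lexx _)) hl1.
  have zv1 : n1 (z + v) <= r1 by rewrite (le_trans (n1D _ _)) // (le_trans _ rr1) // lerD.
  have [hzv _] := hC _ zv1.
  have -> : l = f (z + v) - f z - (f (z + v) - f z - l) by ring.
  rewrite (le_trans (cabsB _ _)) // (_ : 3 * C = C + C + C); last by ring.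
  by rewrite lerD // (le_trans (cabsB _ _)) // lerD.
have -> : f (z + h *: v) - f z = (f (z + h *: v) - f z - l * h) + l * h by ring.
rewrite (le_trans (cabsD _ _)) // cabsM (_ : 4 * C * cabs h = C * cabs h + 3 * C * cabs h); last by ring.
rewrite lerD ?ler_wpM2r ?cabs_ge0 // (le_trans (hl h h1)) // ler_wpM2l //.
by rewrite expr2 ler_piMl // cabs_ge0.
Qed.

(** Complex differentiability enters here. The grid mean is invariant under a real shift by one
    mesh, so its derivative along the complex line is of the order of the mesh, in imaginary
    directions too. A complex step of at most one mesh thus changes the mean by a quadratic amount,
    and the number of steps leading to [a] is linear in [N]. *)
Lemma gavg_flat_line f z j (a : Cx R) : tame f -> periodic f ->
  null (fun N => gavg (fun k : {ffun 'I_g -> 'I_N.+1} => f (z + a *: delta_mx j 0 + gpt R k)) -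
                 gavg (fun k : {ffun 'I_g -> 'I_N.+1} => f (z + gpt R k))).
Proof.
move=> ft fper; pose r := n1 z + cabs a + g%:R + 1.
have [C hC] := ft r.
(* The path to [a] is cut into [B * N.+1] steps, each no longer than the mesh. *)
have [B [B0 hB]] : exists B : nat, (0 < B)%N /\ cabs a <= B%:R.
  exists (Num.bound (cabs a)).+1; split=> //; rewrite ltW //.
  by rewrite (lt_le_trans (archi_boundP (cabs_ge0 _))) // ler_nat.
have BR : 0 < B%:R :> R by rewrite ltr0n.
have rC y : n1 y <= n1 z + cabs a -> forall N (k : {ffun 'I_g -> 'I_N.+1}), n1 (y + gpt R k) <= r.
  move=> hy N k; rewrite (le_trans (n1D _ _)) // /r; have := n1_gpt R k; lra.
have r1 : 1 <= r by rewrite /r lerDr !addr_ge0 ?n1_ge0 ?cabs_ge0.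
have C0 : 0 <= C.
  have [|h _] := hC 0; first by rewrite n10; lra.
  exact: le_trans (cabs_ge0 _) h.
apply: (@null_inv R _ (2 * B%:R * C)) => N.
pose F y := gavg (fun k : {ffun 'I_g -> 'I_N.+1} => f (y + gpt R k)).
have M0 : 0 < N.+1%:R :> R by rewrite ltr0n.
pose M1 : R := N.+1%:R^-1.
have M1_gt0 : 0 < M1 by rewrite invr_gt0.
have M1_le1 : M1 <= 1 by rewrite invf_le1 // ler1n.
have step y h : n1 y <= n1 z + cabs a -> cabs h <= M1 ->
    cabs (F (y + h *: delta_mx j 0) - F y) <= 2 * C * M1 ^+ 2.
  move=> hy hh.
  have /choice[l hl] : forall k : {ffun 'I_g -> 'I_N.+1}, exists l : Cx R, forall h : Cx R,
      cabs h <= 1 -> cabs (f (y + gpt R k + h *: delta_mx j 0) - f (y + gpt R k) - l * h) <= C * cabs h ^+ 2.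
    move=> k; have [_ H] := hC _ (rC y hy N k).
    by apply: H; rewrite n1_delta.
  have avgl h' : cabs h' <= 1 ->
      cabs (F (y + h' *: delta_mx j 0) - F y - gavg l * h') <= C * cabs h' ^+ 2.
    move=> h'1; rewrite /F [gavg l * h']mulrC -gavgZ -!gavgB; apply: cabs_gavg_le => k.
    by rewrite [h' * l k]mulrC [y + _ + _]addrAC hl.
  (* At h = M1 the increment of [F] vanishes by [gavg_shift], so the derivative term is bounded by
     the remainder. *)
  have lC : cabs (gavg l) <= C * M1.
    have := avgl (rc M1); rewrite cabs_rc gtr0_norm // => /(_ M1_le1).
    rewrite {1}/F gavg_shift // subrr sub0r cabsN cabsM cabs_rc gtr0_norm //.
    by rewrite expr2 mulrA ler_pM2r.
  have h1 : cabs h <= 1 := le_trans hh M1_le1.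
  have -> : F (y + h *: delta_mx j 0) - F y =
    (F (y + h *: delta_mx j 0) - F y - gavg l * h) + gavg l * h by ring.
  rewrite (le_trans (cabsD _ _)) // cabsM.
  rewrite (_ : 2 * C * M1 ^+ 2 = C * M1 ^+ 2 + C * M1 * M1); last by ring.
  rewrite lerD ?ler_pM ?cabs_ge0 // (le_trans (avgl h h1)) // ler_wpM2l //.
  by rewrite lerXn2r ?nnegrE ?cabs_ge0 // ltW.
pose h : Cx R := a / (B * N.+1)%:R.
have BN0 : (B * N.+1)%:R != 0 :> R by rewrite pnatr_eq0 muln_eq0 negb_or -lt0n B0.
have hM : cabs h <= M1.
  rewrite /h cabsM cabsV cabs_nat natrM invfM mulrA ler_piMl ?(ltW M1_gt0) //.
  by rewrite ler_pdivrMr // mul1r.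
have ind n : (n <= B * N.+1)%N ->
    cabs (F (z + (n%:R * h) *: delta_mx j 0) - F z) <= n%:R * (2 * C * M1 ^+ 2).
  elim: n => [_|n IH nB]; first by rewrite mul0r scale0r addr0 subrr cabs0 mul0r.
  rewrite (le_trans (cabs_triangle (F (z + (n%:R * h) *: delta_mx j 0)) _ _)) //.
  rewrite -[n.+1%:R in leRHS]natr1 [leRHS]mulrDl mul1r [leRHS]addrC lerD ?IH ?(ltnW nB) //.
  rewrite -[n.+1%:R]natr1.
  rewrite mulrDl mul1r scalerDl addrA step //.
  rewrite (le_trans (n1D _ _)) // lerD2l n1Z n1_delta mulr1 cabsM cabs_nat.
  rewrite /h cabsM cabsV cabs_nat mulrCA ler_piMr ?cabs_ge0 //.
  by rewrite ler_pdivrMr ?mul1r ?ler_nat ?(ltnW nB) // ltr0n muln_gt0 B0.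
have := ind _ (leqnn _).
have -> : (B * N.+1)%:R * h = a.
  by rewrite /h mulrC divfK // -rc_nat; apply: contra_neq BN0 => /complexI.
move=> H; apply: le_trans H _.
rewrite natrM /M1 le_eqVlt; apply/orP; left; apply/eqP; field.
by rewrite lt0r_neq0.
Qed.

Lemma gavg_flat f z w : tame f -> periodic f ->
  null (fun N => gavg (fun k : {ffun 'I_g -> 'I_N.+1} => f (w + gpt R k)) -
                 gavg (fun k : {ffun 'I_g -> 'I_N.+1} => f (z + gpt R k))).
Proof.
move=> ft fper.
have hs (s : seq 'I_g) : null (fun N =>
    gavg (fun k : {ffun 'I_g -> 'I_N.+1} => f (z + \sum_(j <- s) ((w - z) j 0) *: delta_mx j 0 + gpt R k)) -
    gavg (fun k : {ffun 'I_g -> 'I_N.+1} => f (z + gpt R k))).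
  elim: s => [|j s IH].
    apply: eq_null (@null0 R) => N; rewrite big_nil addr0 subrr //.
  apply: eq_null (nullD (@gavg_flat_line f (z + \sum_(i <- s) ((w - z) i 0) *: delta_mx i 0) j ((w - z) j 0) ft fper) IH) => N.
  by rewrite subrKA big_cons (addrC (_ *: delta_mx j 0)) (addrA z).
apply: eq_null (hs (index_enum 'I_g)) => N; congr (gavg _ - _).
apply/funext => k; congr (f (_ + _)).
rewrite -[RHS](subrK z) addrC; congr (_ + _).
apply/matrixP => i i0; rewrite (ord1 i0) {i0} summxE (bigD1 i) //= !mxE !eqxx mulr1.
by rewrite big1 ?addr0 // => p /negPf h; rewrite !mxE eq_sym h mulr0.
Qed.

(* Entire functions with the same quasi-periods under [Z^g + tau Z^g] are
   proportional: the Fourier coefficients of such a function are determined by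
   its mean, and both functions are compared to their means over finite grids. *)
Lemma proportional_means (tau : 'M[Cx R]_g) (c : 'cV[int]_g -> Cx R) f1 f2 :
  tame f1 -> tame f2 -> periodic f1 -> periodic f2 -> (forall m, c m != 0) ->
  (forall m z, f1 (z + tau *m iv R m) = c m * cexp (- (2 * ipi R) * dot (iv R m) z) * f1 z) ->
  (forall m z, f2 (z + tau *m iv R m) = c m * cexp (- (2 * ipi R) * dot (iv R m) z) * f2 z) ->
  forall z, null (fun N =>
    f1 z * gavg (fun k : {ffun 'I_g -> 'I_N.+1} => f2 (gpt R k)) -
    f2 z * gavg (fun k : {ffun 'I_g -> 'I_N.+1} => f1 (gpt R k))).
Proof.
move=> t1 t2 p1 p2 c0 q1 q2 z.
pose al N := gavg (fun k : {ffun 'I_g -> 'I_N.+1} => f1 (gpt R k)).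
pose be N := gavg (fun k : {ffun 'I_g -> 'I_N.+1} => f2 (gpt R k)).
pose r := n1 z + g%:R.
have [C1 H1] := tame_lipschitz r t1.
have [C2 H2] := tame_lipschitz r t2.
have rk N (k : {ffun 'I_g -> 'I_N.+1}) : n1 (z + gpt R k) <= r.
  by rewrite (le_trans (n1D _ _)) // lerD2l n1_gpt.
have rk0 N (k : {ffun 'I_g -> 'I_N.+1}) : n1 (gpt R k) <= r.
  by rewrite (le_trans (n1_gpt R k)) // lerDr n1_ge0.
have alC N : cabs (al N) <= C1.
  by apply: cabs_gavg_le => k; have [] := H1 _ (rk0 N k).
have beC N : cabs (be N) <= C2.
  by apply: cabs_gavg_le => k; have [] := H2 _ (rk0 N k).
have C10 : 0 <= C1 := le_trans (cabs_ge0 _) (alC 0%N).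
have C20 : 0 <= C2 := le_trans (cabs_ge0 _) (beC 0%N).
(* The coefficients of [f1] and [f2] are, asymptotically, the same multiples of their means [al] and
   [be], so those of this combination tend to zero. *)
pose G N (k : {ffun 'I_g -> 'I_N.+1}) := f1 (z + gpt R k) * be N - f2 (z + gpt R k) * al N.
have gpt0 N : gpt R ([ffun=> ord0] : {ffun 'I_g -> 'I_N.+1}) = 0.
  by apply/matrixP => i j; rewrite !mxE ffunE mul0r.
suff : null (fun N => G N [ffun=> ord0]).
  by apply: eq_null => N; rewrite /G gpt0 addr0.
apply: (@null_at_origin R g G (2 * C1 * C2)).
- move=> N k; rewrite /G (le_trans (cabsB _ _)) // (cabsM _ (be N)) (cabsM _ (al N)).
  rewrite (_ : 2 * C1 * C2 = C1 * C2 + C2 * C1); last by ring.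
  have [h1 _] := H1 _ (rk N k); have [h2 _] := H2 _ (rk N k).
  by apply: lerD; apply: ler_pM; rewrite ?cabs_ge0 ?h1 ?h2 ?alC ?beC.
- move=> e e0.
  (* The second bound ensures [n1 x <= 1] below, the third turns the Lipschitz estimate into [e]. *)
  pose eta := Num.min (2^-1) (Num.min (g%:R + 1)^-1 (e / ((g%:R + 1) * (2 * C1 * C2 + 1)))).
  have g1 : 0 < g%:R + 1 :> R by rewrite ltr_wpDl.
  have D0 : 0 < 2 * C1 * C2 + 1 by rewrite ltr_wpDl // !mulr_ge0.
  have eta0 : 0 < eta.
    by rewrite !lt_min !invr_gt0 g1 ltr0Sn /= divr_gt0 // mulr_gt0.
  have eta_le1 : eta <= (g%:R + 1)^-1 by rewrite !ge_min lexx orbT.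
  have eta_le2 : eta <= e / ((g%:R + 1) * (2 * C1 * C2 + 1)) by rewrite !ge_min lexx !orbT.
  exists eta => // N k /forallP hk.
  (* [m] is the vertex of the unit cube close to the grid point, and [x] the small remainder. *)
  pose m : 'cV[int]_g := \col_j (if (k j)%:R / N.+1%:R < eta :> R then 0 else 1).
  pose x : 'cV[Cx R]_g := gpt R k - iv R m.
  have xn : n1 x <= g%:R * eta.
    have -> : g%:R * eta = \sum_(j < g) eta by rewrite sumr_const card_ord mulr_natl.
    apply: ler_sum => j _.
    rewrite !mxE; have := hk j; have x0 : 0 <= (k j)%:R / N.+1%:R :> R by rewrite divr_ge0.
    have x1 : (k j)%:R / N.+1%:R <= 1 :> R by rewrite ler_pdivrMr // mul1r ler_nat ltnW.
    case: ifP => [h _|h /orP[//|h2]].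
      by rewrite subr0 cabs_rc ger0_norm // ltW.
    rewrite (_ : _ - _ = rc ((k j)%:R / N.+1%:R - 1)); last by rewrite rcD rcN.
    rewrite cabs_rc ler0_norm ?subr_le0 // opprB.
    by rewrite lerBlDr -lerBlDl ltW.
  have xn1 : n1 x <= 1.
    rewrite (le_trans xn) // (le_trans (_ : _ <= (g%:R + 1) * (g%:R + 1)^-1)) //.
      by apply: ler_pM; rewrite ?ler0n ?(ltW eta0) ?lerDl.
    by rewrite divff // lt0r_neq0.
  have xne : 2 * C1 * C2 * n1 x <= e.
    apply: (le_trans (_ : _ <= (2 * C1 * C2 + 1) * ((g%:R + 1) * (e / ((g%:R + 1) * (2 * C1 * C2 + 1)))))).
      apply: ler_pM; rewrite ?n1_ge0 ?lerDl ?mulr_ge0 // (le_trans xn) //.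
      by apply: ler_pM; rewrite ?ler0n ?(ltW eta0) ?lerDl.
    by rewrite le_eqVlt; apply/orP; left; apply/eqP; field; rewrite !lt0r_neq0.
  have fx f : periodic f -> f (z + gpt R k) = f (z + x).
    by move=> pf; rewrite -[RHS](pf m); congr f; rewrite -addrA subrK.
  have lip f C : (forall z, n1 z <= r -> cabs (f z) <= C /\
      forall v h, n1 v <= 1 -> cabs h <= 1 -> cabs (f (z + h *: v) - f z) <= C * cabs h) ->
      cabs (f (z + x) - f z) <= C * n1 x.
    move=> H; have zr : n1 z <= r by rewrite lerDl.
    have [_ H'] := H z zr.
    have [x0|x0] := eqVneq (n1 x) 0.
      have -> : x = 0.
        apply/matrixP => i j; rewrite (ord1 j) [RHS]mxE; apply/eqP.
        by rewrite -cabs_eq0 eq_le cabs_ge0 andbT -x0 cabs_le_n1.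
      by rewrite addr0 subrr cabs0 n10 mulr0.
    have := H' ((rc (n1 x))^-1 *: x) (rc (n1 x)).
    rewrite scalerA mulfV ?scale1r; last by rewrite -rc0; apply: contra_neq x0 => /complexI.
    rewrite n1Z cabsV cabs_rc ger0_norm ?n1_ge0 // mulVf //; apply => //.
  have E : G N k - G N [ffun=> ord0] =
      (f1 (z + x) - f1 z) * be N - (f2 (z + x) - f2 z) * al N.
    by rewrite /G gpt0 addr0 !fx //; ring.
  rewrite E (le_trans (cabsB _ _)) // (cabsM _ (be N)) (cabsM _ (al N)) (le_trans _ xne) //.
  rewrite (_ : 2 * C1 * C2 * n1 x = C1 * n1 x * C2 + C2 * n1 x * C1); last by ring.
  by rewrite lerD // ler_pM ?cabs_ge0 // lip.
- move=> m.
  (* Quasi-periodicity turns the coefficient at [m] into a constant times the mean over a translated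
     grid, and translated means agree asymptotically by [gavg_flat]. *)
  have key f : periodic f -> (forall m z, f (z + tau *m iv R m) = c m * cexp (- (2 * ipi R) * dot (iv R m) z) * f z) ->
    forall N, gavg (fun k : {ffun 'I_g -> 'I_N.+1} => f (z + gpt R k) * cexp (- (2 * ipi R) * dot (iv R m) (gpt R k))) =
      (c m * cexp (- (2 * ipi R) * dot (iv R m) z))^-1 *
      gavg (fun k : {ffun 'I_g -> 'I_N.+1} => f (z + tau *m iv R m + gpt R k)).
    move=> pf qf N; rewrite -gavgZ; apply: eq_gavg => k.
    rewrite addrAC qf dotDr mulrDr cexpD.
    by field; rewrite c0 cexp_neq0.
  pose d := (c m * cexp (- (2 * ipi R) * dot (iv R m) z))^-1.
  pose a1 N := gavg (fun k : {ffun 'I_g -> 'I_N.+1} => f1 (z + tau *m iv R m + gpt R k)).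
  pose a2 N := gavg (fun k : {ffun 'I_g -> 'I_N.+1} => f2 (z + tau *m iv R m + gpt R k)).
  apply: (eq_null (u := fun N => d * ((a1 N - al N) * be N - (a2 N - be N) * al N))).
    move=> N; rewrite (_ : (a1 N - al N) * be N - (a2 N - be N) * al N = be N * a1 N - al N * a2 N); last by ring.
    rewrite mulrBr [d * (be N * _)]mulrCA [d * (al N * _)]mulrCA /a1 /a2 /d -(key f1) // -(key f2) // -!gavgZ -gavgB; apply: eq_gavg => k.
    rewrite /G; ring.
  have flat f : tame f -> periodic f -> null (fun N =>
      gavg (fun k : {ffun 'I_g -> 'I_N.+1} => f (z + tau *m iv R m + gpt R k)) -
      gavg (fun k : {ffun 'I_g -> 'I_N.+1} => f (gpt R k))).
    move=> tf pf; apply: eq_null (gavg_flat 0 (z + tau *m iv R m) tf pf) => N.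
    by congr (_ - gavg _); apply/funext => k; rewrite add0r.
  apply: nullZ; apply: nullB.
    exact: nullM (flat _ t1 p1) beC.
  exact: nullM (flat _ t2 p2) alC.
Qed.

(** Eliminating the mean of [f1] between the relations at [z] and [w] leaves the difference of the
    two sides times the mean of [f2], which tends to 1. *)
Lemma tame_proportional (tau : 'M[Cx R]_g) (c : 'cV[int]_g -> Cx R) f1 f2 :
  tame f1 -> tame f2 -> periodic f1 -> periodic f2 -> (forall m, c m != 0) ->
  (forall m z, f1 (z + tau *m iv R m) = c m * cexp (- (2 * ipi R) * dot (iv R m) z) * f1 z) ->
  (forall m z, f2 (z + tau *m iv R m) = c m * cexp (- (2 * ipi R) * dot (iv R m) z) * f2 z) ->
  null (fun N => gavg (fun k : {ffun 'I_g -> 'I_N.+1} => f2 (gpt R k)) - 1) ->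
  forall z w, f1 z * f2 w = f1 w * f2 z.
Proof.
move=> t1 t2 p1 p2 c0 q1 q2 b1 z w.
have H := proportional_means t1 t2 p1 p2 c0 q1 q2.
apply/eqP; rewrite -subr_eq0; apply/eqP; apply: (@null_cst R).
apply: eq_null (nullB (nullB (nullZ (f2 w) (H z)) (nullZ (f2 z) (H w)))
  (nullZ (f1 z * f2 w - f1 w * f2 z) b1)) => N.
ring.
Qed.

End LocallyBoundedHolomorphy.

(** * Theta series *)

Section GaussianSums.
Variables (R : realType) (g : nat).
Implicit Types (m : 'cV[int]_g) (e : 'cV['F_2]_g) (c : characteristic g).

(* The summation index of the theta series, [m + epsilon / 2]. *)
Definition xr e m : 'cV[R]_g := \col_j ((m j 0)%:~R + (e j 0 : nat)%:R / 2).
Definition xc e m : 'cV[Cx R]_g := iv R m + half_char R e.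

Lemma xcE e m : xc e m = map_mx (@rc R) (xr e m).
Proof.
by apply/matrixP => i j; rewrite !mxE rcD rc_int rcM rcV !rc_nat (ord1 j).
Qed.

Definition sqnorm (x : 'cV[R]_g) : R := \sum_j x j 0 ^+ 2.
Definition rn1 (x : 'cV[R]_g) : R := \sum_j `|x j 0|.

Lemma sqnorm_ge0 x : 0 <= sqnorm x.
Proof. by apply: sumr_ge0 => j _; exact: sqr_ge0. Qed.

Lemma rn1_ge0 x : 0 <= rn1 x.
Proof. exact: sumr_ge0. Qed.

Lemma n1_xc e m : n1 (xc e m) = rn1 (xr e m).
Proof. by rewrite xcE /n1; apply: eq_bigr => j _; rewrite mxE cabs_rc. Qed.

(** The linear term in the exponent absorbs the argument of the theta function and the polynomial
    factors produced by differentiation. *)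
Definition gw (a s : R) e m : R :=
  expR (- a * sqnorm (xr e m) + s * rn1 (xr e m)).

Lemma gw_mul a s t e m : gw a s e m * expR (t * rn1 (xr e m)) = gw a (s + t) e m.
Proof. by rewrite /gw -expRD mulrDl addrA. Qed.

Lemma gw_le a s s' e m : s <= s' -> gw a s e m <= gw a s' e m.
Proof. by move=> ss'; rewrite ler_expR lerD2l ler_wpM2r // rn1_ge0. Qed.

Lemma expN1_lt1 : expR (-1) < 1 :> R.
Proof. by rewrite -[ltRHS]expR0 ltr_expR ltrN10. Qed.

Lemma geometric_le (q : R) n : 0 <= q < 1 -> \sum_(i < n) q ^+ i <= (1 - q)^-1.
Proof.
move=> /andP[q0 q1]; have q1' : 0 < 1 - q by rewrite subr_gt0.
rewrite -(ler_pM2l q1') divff ?lt0r_neq0 //.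
have -> : (1 - q) * \sum_(i < n) q ^+ i = 1 - q ^+ n.
  by rewrite -[in RHS](expr1n _ n) subrXX; congr (_ * _); apply: eq_bigr => i _; rewrite expr1n mul1r.
by rewrite gerBl exprn_ge0.
Qed.

(** The vectors of [J] are encoded by signs and bounded absolute values; the sum over all codes is a
    product of geometric sums, with a factor 2 for the sign. *)
Lemma exp_weight_bounded : exists B : R, forall J : {fset 'cV[int]_g},
  \sum_(m <- J) \prod_j expR (- `|(m j 0)%:~R|) <= B.
Proof.
exists ((2 * (1 - expR (-1))^-1) ^+ g) => J.
pose K : nat := \max_(m <- J) \max_(j < g) absz (m j 0%R).
have mK m j : m \in J -> (absz (m j 0%R) <= K)%N.
  move=> mJ; apply: (leq_trans (leq_bigmax (F := fun j => absz (m j 0%R)) j)).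
  exact: (leq_bigmax_seq (F := fun m : 'cV[int]_g => \max_(j < g) absz (m j 0%R))).
pose enc m : {ffun 'I_g -> bool * 'I_K.+1} := [ffun j => (m j 0 < 0, inord (absz (m j 0%R)))].
pose F (k : {ffun 'I_g -> bool * 'I_K.+1}) : R := \prod_j expR (-1) ^+ (k j).2.
have -> : \sum_(m <- J) \prod_j expR (- `|(m j 0)%:~R|) = \sum_(m <- J) F (enc m).
  apply: eq_big_seq => m mJ; apply: eq_bigr => j _; rewrite ffunE inordK ?ltnS ?mK //.
  by rewrite -expRM_natr; congr expR; rewrite mulN1r -intr_norm natr_absz.
have F0 k : 0 <= F k by apply: prodr_ge0 => j _; rewrite exprn_ge0 // expR_ge0.
have enc_inj : {in J &, injective enc}.
  move=> m m' mJ mJ' /ffunP h; apply/matrixP => j i; rewrite (ord1 i) {i}.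
  have := h j; rewrite !ffunE => -[h1 /(congr1 val)].
  rewrite /= !inordK ?ltnS ?mK // => h2.
  move: h1 h2; case: (m j 0) => a; case: (m' j 0) => b //=; first by move=> _ ->.
  by move=> _ [->].
rewrite -(big_map enc xpredT F) big_uniq; last first.
  by rewrite map_inj_in_uniq ?fset_uniq.
apply: (@le_trans _ _ (\sum_k F k)).
  by rewrite [leRHS](bigID (mem [seq enc i | i <- J])) /= lerDl sumr_ge0.
rewrite /F -(bigA_distr_bigA (fun (_ : 'I_g) (x : bool * 'I_K.+1) => expR (-1) ^+ x.2)).
have D0 : 0 <= 2 * (1 - expR (-1))^-1 :> R.
  by rewrite mulr_ge0 // invr_ge0 subr_ge0 ltW // expN1_lt1.
rewrite prodr_const card_ord lerXn2r ?nnegrE //.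
  by apply: sumr_ge0 => x _; rewrite exprn_ge0 // expR_ge0.
rewrite -(pair_bigA _ (fun (_ : bool) (x : 'I_K.+1) => expR (-1) ^+ x)) /=.
rewrite sumr_const card_bool -[leLHS]mulr_natl ler_wpM2l // geometric_le //.
by rewrite expR_ge0 expN1_lt1.
Qed.

(** The comparison is made in each coordinate: the 1 added to [|s|] leaves a spare |x_j|, and |m_j|
    <= |x_j| + 1. *)
Lemma gw_le_exp (a s : R) e m : 0 < a ->
  gw a s e m <= expR (g%:R * ((`|s| + 1) ^+ 2 / a + 1)) * \prod_j expR (- `|(m j 0)%:~R|).
Proof.
move=> a0; rewrite -expR_sum -expRD ler_expR /sqnorm /rn1.
have -> : g%:R * ((`|s| + 1) ^+ 2 / a + 1) = \sum_(j < g) ((`|s| + 1) ^+ 2 / a + 1).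
  by rewrite sumr_const card_ord mulr_natl.
rewrite !mulr_sumr -!big_split /=; apply: ler_sum => j _.
set x := xr e m j 0; set t := `|_%:~R|.
have xE : x = (m j 0)%:~R + (e j 0 : nat)%:R / 2 by rewrite /x mxE.
have tx : t <= `|x| + 1.
  rewrite (_ : t = `|x - (e j 0 : nat)%:R / 2|); last by rewrite xE addrK.
  rewrite (le_trans (ler_normB _ _)) // lerD2l ger0_norm ?divr_ge0 //.
  rewrite ler_pdivrMr // mul1r (ler_nat R _ 2); exact: ltnW.
rewrite -[x ^+ 2]real_normK ?num_real //.
have x0 : 0 <= `|x| by [].
have s0 : s <= `|s| by exact: ler_norm.
set y := `|x| in tx x0 *; set S := `|s| in s0 *.
have S0 : 0 <= S by rewrite /S.
(* Complete the square in [y]. *)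
have key : (S + 1) * y <= a * y ^+ 2 + (S + 1) ^+ 2 / a.
  have h : 0 <= (2 * a * y - (S + 1)) ^+ 2 / a by rewrite divr_ge0 ?sqr_ge0 // ltW.
  have hE : (2 * a * y - (S + 1)) ^+ 2 / a = 4 * (a * y ^+ 2) - 4 * ((S + 1) * y) + (S + 1) ^+ 2 / a.
    by field; rewrite lt0r_neq0.
  have h4 : 0 <= (S + 1) ^+ 2 / a by rewrite divr_ge0 ?sqr_ge0 // ltW.
  lra.
have : s * y <= S * y by rewrite ler_wpM2r.
lra.
Qed.

Lemma gw_bounded (a s : R) : 0 < a -> exists B : R, forall e (J : {fset 'cV[int]_g}),
  \sum_(m <- J) gw a s e m <= B.
Proof.
move=> a0; have [B hB] := exp_weight_bounded.
exists (expR (g%:R * ((`|s| + 1) ^+ 2 / a + 1)) * B) => e J.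
apply: (le_trans (ler_sum _ (fun m _ => gw_le_exp s e m a0))).
by rewrite -mulr_sumr ler_wpM2l // expR_ge0.
Qed.

End GaussianSums.

(** * Convergence and termwise differentiation of theta series *)

Section ThetaSeries.
Variables (R : realType) (g : nat).
Implicit Types (m : 'cV[int]_g) (c : characteristic g) (tau : 'M[Cx R]_g)
  (z v : 'cV[Cx R]_g).
Local Notation ipi := (ipi R).

Definition imag tau : 'M[R]_g := map_mx (@complex.Im R) tau.
Definition rform (Y : 'M[R]_g) (x : 'cV[R]_g) : R := (x^T *m Y *m x) 0 0.

(** Positivity with an explicit constant, as Gaussian bounds require; [act_positive] carries it
    along orbits, and the special matrix has constant 1. *)
Definition strongly_positive tau (a : R) :=
  0 < a /\ forall x : 'cV[R]_g, a * sqnorm x <= rform (imag tau) x.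

Lemma rformE Y x : rform Y x = \sum_i \sum_j x i 0 * Y i j * x j 0.
Proof.
rewrite /rform mxE exchange_big /=; apply: eq_bigr => j _.
by rewrite mxE mulr_suml; apply: eq_bigr => i _; rewrite mxE.
Qed.

Lemma qformE tau z : qform tau z = \sum_i \sum_j z i 0 * tau i j * z j 0.
Proof.
rewrite /qform dotE; apply: eq_bigr => i _; rewrite mxE mulr_sumr.
by apply: eq_bigr => j _; rewrite mulrA.
Qed.

Lemma ImMr (a : R) (w : Cx R) : complex.Im (rc a * w) = a * complex.Im w.
Proof. by case: w => x y /=; rewrite mul0r addr0. Qed.

Lemma ImMl (a : R) (w : Cx R) : complex.Im (w * rc a) = complex.Im w * a.
Proof. by rewrite mulrC ImMr mulrC. Qed.

Lemma Im_qform tau (x : 'cV[R]_g) :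
  complex.Im (qform tau (map_mx (@rc R) x)) = rform (imag tau) x.
Proof.
rewrite qformE rformE Im_sum; apply: eq_bigr => i _; rewrite Im_sum.
by apply: eq_bigr => j _; rewrite !mxE ImMl ImMr.
Qed.

Lemma Re_ipi (w : Cx R) : complex.Re (ipi * w) = - (pi * complex.Im w).
Proof. by case: w => x y /=; rewrite mul0r add0r. Qed.

Lemma cabs_ipi : cabs ipi = pi.
Proof. by rewrite cabsE /= expr0n add0r sqrtr_sqr ger0_norm // pi_ge0. Qed.

Lemma theta_termE c tau z m : theta_term c tau z m =
  cexp (ipi * (qform tau (xc R c.1 m) + 2 * dot (xc R c.1 m) (z + half_char R c.2))).
Proof. by rewrite /theta_term /qform /dot mulmxA. Qed.

Lemma theta_termD c tau z v m : theta_term c tau (z + v) m =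
  theta_term c tau z m * cexp (2 * ipi * dot (xc R c.1 m) v).
Proof.
rewrite !theta_termE -cexpD !dotDr; congr cexp; ring.
Qed.

Lemma half_charE (e : 'cV['F_2]_g) : half_char R e = map_mx (@rc R) (\col_j ((e j 0 : nat)%:R / 2)).
Proof. by apply/matrixP => i j; rewrite !mxE rcM rcV !rc_nat. Qed.

Lemma dot_rc (x y : 'cV[R]_g) :
  dot (map_mx (@rc R) x) (map_mx (@rc R) y) = rc (\sum_j x j 0 * y j 0).
Proof. by rewrite dotE rc_sum; apply: eq_bigr => j _; rewrite !mxE rcM. Qed.

Lemma theta_term_le c tau z m (a : R) : strongly_positive tau a ->
  cabs (theta_term c tau z m) <= gw (pi * a) (2 * pi * n1 z) c.1 m.
Proof.
move=> [a0 ha]; rewrite theta_termE cabs_cexp Re_ipi ler_expR dotDr mulrDr !ImD.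
have -> : complex.Im (qform tau (xc R c.1 m)) = rform (imag tau) (xr R c.1 m).
  by rewrite xcE Im_qform.
have -> : complex.Im (2 * dot (xc R c.1 m) (half_char R c.2)) = 0.
  by rewrite xcE half_charE dot_rc -rc_nat -rcM.
have := Im_le_cabs (2 * dot (xc R c.1 m) z).
rewrite ler_norml => /andP[+ _]; have := cabs_dot (xc R c.1 m) z.
rewrite cabsM cabs_nat n1_xc => h1 h2; have h3 := ha (xr R c.1 m).
have p0 := pi_ge0 R.
have h4 := ler_wpM2l p0 h3.
have h5 : pi * - complex.Im (2 * dot (xc R c.1 m) z) <= pi * (2 * (rn1 (xr R c.1 m) * n1 z)).
  by rewrite ler_wpM2l // lerNl (le_trans _ h2) // lerN2 ler_wpM2l.
lra.
Qed.

(** Closed under differentiation: the derivative in direction [v] multiplies the weight by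
    [lin c v]. *)
Definition wsum (p : 'cV[int]_g -> Cx R) c tau z : Cx R :=
  summability.sum (fun m => p m * theta_term c tau z m).

Definition exp_growth c (p : 'cV[int]_g -> Cx R) := exists K s : R,
  [/\ 0 <= K, 0 <= s & forall m, cabs (p m) <= K * expR (s * rn1 (xr R c.1 m))].

Lemma exp_growth1 c : exp_growth c (fun=> 1).
Proof.
by exists 1, 0; split=> // m; rewrite cabs1 mul0r expR0 mulr1.
Qed.

Definition lin c v m : Cx R := 2 * ipi * dot (xc R c.1 m) v.

Lemma cabs_lin c v m : cabs (lin c v m) <= 2 * pi * rn1 (xr R c.1 m) * n1 v.
Proof.
rewrite /lin !cabsM cabs_nat cabs_ipi -[leRHS]mulrA ler_wpM2l ?mulr_ge0 ?pi_ge0 //.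
by rewrite -n1_xc cabs_dot.
Qed.

Lemma le_expR (t : R) : t <= expR t.
Proof. by rewrite (le_trans _ (expR_ge1Dx t)) // lerDr. Qed.

Lemma exp_growth_lin c p v : exp_growth c p -> exp_growth c (fun m => p m * lin c v m).
Proof.
move=> [K [s [K0 s0 h]]]; exists (K * (2 * pi * n1 v)), (s + 1).
have D0 : 0 <= 2 * pi * n1 v by rewrite !mulr_ge0 ?pi_ge0 ?n1_ge0.
split; [exact: mulr_ge0 | exact: addr_ge0 | move=> m].
rewrite cabsM [(s + 1) * _]mulrDl expRD mul1r mulrACA ler_pM ?cabs_ge0 ?mulr_ge0 ?expR_ge0 //.
rewrite (le_trans (cabs_lin c v m)) // mulrAC ler_wpM2l //.
exact: le_expR.
Qed.

Lemma wsum_has_sum p c tau z a : strongly_positive tau a -> exp_growth c p ->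
  has_sum (fun m => p m * theta_term c tau z m) (wsum p c tau z).
Proof.
move=> ha [K [s [K0 s0 h]]].
have pa0 : 0 < pi * a by rewrite mulr_gt0 ?pi_gt0 //; exact: ha.1.
have [B hB] := @gw_bounded R g _ (2 * pi * n1 z + s) pa0.
apply: (@abs_bounded_has_sum _ _ _ (K * B)) => J.
apply: (@le_trans _ _ (\sum_(m <- J) K * gw (pi * a) (2 * pi * n1 z + s) c.1 m)).
  apply: ler_sum => m _; rewrite cabsM -gw_mul mulrA [leRHS]mulrAC.
  by rewrite ler_pM ?cabs_ge0 // theta_term_le.
by rewrite -mulr_sumr ler_wpM2l.
Qed.

Lemma thetaE c tau z : theta c tau z = wsum (fun=> 1) c tau z.
Proof. by rewrite /theta /wsum; congr summability.sum; apply/funext => m; rewrite mul1r. Qed.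

Lemma wsum_bounded p c tau a r : strongly_positive tau a -> exp_growth c p ->
  exists C : R, forall z, n1 z <= r -> cabs (wsum p c tau z) <= C.
Proof.
move=> ha hp; have [K [s [K0 s0 h]]] := hp.
have pa0 : 0 < pi * a by rewrite mulr_gt0 ?pi_gt0 //; exact: ha.1.
have [B hB] := @gw_bounded R g _ (2 * pi * r + s) pa0.
exists (K * B) => z zr.
apply: (has_sum_le (wsum_has_sum z ha hp)) => J.
apply: (@le_trans _ _ (\sum_(m <- J) K * gw (pi * a) (2 * pi * r + s) c.1 m)).
  apply: ler_sum => m _; rewrite cabsM -gw_mul mulrA [leRHS]mulrAC.
  rewrite ler_pM ?cabs_ge0 // (le_trans (theta_term_le _ _ _ ha)) // gw_le //.
  by rewrite ler_wpM2l // mulr_ge0 // pi_ge0.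
by rewrite -mulr_sumr ler_wpM2l.
Qed.

Lemma wsum_expand p c tau a r : strongly_positive tau a -> exp_growth c p ->
  exists C : R, forall z v (h : Cx R), n1 z <= r -> n1 v <= r -> cabs h <= 1 ->
    cabs (wsum p c tau (z + h *: v) - wsum p c tau z -
          wsum (fun m => p m * lin c v m) c tau z * h) <= C * cabs h ^+ 2.
Proof.
move=> ha hp; have [K [s [K0 s0 hK]]] := hp.
have [r0|r0] := leP 0 r; last first.
  by exists 0 => z v h zr; have := n1_ge0 z; lra.
have pa0 : 0 < pi * a by rewrite mulr_gt0 ?pi_gt0 //; exact: ha.1.
pose q : R := 2 * pi * r.
have q0 : 0 <= q by rewrite !mulr_ge0 ?pi_ge0.
(* With t the l1 norm of the summation vector, the remainder contains (q t)^2 exp (q t) <= exp (3 q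
   t), whence the last three [q]. *)
have [B hB] := @gw_bounded R g _ (q + s + (q + q + q)) pa0.
exists (K * B) => z v h zr vr h1.
have := has_sumB (has_sumB (wsum_has_sum (z + h *: v) ha hp) (wsum_has_sum z ha hp))
  (has_sumZ h (wsum_has_sum z ha (exp_growth_lin v hp))).
rewrite [h * _]mulrC => hs; apply: (has_sum_le hs) => J.
apply: (@le_trans _ _ (\sum_(m <- J) (K * cabs h ^+ 2) * gw (pi * a) (q + s + (q + q + q)) c.1 m)); last first.
  by rewrite -mulr_sumr mulrAC ler_wpM2r ?exprn_ge0 ?cabs_ge0 // ler_wpM2l.
apply: ler_sum => m _.
set t := rn1 (xr R c.1 m); have t0 : 0 <= t := rn1_ge0 _.
set T := theta_term c tau z m; set L := lin c v m.
have -> : p m * theta_term c tau (z + h *: v) m - p m * T - h * (p m * L * T) =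
    p m * T * (cexp (h * L) - 1 - h * L).
  rewrite theta_termD dotZr -/T (_ : 2 * ipi * (h * _) = h * L); last by rewrite /L /lin; ring.
  ring.
have LE : cabs (h * L) <= cabs h * (q * t).
  rewrite cabsM ler_wpM2l ?cabs_ge0 // (le_trans (cabs_lin c v m)) //.
  by rewrite mulrAC /q ler_wpM2r // ler_wpM2l // mulr_ge0 // pi_ge0.
have LE' : cabs (h * L) <= q * t.
  by rewrite (le_trans LE) // ler_piMl // mulr_ge0.
rewrite (cabsM _ (cexp _ - _ - _)) (cabsM (p m)) -!gw_mul.
have e3 : cabs (cexp (h * L) - 1 - h * L) <= cabs h ^+ 2 * expR ((q + q + q) * t).
  rewrite (le_trans (cexp_taylor1 _)) // (_ : expR ((q + q + q) * t) = expR (q * t) * expR (q * t) * expR (q * t)); last first.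
    by rewrite !mulrDl !expRD.
  apply: (@le_trans _ _ ((cabs h * (q * t)) ^+ 2 * expR (q * t))).
    have qt0 : 0 <= cabs h * (q * t) := le_trans (cabs_ge0 _) LE.
    have sq : cabs (h * L) ^+ 2 <= (cabs h * (q * t)) ^+ 2 by rewrite lerXn2r ?nnegrE ?cabs_ge0.
    by apply: ler_pM; rewrite ?(exprn_ge0 _ (cabs_ge0 _)) ?expR_ge0 ?ler_expR.
  rewrite exprMn -[leLHS]mulrA ler_wpM2l ?(exprn_ge0 _ (cabs_ge0 _)) // expr2.
  have qt0 : 0 <= q * t by rewrite mulr_ge0.
  by rewrite ler_wpM2r ?expR_ge0 //; apply: ler_pM; rewrite ?le_expR.
have Tle : cabs T <= gw (pi * a) q c.1 m.
  by rewrite (le_trans (theta_term_le _ _ _ ha)) // gw_le // /q ler_wpM2l // mulr_ge0 // pi_ge0.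
have -> : K * cabs h ^+ 2 * (gw (pi * a) q c.1 m * expR (s * t) * expR ((q + q + q) * t)) =
   (K * expR (s * t)) * gw (pi * a) q c.1 m * (cabs h ^+ 2 * expR ((q + q + q) * t)) by ring.
by apply: ler_pM; rewrite ?mulr_ge0 ?cabs_ge0 //; apply: ler_pM; rewrite ?cabs_ge0.
Qed.

Lemma theta_tame c tau a : strongly_positive tau a -> tame (theta c tau).
Proof.
move=> ha r; have [C1 h1] := wsum_bounded r ha (exp_growth1 c).
have [C2 h2] := wsum_expand r ha (exp_growth1 c).
exists (Num.max C1 C2) => z zr; split; first by rewrite thetaE le_max h1.
move=> v vr; exists (wsum (fun m => 1 * lin c v m) c tau z) => h hh; rewrite !thetaE (le_trans (h2 z v h zr vr hh)) //.
by rewrite ler_wpM2r ?exprn_ge0 ?cabs_ge0 // le_max lexx orbT.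
Qed.

Lemma derive_wsum p c tau a v z : strongly_positive tau a -> exp_growth c p ->
  'D_v (wsum p c tau) z = wsum (fun m => p m * lin c v m) c tau z.
Proof.
move=> ha hp; have [C hC] := wsum_expand (Num.max (n1 z) (n1 v)) ha hp.
set l := wsum (fun m => p m * lin c v m) c tau z in hC *.
have zr : n1 z <= Num.max (n1 z) (n1 v) by rewrite le_max lexx.
have vr : n1 v <= Num.max (n1 z) (n1 v) by rewrite le_max lexx orbT.
have C0 : 0 <= C.
  have := hC z v 1 zr vr; rewrite cabs1 expr1n !mulr1 => /(_ (lexx _)) hh.
  exact: le_trans (cabs_ge0 _) hh.
rewrite /derive; apply: cvg_lim; first exact: norm_hausdorff.
apply/cvgrPdist_le => e e0.
have [e1 eE] : 0 < complex.Re e /\ e = rc (complex.Re e).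
  move: e0; rewrite ltcE /= => /andP[/eqP h1 h2]; split=> //.
  by rewrite [LHS]complex_split /= h1 rc0 mulr0 addr0.
have C1 : 0 < C + 1 by rewrite ltr_wpDl.
have d0 : (0 : Cx R) < rc (complex.Re e / (C + 1)) by rewrite -rc0 ltcR divr_gt0.
near=> h.
have h0 : h != 0 by near: h; exact: nbhs_dnbhs_neq.
have hd : cabs h <= complex.Re e / (C + 1).
  have : `|h| <= rc (complex.Re e / (C + 1)) by near: h; exact: dnbhs0_le.
  by rewrite normCx lecR.
have h1 : cabs h <= 1.
  have : `|h| <= rc 1 by near: h; apply: dnbhs0_le; rewrite -rc0 ltcR.
  by rewrite normCx lecR.
rewrite /= eE normCx lecR.
have hh := hC z v h zr vr h1.
rewrite [h *: v + z]addrC.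
have -> : l - h^-1 *: (wsum p c tau (z + h *: v) - wsum p c tau z) =
    - h^-1 * (wsum p c tau (z + h *: v) - wsum p c tau z - l * h).
  set A := wsum _ _ _ _; set B := wsum _ _ _ _.
  transitivity (l - h^-1 * (A - B)); first by [].
  have hh' : h^-1 * (l * h) = l by rewrite mulrC mulfK.
  by rewrite mulNr [h^-1 * (A - B - _)]mulrBr hh' opprB.
rewrite cabsM cabsN cabsV ler_pdivrMl ?cabs_gt0 // (le_trans hh) //.
rewrite expr2 mulrA mulrC ler_wpM2l ?cabs_ge0 //.
rewrite (le_trans (ler_wpM2l C0 hd)) // mulrCA ler_piMr ?(ltW e1) //.
by rewrite ler_pdivrMr // mul1r lerDl.
Unshelve. all: by end_near.
Qed.

Lemma derive_theta c tau a v z : strongly_positive tau a ->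
  'D_v (theta c tau) z = wsum (lin c v) c tau z.
Proof.
move=> ha; have -> : theta c tau = wsum (fun=> 1) c tau.
  by apply/funext => y; rewrite thetaE.
rewrite (derive_wsum v z ha (exp_growth1 c)).
by congr (wsum _ c tau z); apply/funext => m; rewrite mul1r.
Qed.

Lemma exp_growth_lin1 c v : exp_growth c (lin c v).
Proof.
have := exp_growth_lin v (exp_growth1 c).
by under eq_fun do rewrite mul1r.
Qed.

Lemma theta_hessianE c tau a j k : strongly_positive tau a ->
  theta_hessian c tau j k =
  wsum (fun m => lin c (delta_mx k 0) m * lin c (delta_mx j 0) m) c tau 0.
Proof.
move=> ha; rewrite mxE.
have -> : 'D_(delta_mx k 0) (theta c tau) = wsum (lin c (delta_mx k 0)) c tau.
  by apply/funext => y; rewrite (derive_theta _ _ _ ha).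
by rewrite (derive_wsum _ _ ha (exp_growth_lin1 c _)).
Qed.

End ThetaSeries.

(** * Quasi-periods, parity and second-order expansion of theta functions *)

Section ThetaFunctionalEquations.
Variables (R : realType) (g : nat).
Implicit Types (m a b : 'cV[int]_g) (e : 'cV['F_2]_g) (c : characteristic g)
  (tau : 'M[Cx R]_g) (z v : 'cV[Cx R]_g).
Local Notation ipi := (ipi R).

Definition lift01 e : 'cV[int]_g := \col_j Posz (e j 0 : nat).

Lemma half_char_lift e : half_char R e = 2^-1 *: iv R (lift01 e).
Proof. by apply/matrixP => i j; rewrite !mxE mulrC. Qed.

Definition idot a b : int := \sum_j a j 0 * b j 0.

Lemma dot_iv a b : dot (iv R a) (iv R b) = (idot a b)%:~R.
Proof.
rewrite dotE /idot rmorph_sum /=; apply: eq_bigr => j _.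
by rewrite !mxE rmorphM.
Qed.

Lemma even_charE c : even_char c = ~~ odd `|idot (lift01 c.1) (lift01 c.2)|.
Proof.
rewrite /even_char mxE.
have -> : \sum_j c.1^T 0 j * c.2 j 0 = (`|idot (lift01 c.1) (lift01 c.2)|%N)%:R.
  have -> : idot (lift01 c.1) (lift01 c.2) = Posz (\sum_j (c.1 j 0%R : nat) * (c.2 j 0%R : nat))%N.
    rewrite /idot -[Posz _]/(Posz _) (big_morph Posz PoszD (erefl (Posz 0))).
    by apply: eq_bigr => j _; rewrite !mxE PoszM.
  rewrite absz_nat natr_sum; apply: eq_bigr => j _.
  by rewrite mxE natrM !natr_Zp.
by rewrite -dvdn2 (dvdn_pcharf (pchar_Fp (isT : prime 2))).
Qed.

Lemma theta_has_sum c tau z s : strongly_positive tau s ->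
  has_sum (theta_term c tau z) (theta c tau z).
Proof.
move=> hs; rewrite thetaE; have H := wsum_has_sum z hs (@exp_growth1 R g c).
apply: (eq_has_sum _ H) => m.
by rewrite mul1r.
Qed.

Lemma theta_quasi_periodic c tau z a b s : strongly_positive tau s -> tau^T = tau ->
  theta c tau (z + tau *m iv R a + iv R b) =
  cexp (ipi * (- qform tau (iv R a) - 2 * dot (iv R a) z +
    (idot (lift01 c.1) b - idot (lift01 c.2) a)%:~R)) * theta c tau z.
Proof.
move=> hs hT.
have h := @has_sum_reindex R _ (fun m => m + a) (fun m => m - a) _ _ _ _ (theta_has_sum c z hs).
have {}h := h (fun m => addrK a m) (fun m => subrK a m).
apply: has_sum_uniq (theta_has_sum c _ hs) _.
apply: eq_has_sum (has_sumZ _ h) => m /=.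
rewrite !theta_termE -cexpD.
have -> : xc R c.1 (m + a) = xc R c.1 m + iv R a by rewrite /xc ivD addrAC.
set x := xc R c.1 m.
have Dl y : dot (x + iv R a) y = dot x y + dot (iv R a) y by exact: dotDl.
rewrite qformD // Dl !dotDr.
rewrite (half_char_lift c.2) [dot (iv R a) (_ *: _)]dotZr dot_iv intrB.
have -> : (idot (lift01 c.2) a)%:~R = (idot a (lift01 c.2))%:~R :> Cx R.
  by rewrite -!dot_iv dotC.
have xb : dot x (iv R b) = (idot m b)%:~R + 2^-1 * (idot (lift01 c.1) b)%:~R.
  by rewrite /x /xc dotDl half_char_lift dotZl !dot_iv.
rewrite xb.
(* The two exponents differ by an integral multiple of 2 pi i. *)
rewrite -[LHS]mulr1 -[X in _ * X = _](@cexp_ipi_even R (idot m b)) -cexpD; congr cexp.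
by field.
Qed.

Lemma theta_parity c tau z s : strongly_positive tau s -> tau^T = tau ->
  theta c tau (- z) = (-1) ^+ `|idot (lift01 c.1) (lift01 c.2)| * theta c tau z.
Proof.
move=> hs hT.
(* The involution x -> -x of Z^g + epsilon/2 in terms of [m]. *)
pose u m := - m - lift01 c.1.
have uK : cancel u u by move=> m; rewrite /u opprD !opprK addrK.
have h := has_sum_reindex uK uK (theta_has_sum c z hs).
apply: has_sum_uniq (theta_has_sum c _ hs) _.
apply: eq_has_sum (has_sumZ _ h) => m /=.
rewrite -cexp_ipi_int !theta_termE -cexpD.
have -> : xc R c.1 (u m) = - xc R c.1 m.
  rewrite /xc /u ivD !ivN half_char_lift opprD -addrA; congr (_ + _).
  by rewrite -scaleN1r -scaleNr -scalerDl; congr (_ *: _); field.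
set x := xc R c.1 m.
have xd : dot x (half_char R c.2) = 2^-1 * ((idot m (lift01 c.2))%:~R +
    2^-1 * (idot (lift01 c.1) (lift01 c.2))%:~R).
  by rewrite half_char_lift dotZr /x /xc dotDl half_char_lift dotZl !dot_iv.
rewrite -(scaleN1r x) qformZ dotZl !dotDr !dotNr xd.
rewrite -[LHS]mulr1 -[X in _ * X = _](@cexp_ipi_even R (idot m (lift01 c.2))) -cexpD; congr cexp.
by field.
Qed.

Lemma theta_even c tau z s : strongly_positive tau s -> tau^T = tau ->
  even_char c -> theta c tau (- z) = theta c tau z.
Proof.
move=> hs hT; rewrite even_charE (theta_parity _ _ hs) // => h.
by rewrite -signr_odd (negPf h) mul1r.
Qed.

Lemma theta_odd c tau z s : strongly_positive tau s -> tau^T = tau ->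
  ~~ even_char c -> theta c tau (- z) = - theta c tau z.
Proof.
move=> hs hT; rewrite even_charE negbK (theta_parity _ _ hs) // => h.
by rewrite -signr_odd h mulN1r.
Qed.

Lemma wsumZ (p : 'cV[int]_g -> Cx R) k c tau z s : strongly_positive tau s -> exp_growth c p ->
  wsum (fun m => k * p m) c tau z = k * wsum p c tau z.
Proof.
move=> hs hp; apply: has_sumE.
by apply: eq_has_sum (has_sumZ k (wsum_has_sum z hs hp)) => m; rewrite mulrA.
Qed.

Lemma lin_sum c v m : lin c v m = \sum_j v j 0 * lin c (delta_mx j 0) m.
Proof.
rewrite /lin dotE mulr_sumr; apply: eq_bigr => j _.
by rewrite dot_delta; ring.
Qed.

Lemma qform_theta_hessian c tau v s : strongly_positive tau s ->
  qform (theta_hessian c tau) v = wsum (fun m => lin c v m * lin c v m) c tau 0.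
Proof.
move=> hs; apply/esym/has_sumE; rewrite qformE.
have h i : has_sum (fun m => \sum_j v i 0 * v j 0 *
     (lin c (delta_mx j 0) m * lin c (delta_mx i 0) m * theta_term c tau 0 m))
   (\sum_j v i 0 * v j 0 * theta_hessian c tau i j).
  apply: has_sum_sum => j; apply: has_sumZ; rewrite (theta_hessianE _ _ _ hs).
  exact: wsum_has_sum hs (exp_growth_lin _ (exp_growth_lin1 _ _)).
have := has_sum_sum (index_enum 'I_g) h.
rewrite (eq_bigr (fun i => \sum_j v i 0 * theta_hessian c tau i j * v j 0)); last first.
  by move=> i _; apply: eq_bigr => j _; rewrite mulrAC.
apply: eq_has_sum => m; rewrite (lin_sum c v m) mulr_suml mulr_suml; apply: eq_bigr => i _.
rewrite mulr_sumr mulr_suml; apply: eq_bigr => j _; ring.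
Qed.

Lemma theta_hessian_sym c tau s : strongly_positive tau s ->
  (theta_hessian c tau)^T = theta_hessian c tau.
Proof.
move=> hs; apply/matrixP => i j; rewrite mxE !(theta_hessianE _ _ _ hs).
by congr (wsum _ c tau 0); apply/funext => m; rewrite mulrC.
Qed.

(** The expansion with its linear term is averaged over [v] and [- v]: evenness preserves the values
    and cancels that term. *)
Lemma theta_taylor c tau s : strongly_positive tau s -> tau^T = tau -> even_char c ->
  exists C : R, forall v, n1 v <= 1 ->
    cabs (theta c tau v - theta_const c tau - 2^-1 * qform (theta_hessian c tau) v) <=
    C * n1 v ^+ 3.
Proof.
move=> hs hT ev.
have ps0 : 0 < pi * s by rewrite mulr_gt0 ?pi_gt0 //; exact: hs.1.
pose q : R := 2 * pi.
have q0 : 0 <= q by rewrite mulr_ge0 ?pi_ge0.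
have [B hB] := @gw_bounded R g _ (0 + (q + q + q + q)) ps0.
have key v : n1 v <= 1 -> cabs (theta c tau v - theta c tau 0 - wsum (lin c v) c tau 0 -
    2^-1 * qform (theta_hessian c tau) v) <= B * n1 v ^+ 3.
  move=> v1; rewrite (qform_theta_hessian c v hs).
  have := has_sumB (has_sumB (has_sumB (theta_has_sum c v hs) (theta_has_sum c 0 hs))
    (wsum_has_sum 0 hs (exp_growth_lin1 c v)))
    (has_sumZ 2^-1 (wsum_has_sum 0 hs (exp_growth_lin v (exp_growth_lin1 c v)))).
  move=> h; apply: (has_sum_le h) => J.
  apply: (@le_trans _ _ (\sum_(m <- J) (n1 v ^+ 3 * gw (pi * s) (0 + (q + q + q + q)) c.1 m))); last first.
    by rewrite -mulr_sumr mulrC ler_wpM2r ?exprn_ge0 ?n1_ge0.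
  apply: ler_sum => m _; set L := lin c v m; set T := theta_term c tau 0 m.
  have -> : theta_term c tau v m - T - L * T - 2^-1 * (L * L * T) =
      T * (cexp L - 1 - L - L ^+ 2 / 2).
    by rewrite -[v in theta_term c tau v m]add0r theta_termD -/T -/(lin c v m) -/L; field.
  set t := rn1 (xr R c.1 m); have t0 : 0 <= t := rn1_ge0 _.
  have LE : cabs L <= n1 v * (q * t).
    by rewrite mulrC (le_trans (cabs_lin c v m)).
  have qt0 : 0 <= q * t by rewrite mulr_ge0.
  have LE' : cabs L <= q * t by rewrite (le_trans LE) // ler_piMl.
  have TE : cabs T <= gw (pi * s) 0 c.1 m.
    by have := theta_term_le c 0 m hs; rewrite n10 mulr0.
  rewrite cabsM -gw_mul mulrCA; apply: ler_pM; rewrite ?cabs_ge0 //.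
  rewrite (le_trans (cexp_taylor2 _)) //.
  have -> : expR ((q + q + q + q) * t) = expR (q * t) * expR (q * t) * expR (q * t) * expR (q * t).
    by rewrite !mulrDl !expRD.
  apply: (@le_trans _ _ ((n1 v * (q * t)) ^+ 3 * expR (q * t))).
    apply: ler_pM; rewrite ?(exprn_ge0 _ (cabs_ge0 _)) ?expR_ge0 ?ler_expR //.
    by rewrite lerXn2r ?nnegrE ?cabs_ge0 // mulr_ge0 ?n1_ge0.
  rewrite exprMn -[leLHS]mulrA ler_wpM2l ?(exprn_ge0 _ (n1_ge0 _)) //.
  rewrite ler_wpM2r ?expR_ge0 //.
  have -> : (q * t) ^+ 3 = q * t * (q * t) * (q * t) by ring.
  by apply: ler_pM; rewrite ?(mulr_ge0 qt0) ?le_expR //; apply: ler_pM; rewrite ?le_expR.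
exists B => v v1.
have h1 := key _ v1; have := key (- v); rewrite n1N => /(_ v1) h2.
have linN : wsum (lin c (- v)) c tau 0 = - wsum (lin c v) c tau 0.
  rewrite -mulN1r -(wsumZ _ _ hs (exp_growth_lin1 c v)).
  by congr (wsum _ c tau 0); apply/funext => m; rewrite /lin dotNr; ring.
move: h2; rewrite linN (theta_even _ hs hT ev) -(scaleN1r v) qformZ sqrrN expr1n mul1r => h2.
set X := theta c tau v in h1 h2 *; set W := wsum _ _ _ _ in h1 h2.
set Q := 2^-1 * _ in h1 h2 *.
have -> : X - theta_const c tau - Q = 2^-1 * ((X - theta c tau 0 - W - Q) + (X - theta c tau 0 - - W - Q)).
  by rewrite /theta_const; field.
rewrite cabsM cabsV cabs_nat ler_pdivrMl // (le_trans (cabsD _ _)) //.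
by rewrite mulr_natl mulr2n lerD.
Qed.

End ThetaFunctionalEquations.

(** * Grid means of theta functions *)

Section ThetaMean.
Variables (R : realType) (g : nat).
Implicit Types (m a b : 'cV[int]_g) (c : characteristic g)
  (tau : 'M[Cx R]_g) (z v : 'cV[Cx R]_g).
Local Notation ipi := (ipi R).

Lemma abs_bounded_tail (I : choiceType) (h : I -> R) (B e : R) : (forall i, 0 <= h i) ->
  (forall J : {fset I}, \sum_(i <- J) h i <= B) -> 0 < e ->
  exists J0 : {fset I}, forall J : {fset I}, [disjoint J & J0]%fset -> \sum_(i <- J) h i <= e.
Proof.
move=> h0 hB e0.
pose E := [set s : R | exists J : {fset I}, s = \sum_(i <- J) h i].
have supE : has_sup E.
  split; first by exists (\sum_(i <- fset0) h i), fset0.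
  by exists B => _ [J ->].
have [_ [J0 ->] hJ] := sup_adherent e0 supE.
exists J0 => J dJ.
have : \sum_(i <- (J `|` J0)%fset) h i <= sup E.
  by rewrite ub_le_sup //; [exact: supE.2 | exists (J `|` J0)%fset].
rewrite (@big_fsetID _ _ _ _ (mem J0) (J `|` J0)%fset) /=.
have -> : \sum_(i <- [fset x in (J `|` J0)%fset | x \in J0]%fset) h i = \sum_(i <- J0) h i.
  by apply: eq_fbigl => i; rewrite !inE /= andb_orl andbb; case: (i \in J0); rewrite ?orbT ?andbF.
have -> : \sum_(i <- [fset x in (J `|` J0)%fset | x \notin J0]%fset) h i = \sum_(i <- J) h i.
  apply: eq_fbigl => i; rewrite !inE /=; case: (boolP (i \in J)) => /= iJ.
    by rewrite (fdisjointP dJ).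
  by case: (i \in J0).
lra.
Qed.

(** A mesh shift in coordinate j leaves the mean unchanged, yet multiplies it by exp (2 pi i m_j /
    (N + 1)), which is not 1. *)
Lemma character_mean0 m N : (exists j, (0 < absz (m j 0%R) <= N)%N) ->
  gavg (fun k : {ffun 'I_g -> 'I_N.+1} => cexp (2 * ipi * dot (iv R m) (gpt R k))) = 0.
Proof.
move=> [j /andP[mj0 mjN]]; set D := gavg _.
pose f y := cexp (2 * ipi * dot (iv R m) y).
have fper a y : f (y + iv R a) = f y.
  rewrite /f dotDr mulrDr cexpD dot_iv [2 * ipi]mulrC -[ipi * 2 * _%:~R]mulrA.
  by rewrite cexp_ipi_even mulr1.
have E0 : gavg (fun k : {ffun 'I_g -> 'I_N.+1} => f (0 + gpt R k)) = D.
  by apply: eq_gavg => k; rewrite add0r.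
set w := cexp (2 * ipi * ((m j 0)%:~R * rc (N.+1%:R^-1))).
have E1 : gavg (fun k : {ffun 'I_g -> 'I_N.+1} => f (0 + rc N.+1%:R^-1 *: delta_mx j 0 + gpt R k)) = w * D.
  rewrite /D -gavgZ; apply: eq_gavg => k.
  rewrite /f add0r dotDr mulrDr cexpD; congr (cexp (_ * _) * _).
  by rewrite dotZr dot_delta mxE mulrC.
have wD := etrans (etrans (esym E1) (gavg_shift N 0 j fper)) E0.
have : (w - 1) * D = 0 by rewrite mulrBl wD mul1r subrr.
move: E0 E1 wD => _ _ _.
move/eqP; rewrite mulf_eq0 => /orP[|/eqP //]; rewrite subr_eq0 => /eqP w1.
exfalso.
(* As [w] is the square of [E], w = 1 would force sin (pi y) = 0, impossible for 0 < |y| < 1. *)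
pose y : R := (m j 0)%:~R / N.+1%:R.
pose E := cexp (ipi * rc y).
have wE : w = E ^+ 2.
  rewrite /w /E expr2 -cexpD; congr cexp; rewrite /y -rc_int -rcM; ring.
have ImE : complex.Im E = 0.
  by move/eqP: w1; rewrite wE sqrf_eq1 => /orP[/eqP -> | /eqP ->] //=; rewrite oppr0.
have sy : sin (pi * y) = 0.
  move: ImE; rewrite /E /cexp /=.
  by rewrite mulr0 !mul0r subrr expR0 mul1r add0r.
have y0 : 0 < `|y|.
  by rewrite normr_gt0 mulf_neq0 ?invr_eq0 ?pnatr_eq0 // intr_eq0 -absz_gt0.
have y1 : `|y| < 1.
  rewrite normrM -intr_norm -natr_absz ger0_norm ?invr_ge0 // ltr_pdivrMr // mul1r.
  by rewrite ltr_nat ltnS.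
have : 0 < sin (pi * `|y|).
  by have p0 := pi_gt0 R; apply: sin_gt0_pi; apply/andP; split; nra.
have [h0|h0] := leP 0 y; first by rewrite ger0_norm // sy ltxx.
by rewrite ltr0_norm // mulrN sinN sy oppr0 ltxx.
Qed.

(** Without its factor exp (pi i epsilon . z), theta is a Fourier series with nonzero constant term,
    normalized by [k0]. Grid means kill the frequencies having some 0 < |m_j| <= N; the aliased ones
    lie in the tail of an absolutely convergent series. *)
Lemma theta_mean c tau s : strongly_positive tau s ->
  exists2 k0 : Cx R, k0 != 0 & null (fun N => gavg (fun k : {ffun 'I_g -> 'I_N.+1} =>
    k0 * cexp (- (2 * ipi) * dot (half_char R c.1) (gpt R k)) * theta c tau (gpt R k)) - 1).
Proof.
move=> hs; set T0 := theta_term c tau 0.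
have T00 : T0 0 != 0 by rewrite /T0 theta_termE cexp_neq0.
exists (T0 0)^-1; first by rewrite invr_eq0.
set k0 := (T0 0)^-1 => e e0.
have ps0 : 0 < pi * s by rewrite mulr_gt0 ?pi_gt0 //; exact: hs.1.
have [B hB] := @gw_bounded R g _ (2 * pi * n1 (0 : 'cV[Cx R]_g)) ps0.
have bnd (J : {fset 'cV[int]_g}) : \sum_(m <- J) cabs (k0 * T0 m) <= cabs k0 * B.
  apply: (@le_trans _ _ (\sum_(m <- J) cabs k0 * gw (pi * s) (2 * pi * n1 (0 : 'cV[Cx R]_g)) c.1 m)).
    by apply: ler_sum => m _; rewrite cabsM ler_wpM2l ?cabs_ge0 // theta_term_le.
  by rewrite -mulr_sumr ler_wpM2l ?cabs_ge0.
have [J0 hJ0] := abs_bounded_tail (fun m => cabs_ge0 (k0 * T0 m)) bnd e0.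
pose N0 := \max_(m <- J0) \max_(j < g) absz (m j 0%R).
have mN m j : m \in J0 -> (absz (m j 0%R) <= N0)%N.
  move=> mJ; apply: (leq_trans (leq_bigmax (F := fun j => absz (m j 0%R)) j)).
  exact: (leq_bigmax_seq (F := fun m : 'cV[int]_g => \max_(j < g) absz (m j 0%R))).
exists N0 => N NN0.
pose D m := gavg (fun k : {ffun 'I_g -> 'I_N.+1} => cexp (2 * ipi * dot (iv R m) (gpt R k))).
have D1 m : cabs (D m) <= 1.
  apply: cabs_gavg_le => k; rewrite cabs_cexp.
  have -> : 2 * ipi * dot (iv R m) (gpt R k) =
      ipi * rc (2 * (\sum_j (m j 0)%:~R * ((k j)%:R / N.+1%:R))).
    rewrite rcM rc_nat rc_sum dotE mulrCA -mulrA; congr (_ * (_ * _)).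
    by apply: eq_bigr => j _; rewrite !mxE [RHS]rcM rc_int.
  by rewrite Re_ipi /= mulr0 oppr0 expR0.
have hsum : has_sum (fun m => k0 * T0 m * D m) (gavg (fun k : {ffun 'I_g -> 'I_N.+1} =>
    k0 * cexp (- (2 * ipi) * dot (half_char R c.1) (gpt R k)) * theta c tau (gpt R k))).
  have h (k : {ffun 'I_g -> 'I_N.+1}) := has_sumZ (k0 * cexp (- (2 * ipi) * dot (half_char R c.1) (gpt R k)))
    (theta_has_sum c (gpt R k) hs).
  apply: eq_has_sum (has_sumZ ((N.+1%:R ^+ g)^-1) (has_sum_sum (index_enum {ffun 'I_g -> 'I_N.+1}) h)) => m.
  rewrite /D -gavgZ /gavg; congr (_ * _); apply: eq_bigr => k _.
  have -> : theta_term c tau (gpt R k) m = T0 m * cexp (2 * ipi * dot (xc R c.1 m) (gpt R k)).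
    by rewrite -theta_termD add0r.
  rewrite /xc dotDl mulrDr cexpD mulNr cexpN.
  set E1 := cexp (_ * dot (half_char R c.1) _); set E2 := cexp _; have E10 : E1 != 0 by exact: cexp_neq0.
  by rewrite mulrACA [E1^-1 * _]mulrC mulfK.
have D0 : D 0 = 1.
  rewrite /D -[RHS](@gavg_cst R g N); apply: eq_gavg => k.
  by rewrite iv0 dotC dot0r mulr0 cexp0.
have k1 : k0 * T0 0 = 1 by exact: mulVf.
have sum0 : \sum_(m <- [fset (0 : 'cV[int]_g)]%fset) k0 * T0 m * D m = 1.
  by rewrite big_seq_fset1 k1 D0 mul1r.
have := has_sum_close (S := [fset (0 : 'cV[int]_g)]%fset) (B := e) hsum; rewrite sum0.
apply => J dJ.
rewrite (@big_fsetID _ _ _ _ (mem J0) J) /=.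
rewrite big1_fset ?add0r; last first.
  move=> m; rewrite !inE /= => /andP[mJ mJ0] _.
  have m0 : m != 0 by have := fdisjointP dJ m mJ; rewrite inE.
  have [j mj] : exists j, m j 0 != 0.
    apply/existsP; apply: contra_neqT m0 => /existsPn h.
    by apply/matrixP => i i0; rewrite (ord1 i0) [RHS]mxE; apply/eqP; rewrite -[_ == _]negbK h.
  rewrite -/k0 [D m]character_mean0 ?mulr0 ?cabs0 //.
  by exists j; rewrite absz_gt0 mj /= (leq_trans (mN m j mJ0)).
rewrite (le_trans (ler_sum _ (fun m _ => (_ : _ <= cabs (k0 * T0 m))))) //.
  by move=> m _; rewrite cabsM ler_piMr ?cabs_ge0.
apply: hJ0; apply/fdisjointP => m; rewrite !inE /= => /andP[_ //].
Qed.

End ThetaMean.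

Section TameClosure.
Variables (R : realType) (g : nat).
Implicit Types (f : 'cV[Cx R]_g -> Cx R) (A S : 'M[Cx R]_g) (z v : 'cV[Cx R]_g).

(** Adds a bound on the derivative, obtained from the expansion at h = 1; products require it. *)
Lemma tame_ge0 f (r : R) : tame f -> exists2 C : R, 0 <= C & forall z, n1 z <= r ->
  cabs (f z) <= C /\
  forall v, n1 v <= r -> exists l : Cx R, cabs l <= C /\ forall h : Cx R, cabs h <= 1 ->
    cabs (f (z + h *: v) - f z - l * h) <= C * cabs h ^+ 2.
Proof.
move=> ft; have [C1 h1] := ft `|r|; have [C2 h2] := ft (`|r| + `|r|).
have rr : r <= `|r| by exact: ler_norm.
have r0 : 0 <= `|r| by [].
have C10 : 0 <= C1.
  by have [|h _] := h1 0; [rewrite n10 | exact: le_trans (cabs_ge0 _) h].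
have C20 : 0 <= C2.
  by have [|h _] := h2 0; [rewrite n10 addr_ge0 | exact: le_trans (cabs_ge0 _) h].
exists (2 * C1 + C2); first by lra.
move=> z zr; have {}zr := le_trans zr rr; have [hz hv] := h1 z zr.
split; first by lra.
move=> v vr; have {}vr := le_trans vr rr; have [l hl] := hv v vr.
exists l; split; last first.
  move=> h hh; rewrite (le_trans (hl h hh)) // ler_wpM2r ?exprn_ge0 ?cabs_ge0 //; lra.
have := hl 1; rewrite cabs1 scale1r mulr1 expr1n mulr1 => /(_ (lexx _)) hl1.
have [hzv _] : cabs (f (z + v)) <= C2 /\ _ := h2 (z + v) (le_trans (n1D _ _) (lerD zr vr)).
have -> : l = f (z + v) - f z - (f (z + v) - f z - l) by ring.
rewrite (le_trans (cabsB _ _)) // (_ : 2 * C1 + C2 = C2 + C1 + C1); last by ring.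
by rewrite lerD // (le_trans (cabsB _ _)) // lerD.
Qed.

Lemma tameM f1 f2 : tame f1 -> tame f2 -> tame (fun z => f1 z * f2 z).
Proof.
move=> t1 t2 r; have [C C0 h1] := tame_ge0 r t1; have [D D0 h2] := tame_ge0 r t2.
exists (6 * (C * D)) => z zr; have [a1 b1] := h1 z zr; have [a2 b2] := h2 z zr.
have CD0 : 0 <= C * D by rewrite mulr_ge0.
split.
  rewrite cabsM (le_trans (ler_pM (cabs_ge0 _) (cabs_ge0 _) a1 a2)) //; lra.
move=> v vr; have [l [hl el]] := b1 v vr; have [k [hk ek]] := b2 v vr.
exists (l * f2 z + f1 z * k) => h hh.
have {}el := el h hh; have {}ek := ek h hh.
set x := cabs h in hh el ek *; have x0 : 0 <= x := cabs_ge0 _.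
set E := f1 (z + h *: v) - f1 z - l * h in el.
set F := f2 (z + h *: v) - f2 z - k * h in ek.
have -> : f1 (z + h *: v) * f2 (z + h *: v) - f1 z * f2 z - (l * f2 z + f1 z * k) * h =
    E * f2 z + (f1 z + l * h + E) * F + (l * h + E) * (k * h).
  by rewrite /E /F; ring.
have x21 : x ^+ 2 <= x by rewrite expr2 ler_piMl.
have x2 : 0 <= x ^+ 2 by rewrite exprn_ge0.
have lh : cabs (l * h) <= C * x by rewrite cabsM ler_wpM2r.
have kh : cabs (k * h) <= D * x by rewrite cabsM ler_wpM2r.
have lhE : cabs (l * h + E) <= 2 * C * x.
  rewrite (le_trans (cabsD _ _)) // (_ : 2 * C * x = C * x + C * x); last by ring.
  by rewrite lerD // (le_trans el) // ler_wpM2l.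
have sum : cabs (f1 z + l * h + E) <= 3 * C.
  rewrite -addrA (le_trans (cabsD _ _)) // (_ : 3 * C = C + 2 * C * 1); last by ring.
  by rewrite lerD // (le_trans lhE) // ler_wpM2l // mulr_ge0.
rewrite (le_trans (cabsD _ _)) // (_ : 6 * (C * D) * x ^+ 2 =
  (C * x ^+ 2 * D + 3 * C * (D * x ^+ 2)) + 2 * C * x * (D * x)); last by ring.
apply: lerD; last by rewrite cabsM ler_pM ?cabs_ge0.
by rewrite (le_trans (cabsD _ _)) // lerD // cabsM ler_pM ?cabs_ge0.
Qed.

Lemma tame_comp_mulmx f A : tame f -> tame (fun z => f (A *m z)).
Proof.
move=> tf r; have [D D0 hD] := n1_mulmx A; have [C hC] := tf (D * `|r|).
have rr : r <= `|r| by exact: ler_norm.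
have hr z : n1 z <= r -> n1 (A *m z) <= D * `|r|.
  by move=> zr; rewrite (le_trans (hD z)) // ler_wpM2l ?(ltW D0) // (le_trans zr).
exists C => z zr; have [a b] := hC _ (hr z zr); split=> // v vr.
have [l hl] := b _ (hr v vr); exists l => h hh.
by rewrite mulmxDr -scalemxAr hl.
Qed.

Lemma cabs_qform S : exists2 C, 0 < C & forall z, cabs (qform S z) <= C * n1 z ^+ 2.
Proof.
have [C C0 hC] := n1_mulmx S; exists C => // z.
by rewrite (le_trans (cabs_dot _ _)) // expr2 mulrCA ler_wpM2l ?n1_ge0.
Qed.

Lemma tame_cexp_linear a : tame (fun z => cexp (dot a z)).
Proof.
move=> r; pose q : R := n1 a * `|r|.
have q0 : 0 <= q by rewrite mulr_ge0 ?n1_ge0.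
have hr z : n1 z <= r -> cabs (dot a z) <= q.
  move=> zr; rewrite (le_trans (cabs_dot _ _)) // ler_wpM2l ?n1_ge0 //.
  by rewrite (le_trans zr) // ler_norm.
exists (expR q * (1 + q ^+ 2 * expR q)) => z zr.
have Eq0 : 0 <= expR q by exact: expR_ge0.
have ez : cabs (cexp (dot a z)) <= expR q.
  by rewrite (le_trans (cabs_cexp_le _)) // ler_expR hr.
split.
  rewrite (le_trans ez) // ler_peMr // lerDl mulr_ge0 // exprn_ge0 //.
move=> v vr; exists (cexp (dot a z) * dot a v) => h hh.
rewrite dotDr cexpD dotZr.
have -> : cexp (dot a z) * cexp (h * dot a v) - cexp (dot a z) - cexp (dot a z) * dot a v * h =
   cexp (dot a z) * (cexp (h * dot a v) - 1 - h * dot a v) by ring.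
have hv : cabs (h * dot a v) <= cabs h * q by rewrite cabsM ler_wpM2l ?cabs_ge0 // hr.
have hv' : cabs (h * dot a v) <= q by rewrite (le_trans hv) // ler_piMl.
rewrite cabsM -mulrA ler_pM ?cabs_ge0 // (le_trans (cexp_taylor1 _)) //.
rewrite mulrDl mul1r (le_trans _ (_ : (cabs h * q) ^+ 2 * expR q <= _)) //; last first.
  rewrite (_ : (cabs h * q) ^+ 2 * expR q = q ^+ 2 * expR q * cabs h ^+ 2); last by ring.
  by rewrite lerDr exprn_ge0 ?cabs_ge0.
apply: ler_pM; rewrite ?(exprn_ge0 _ (cabs_ge0 _)) ?expR_ge0 ?ler_expR //.
by rewrite lerXn2r ?nnegrE ?cabs_ge0 // mulr_ge0 ?cabs_ge0.
Qed.

Lemma tame_cexp_qform S : S^T = S -> tame (fun z => cexp (qform S z)).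
Proof.
move=> hS r; have [K K0 hK] := cabs_qform S; have [D D0 hD] := n1_mulmx S.
pose rr := `|r|; have rr0 : 0 <= rr by exact: normr_ge0.
have hrr : r <= rr by exact: ler_norm.
pose q : R := K * rr ^+ 2; pose p : R := 2 * (rr * (D * rr)).
have q0 : 0 <= q by rewrite mulr_ge0 ?exprn_ge0 // ltW.
have p0 : 0 <= p by rewrite !mulr_ge0 // ltW.
have hr z : n1 z <= r -> cabs (qform S z) <= q.
  move=> zr; rewrite (le_trans (hK z)) // ler_wpM2l ?(ltW K0) //.
  by rewrite lerXn2r ?nnegrE ?n1_ge0 // (le_trans zr).
have Eq0 : 0 <= expR q by exact: expR_ge0.
pose B : R := (p + q) ^+ 2 * expR (p + q) + q.
have B0 : 0 <= B by rewrite addr_ge0 // mulr_ge0 ?exprn_ge0 ?expR_ge0 ?addr_ge0.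
exists (expR q * (1 + B)) => z zr.
have ez : cabs (cexp (qform S z)) <= expR q.
  by rewrite (le_trans (cabs_cexp_le _)) // ler_expR hr.
split; first by rewrite (le_trans ez) // ler_peMr // lerDl.
move=> v vr; pose b := 2 * dot z (S *m v).
have bp : cabs b <= p.
  rewrite /b cabsM cabs_nat ler_wpM2l // (le_trans (cabs_dot _ _)) //.
  apply: ler_pM; rewrite ?n1_ge0 ?(le_trans zr) //.
  by rewrite (le_trans (hD v)) // ler_wpM2l ?(ltW D0) // (le_trans vr).
exists (cexp (qform S z) * b) => h hh.
set x := cabs h in hh *; have x0 : 0 <= x := cabs_ge0 _.
rewrite qformD // qformZ -scalemxAr dotZr.
pose a := h * b + h ^+ 2 * qform S v.
have -> : cexp (qform S z + 2 * (h * dot z (S *m v)) + h ^+ 2 * qform S v) - cexp (qform S z)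
    - cexp (qform S z) * b * h =
    cexp (qform S z) * ((cexp a - 1 - a) + h ^+ 2 * qform S v).
  have -> : qform S z + 2 * (h * dot z (S *m v)) + h ^+ 2 * qform S v = qform S z + a.
    by rewrite /a /b; ring.
  by rewrite cexpD; set Ea := cexp a; rewrite /a; ring.
have x21 : x ^+ 2 <= x by rewrite expr2 ler_piMl.
have aE : cabs a <= x * (p + q).
  rewrite (le_trans (cabsD _ _)) // mulrDr (cabsM h b) (cabsM (h ^+ 2)) cabsX -/x lerD ?ler_wpM2l //.
  by rewrite (le_trans (ler_wpM2l (exprn_ge0 _ x0) (hr v vr))) // ler_wpM2r.
have aE' : cabs a <= p + q by rewrite (le_trans aE) // ler_piMl // addr_ge0.
rewrite cabsM -[leRHS]mulrA ler_pM ?cabs_ge0 // mulrDl mul1r.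
apply: (@le_trans _ _ (B * x ^+ 2)); last by rewrite lerDr exprn_ge0.
rewrite (le_trans (cabsD _ _)) // /B mulrDl lerD //; last first.
  by rewrite (cabsM (h ^+ 2)) cabsX mulrC ler_wpM2r ?exprn_ge0 // hr.
rewrite (le_trans (cexp_taylor1 _)) //.
apply: (@le_trans _ _ ((x * (p + q)) ^+ 2 * expR (p + q))).
  apply: ler_pM; rewrite ?(exprn_ge0 _ (cabs_ge0 _)) ?expR_ge0 ?ler_expR //.
  by rewrite lerXn2r ?nnegrE ?cabs_ge0 // mulr_ge0 ?addr_ge0.
by rewrite le_eqVlt; apply/orP; left; apply/eqP; ring.
Qed.

End TameClosure.

(** * The symplectic action *)

Section SymplecticBlocks.
Variables (T : comNzRingType) (g : nat).
Implicit Types (A B C D sigma tau : 'M[T]_g).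

(** With J the standard form, the first three relations come from M^T J M = J and the last from M J
    M^T = J. *)
Definition symplectic_blocks A B C D :=
  [/\ A^T *m C = C^T *m A, B^T *m D = D^T *m B,
      A^T *m D - C^T *m B = 1%:M & C *m D^T = D *m C^T].

(** Taking [sigma] equal to [tau] gives the symmetry of the new period matrix; taking its conjugate
    gives the positivity of the imaginary part. *)
Lemma symplectic_pairing A B C D sigma tau : symplectic_blocks A B C D ->
  (sigma *m C^T + D^T) *m (A *m tau + B) - (sigma *m A^T + B^T) *m (C *m tau + D) =
  tau - sigma.
Proof.
move=> [h1 h2 h3 _].
have h3' : D^T *m A - B^T *m C = 1%:M.
  by have := congr1 trmx h3; rewrite trmx1 linearB /= !trmx_mul !trmxK.
rewrite !mulmxDl !mulmxDr !mulmxA -!(mulmxA sigma) h1 -h2.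
have -> : A^T *m D = 1%:M + C^T *m B by rewrite -h3 subrK.
have -> : D^T *m A = 1%:M + B^T *m C by rewrite -h3' subrK.
rewrite mulmxDl mulmxDr mul1mx mulmx1 !mulmxA.
set P := sigma *m _ *m A *m tau; set Q := sigma *m C^T *m B.
set U := B^T *m C *m tau; set V := B^T *m D.
rewrite opprD !opprD !addrA; apply/matrixP => i j; rewrite !mxE; ring.
Qed.

(** For symmetric [tau], this writes a lattice vector in the basis formed by the transposed
    numerator and denominator of the action. *)
Lemma symplectic_lattice A B C D tau (a b : 'cV[T]_g) : symplectic_blocks A B C D ->
  (tau *m A^T + B^T) *m (D *m a - C *m b) + (tau *m C^T + D^T) *m (- (B *m a) + A *m b) =
  tau *m a + b.
Proof.
move=> [h1 h2 h3 _].
have h3' : D^T *m A - B^T *m C = 1%:M.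
  by have := congr1 trmx h3; rewrite trmx1 linearB /= !trmx_mul !trmxK.
have e1 : A^T *m D = 1%:M + C^T *m B by rewrite -h3 subrK.
have e2 : D^T *m A = 1%:M + B^T *m C by rewrite -h3' subrK.
rewrite !mulmxDl !mulmxDr !mulmxN !mulmxA -!(mulmxA tau) e1 h1 h2 e2.
rewrite !mulmxDl !mulmxDr !mul1mx !mulmxA.
set t := tau *m a; set u := tau *m C^T *m B *m a; set v := tau *m C^T *m A *m b.
set w := D^T *m B *m a; set x := B^T *m C *m b.
by apply/matrixP => i j; rewrite !mxE; ring.
Qed.

End SymplecticBlocks.

Lemma map_symplectic_blocks (T U : comNzRingType) (f : {rmorphism T -> U}) g (A B C D : 'M[T]_g) :
  symplectic_blocks A B C D ->
  symplectic_blocks (map_mx f A) (map_mx f B) (map_mx f C) (map_mx f D).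
Proof.
move=> [h1 h2 h3 h4]; split; rewrite !map_trmx -!map_mxM.
- by rewrite h1.
- by rewrite h2.
- by rewrite -map_mxB h3 map_mx1.
- by rewrite h4.
Qed.

(** M J M^T = J exhibits - J M^T J as a right inverse of M; being also a left inverse, it yields M^T
    J M = J. *)
Lemma symplectic_groupP g (M : 'M[int]_(g + g)) : symplectic_group M ->
  symplectic_blocks (ulsubmx M) (ursubmx M) (dlsubmx M) (drsubmx M).
Proof.
rewrite /symplectic_group /=; set J := symplectic_form g => hM.
have JJ : J *m J = - 1%:M.
  rewrite /J /symplectic_form mulmx_block !mul0mx !mulmx0 !mul1mx !mulmx1 !addr0 !add0r.
  by rewrite [in RHS]scalar_mx_block opp_block_mx !oppr0.
have h : M *m (J *m M^T *m - J) = 1%:M.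
  by rewrite !mulmxA hM mulmxN JJ opprK.
have h' := mulmx1C h.
have hT : M^T *m J *m M = J.
  have := congr1 (mulmx J) h'.
  by rewrite mulmx1 !mulmxA JJ mulNmx mul1mx !(mulNmx, mulmxN) opprK.
have := etrans (congr1 (fun X => X^T *m J *m X) (submxK M)) hT.
have := etrans (congr1 (fun X => X *m J *m X^T) (submxK M)) hM.
rewrite /J /symplectic_form !tr_block_mx !mulmx_block.
rewrite !mulmx0 ?mul0mx !mulmxN !mulmx1 !add0r !addr0 !mulNmx.
move=> /eq_block_mx[_ _ _ e4] /eq_block_mx[f1 f2 _ f4].
split.
- by apply/eqP; rewrite -subr_eq0 -f1 addrC.
- by apply/eqP; rewrite -subr_eq0 -f4 addrC.
- by rewrite -f2 addrC.
- by apply/eqP; rewrite -subr_eq0 -e4 addrC.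
Qed.

Section SiegelAction.
Variables (R : realType) (g : nat).
Implicit Types (A B C D tau : 'M[Cx R]_g) (v : 'cV[Cx R]_g) (x : 'cV[R]_g).

Definition cj m n (A : 'M[Cx R]_(m, n)) : 'M[Cx R]_(m, n) := map_mx (@conjc R) A.

Lemma cjM m n p (A : 'M[Cx R]_(m, n)) (B : 'M[Cx R]_(n, p)) : cj (A *m B) = cj A *m cj B.
Proof. exact: (@map_mxM R[i] R[i] (@conjc R)). Qed.

Lemma cjD m n (A B : 'M[Cx R]_(m, n)) : cj (A + B) = cj A + cj B.
Proof. exact: (@map_mxD R[i] R[i] (@conjc R)). Qed.

Lemma cj0 m n : cj (0 : 'M[Cx R]_(m, n)) = 0.
Proof. exact: (@map_mx0 R[i] R[i] (@conjc R)). Qed.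

Lemma cj_tr m n (A : 'M[Cx R]_(m, n)) : cj A^T = (cj A)^T.
Proof. by rewrite /cj map_trmx. Qed.

Lemma cj_rc m n (A : 'M[R]_(m, n)) : cj (map_mx (@rc R) A) = map_mx (@rc R) A.
Proof. by apply/matrixP => i j; rewrite !mxE; exact: conjc_real. Qed.

Lemma cj_intr m n (A : 'M[int]_(m, n)) : cj (map_mx intr A) = map_mx intr A.
Proof.
by apply/matrixP => i j; rewrite !mxE -rc_int; exact: conjc_real.
Qed.

Definition csqnorm v : R := \sum_i cabs (v i 0) ^+ 2.

Lemma subcj tau : tau - cj tau = (2 * (0 +i* 1)) *: map_mx (@rc R) (imag tau).
Proof.
apply/matrixP => i j; rewrite !mxE; case: (tau i j) => x y.
by apply/eqP; rewrite eq_complex /=; apply/andP; split; apply/eqP; ring.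
Qed.

(** The cross terms between real and imaginary parts cancel by symmetry. *)
Lemma hermitian_form (Y : 'M[R]_g) v : Y^T = Y ->
  ((cj v)^T *m map_mx (@rc R) Y *m v) 0 0 =
  rc (rform Y (map_mx (@complex.Re R) v) + rform Y (map_mx (@complex.Im R) v)).
Proof.
move=> hY; rewrite mxE.
have -> : \sum_j ((cj v)^T *m map_mx (@rc R) Y) 0 j * v j 0 =
    \sum_i \sum_j conjc (v i 0) * rc (Y i j) * v j 0.
  rewrite exchange_big /=; apply: eq_bigr => j _; rewrite mxE mulr_suml.
  by apply: eq_bigr => i _; rewrite !mxE.
apply/eqP; rewrite eq_complex; apply/andP; split; apply/eqP.
- rewrite Re_sum /= !rformE -big_split; apply: eq_bigr => i _.
  rewrite Re_sum -big_split; apply: eq_bigr => j _; rewrite !mxE.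
  by case: (v i 0) (v j 0) => [a b] [c d] /=; ring.
- rewrite Im_sum /=.
  have E (i : 'I_g) : complex.Im (\sum_j conjc (v i 0) * rc (Y i j) * v j 0) =
      \sum_j (complex.Re (v i 0) * Y i j * complex.Im (v j 0) - complex.Im (v i 0) * Y i j * complex.Re (v j 0)).
    rewrite Im_sum; apply: eq_bigr => j _.
    by case: (v i 0) (v j 0) => [a b] [c d] /=; ring.
  rewrite (eq_bigr _ (fun i _ => E i)).
  under eq_bigr do rewrite sumrB; rewrite sumrB.
  apply/eqP; rewrite subr_eq0 exchange_big /=; apply/eqP.
  apply: eq_bigr => i _; apply: eq_bigr => j _.
  have -> : Y j i = Y i j by rewrite -[in LHS]hY mxE.
  ring.
Qed.

Lemma sqnorm_ReIm v : sqnorm (map_mx (@complex.Re R) v) + sqnorm (map_mx (@complex.Im R) v) = csqnorm v.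
Proof.
rewrite /sqnorm /csqnorm -big_split; apply: eq_bigr => i _; rewrite !mxE cabsE.
by rewrite sqr_sqrtr // addr_ge0 ?sqr_ge0.
Qed.

Lemma csqnorm_eq0 v : csqnorm v <= 0 -> v = 0.
Proof.
move=> h; apply/matrixP => i j; rewrite (ord1 j) [RHS]mxE; apply/eqP.
rewrite -cabs_eq0 -sqrf_eq0 eq_le exprn_ge0 ?cabs_ge0 // andbT (le_trans _ h) //.
by rewrite /csqnorm (bigD1 i) //= lerDl sumr_ge0 // => k _; rewrite exprn_ge0 // cabs_ge0.
Qed.

Lemma sq_n1_le v : n1 v ^+ 2 <= g%:R * csqnorm v.
Proof.
have : n1 v ^+ 2 + n1 v ^+ 2 <= g%:R * csqnorm v + g%:R * csqnorm v; last by lra.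
have -> : n1 v ^+ 2 = \sum_i \sum_j cabs (v i 0) * cabs (v j 0).
  by rewrite expr2 /n1 mulr_suml; apply: eq_bigr => i _; rewrite mulr_sumr.
have E1 : g%:R * csqnorm v = \sum_(i < g) \sum_(j < g) cabs (v i 0) ^+ 2.
  rewrite /csqnorm mulr_sumr; apply: eq_bigr => i _.
  by rewrite sumr_const card_ord mulr_natl.
have E2 : g%:R * csqnorm v = \sum_(i < g) \sum_(j < g) cabs (v j 0) ^+ 2.
  by rewrite E1 exchange_big.
rewrite {1}E1 E2 -!big_split; apply: ler_sum => i _; rewrite -!big_split; apply: ler_sum => j _ /=.
by have := sqr_ge0 (cabs (v i 0) - cabs (v j 0)); rewrite sqrrB; lra.
Qed.

Lemma imag_sym tau : tau^T = tau -> (imag tau)^T = imag tau.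
Proof. by move=> h; apply/matrixP => i j; rewrite !mxE -[in RHS]h mxE. Qed.

Section Action.
Variables A B C D tau : 'M[Cx R]_g.

Definition cocycle := C *m tau + D.
Definition numerator := A *m tau + B.
Definition act := numerator *m invmx cocycle.

Lemma hermitian_pairing v s : strongly_positive tau s -> tau^T = tau ->
  exists2 q : R, s * csqnorm v <= q &
  ((cj v)^T *m (tau - cj tau) *m v) 0 0 = 2 * (0 +i* 1) * rc q.
Proof.
move=> [s0 hs] hT; rewrite subcj.
exists (rform (imag tau) (map_mx (@complex.Re R) v) + rform (imag tau) (map_mx (@complex.Im R) v)).
  by rewrite -sqnorm_ReIm mulrDr lerD.
by rewrite -scalemxAr -scalemxAl mxE hermitian_form // imag_sym.
Qed.

Hypothesis sp : symplectic_blocks A B C D.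
Hypotheses (rA : cj A = A) (rB : cj B = B) (rC : cj C = C) (rD : cj D = D).
Hypothesis tT : tau^T = tau.

Lemma cj_pairing :
  (cj cocycle)^T *m numerator - (cj numerator)^T *m cocycle = tau - cj tau.
Proof.
have h := symplectic_pairing (cj tau) tau sp; rewrite -h.
rewrite /cocycle /numerator !cjD !cjM rA rB rC rD !linearD /= !trmx_mul.
by rewrite -!cj_tr tT.
Qed.

Lemma tr_pairing :
  cocycle^T *m numerator - numerator^T *m cocycle = 0.
Proof.
have h := symplectic_pairing tau tau sp; rewrite subrr in h; rewrite -[RHS]h.
by rewrite /cocycle /numerator !linearD /= !trmx_mul tT.
Qed.

(** On a kernel vector, [cj_pairing] makes the Hermitian form of [tau - cj tau] vanish, so the
    vector is zero by positivity. *)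
Lemma cocycle_unit s : strongly_positive tau s -> cocycle \in unitmx.
Proof.
move=> hs; rewrite -unitmx_tr unitmxE unitfE; apply/det0P => -[u u0 hu].
have Nv : cocycle *m u^T = 0 by rewrite -[LHS]trmxK trmx_mul trmxK hu trmx0.
have [q hq hE] := hermitian_pairing u^T hs tT.
move: hE; rewrite -cj_pairing mulmxBr mulmxBl.
rewrite mulmxA -trmx_mul -cjM Nv cj0 trmx0 !mul0mx -!mulmxA Nv !mulmx0 subrr mxE.
move/esym/eqP; rewrite mulf_eq0 => /orP[|/eqP/complexI q0].
  rewrite mulf_eq0 pnatr_eq0 /= eq_complex /= => /andP[_]; by rewrite oner_eq0.
move: u0; rewrite -[u]trmxK (_ : u^T = 0) ?trmx0 ?eqxx //.
apply: csqnorm_eq0; move: hq; rewrite q0; case: hs => s0 _.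
by rewrite pmulr_rle0.
Qed.

Lemma act_sym s : strongly_positive tau s -> act^T = act.
Proof.
move=> hs; have U := cocycle_unit hs; have UT : cocycle^T \in unitmx by rewrite unitmx_tr.
have h : cocycle^T *m numerator = numerator^T *m cocycle.
  by apply/eqP; rewrite -subr_eq0 tr_pairing.
rewrite /act trmx_mul trmx_inv.
have -> : numerator^T = cocycle^T *m numerator *m invmx cocycle by rewrite h mulmxK.
by rewrite !mulmxA mulVmx // mul1mx.
Qed.

(** For x = (C tau + D) v, the imaginary part of the new matrix at x equals the Hermitian form of
    that of [tau] at v. The constant comes from |x|^2 <= (K n1 v)^2 <= K^2 g |v|^2. *)
Lemma act_positive s : strongly_positive tau s -> exists s', strongly_positive act s'.
Proof.
move=> hs; have U := cocycle_unit hs; have [K K0 hK] := n1_mulmx cocycle.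
have aT := act_sym hs.
have g1 : 0 < g%:R + 1 :> R by rewrite ltr_wpDl.
exists (s / (K ^+ 2 * (g%:R + 1))); split.
  by rewrite divr_gt0 ?(proj1 hs) // mulr_gt0 // exprn_gt0.
move=> x; pose w : 'cV[Cx R]_g := map_mx (@rc R) x; pose v := invmx cocycle *m w.
have wv : w = cocycle *m v by rewrite /v mulKVmx.
have [q hq hE] := hermitian_pairing v hs tT.
have qE : rform (imag act) x = q.
  have : ((cj w)^T *m (act - cj act) *m w) 0 0 = 2 * (0 +i* 1) * rc q.
    rewrite -hE -cj_pairing wv cjM trmx_mul; congr (_ _ 0 0).
    have e1 : act *m cocycle = numerator by rewrite /act mulmxKV.
    have e2 : (cj cocycle)^T *m cj act = (cj numerator)^T.
      have -> : cj act = (cj act)^T by rewrite -cj_tr aT.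
      by rewrite -trmx_mul -cjM e1.
    rewrite -!mulmxA; congr (_ *m _); rewrite !mulmxA; congr (_ *m _).
    by rewrite mulmxBr mulmxBl e2 -[_ *m act *m _]mulmxA e1.
  rewrite subcj -scalemxAr -scalemxAl mxE hermitian_form ?cj_rc.
    move/mulfI => /(_ _)/complexI h.
    rewrite -h; last first.
      by rewrite mulf_neq0 // ?pnatr_eq0 // eq_complex /= oner_eq0 andbF.
    have -> : map_mx (@complex.Re R) w = x by apply/matrixP => i j; rewrite !mxE.
    have -> : map_mx (@complex.Im R) w = 0 by apply/matrixP => i j; rewrite !mxE.
    have -> : rform (imag act) 0 = 0 by rewrite /rform mulmx0 mxE.
    by rewrite addr0.
  exact: imag_sym.
rewrite qE (le_trans _ hq) // mulrAC ler_pdivrMr; last by rewrite mulr_gt0 // exprn_gt0.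
rewrite -mulrA ler_pM2l ?(proj1 hs) //.
have xw : sqnorm x = csqnorm w.
  by apply: eq_bigr => i _; rewrite mxE cabs_rc real_normK ?num_real.
have : csqnorm w <= n1 w ^+ 2.
  rewrite /csqnorm expr2 {1}/n1 mulr_suml; apply: ler_sum => i _.
  by rewrite expr2 ler_wpM2l ?cabs_ge0 // cabs_le_n1.
rewrite xw => h; apply: (le_trans h).
apply: (@le_trans _ _ ((K * n1 v) ^+ 2)).
  by rewrite lerXn2r ?nnegrE ?n1_ge0 ?mulr_ge0 ?n1_ge0 ?(ltW K0) // {1}wv hK.
rewrite exprMn [leRHS]mulrC -[leRHS]mulrA ler_pM2l ?exprn_gt0 // (le_trans (sq_n1_le v)) //.
by rewrite ler_wpM2r ?lerDl // sumr_ge0 // => i _; rewrite exprn_ge0 // cabs_ge0.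
Qed.

(** This matrix gives the quadratic form in the exponential factor of the transformation formula. *)
Lemma twist_sym s : strongly_positive tau s -> (invmx cocycle *m C)^T = invmx cocycle *m C.
Proof.
move=> hs; have U := cocycle_unit hs; have UT : cocycle^T \in unitmx by rewrite unitmx_tr.
have [_ _ _ h4] := sp.
have h : C *m cocycle^T = cocycle *m C^T.
  by rewrite /cocycle [(_ + _)^T]linearD /= trmx_mul tT mulmxDr mulmxDl mulmxA h4.
rewrite trmx_mul trmx_inv.
have -> : C^T = invmx cocycle *m (C *m cocycle^T) by rewrite h mulKmx.
by rewrite !mulmxA mulmxK.
Qed.

End Action.

End SiegelAction.

(** * Theta functions are characterized by their quasi-periods *)

Section ThetaCharacterization.
Variables (R : realType) (g : nat).
Implicit Types (m a b : 'cV[int]_g) (c : characteristic g)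
  (tau : 'M[Cx R]_g) (z w : 'cV[Cx R]_g).
Local Notation ipi := (ipi R).

Definition quasi_periodic c tau (f : 'cV[Cx R]_g -> Cx R) := forall z a b,
  f (z + tau *m iv R a + iv R b) =
  cexp (ipi * (- qform tau (iv R a) - 2 * dot (iv R a) z +
    (idot (lift01 c.1) b - idot (lift01 c.2) a)%:~R)) * f z.

(** Otherwise the normalized grid means of [theta_mean] would be 0 and not tend to 1. *)
Lemma theta_neq0 c tau s : strongly_positive tau s -> exists z, theta c tau z != 0.
Proof.
move=> hs; apply: contrapT => h.
have h0 z : theta c tau z = 0 by apply/eqP/negPn/negP => hz; apply: h; exists z.
have [k0 _ hk] := theta_mean c hs.
have : (-1 : Cx R) = 0; last by move/eqP; rewrite oppr_eq0 oner_eq0.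
apply: (@null_cst R); apply: eq_null hk => N.
rewrite (eq_gavg (G := fun=> 0)) ?gavg_cst ?sub0r // => k.
by rewrite h0 mulr0.
Qed.

Lemma half_dot_iv (e : 'cV['F_2]_g) m : 2 * ipi * dot (half_char R e) (iv R m) =
  ipi * (idot (lift01 e) m)%:~R.
Proof. by rewrite half_char_lift dotZl dot_iv; field. Qed.

Lemma theta_unique c tau s f : strongly_positive tau s -> tau^T = tau ->
  tame f -> quasi_periodic c tau f -> exists K, forall z, f z = K * theta c tau z.
Proof.
move=> hs hT tf qf; have [k0 k00 hk] := theta_mean c hs.
(* [E] compensates the signs (-1)^(epsilon . b) under translation by integer vectors b, so that
   [E * h] is periodic. *)
pose E z : Cx R := cexp (dot (- (2 * ipi) *: half_char R c.1) z).
have E0 z : E z != 0 by exact: cexp_neq0.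
have EE z : E z = cexp (- (2 * ipi) * dot (half_char R c.1) z) by rewrite /E dotZl.
have tE : tame E by exact: tame_cexp_linear.
have qt : quasi_periodic c tau (theta c tau).
  by move=> z a b; exact: theta_quasi_periodic hs hT.
have tth : tame (theta c tau) := theta_tame c hs.
have Em z m : E (z + iv R m) = cexp (- (ipi * (idot (lift01 c.1) m)%:~R)) * E z.
  by rewrite !EE dotDr mulrDr cexpD mulrC !mulNr half_dot_iv.
have per h : quasi_periodic c tau h -> periodic (fun z => E z * h z).
  move=> qh m z; rewrite Em.
  have := qh z 0 m; rewrite iv0 mulmx0 addr0 => ->.
  have -> : qform tau 0 = 0 by rewrite /qform mulmx0 dot0r.
  have -> : idot (lift01 c.2) 0 = 0.
    by rewrite /idot big1 // => j _; rewrite [X in _ * X]mxE mulr0.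
  rewrite [dot 0 z]dotC dot0r mulr0 subr0 oppr0 add0r subr0 cexpN.
  by rewrite mulrACA mulVf ?mul1r // cexp_neq0.
pose cm m := cexp (ipi * (- qform tau (iv R m) - (idot (lift01 c.2) m)%:~R)) *
   cexp (- (2 * ipi) * dot (half_char R c.1) (tau *m iv R m)).
have mul h : quasi_periodic c tau h -> forall m z,
    E (z + tau *m iv R m) * h (z + tau *m iv R m) =
    cm m * cexp (- (2 * ipi) * dot (iv R m) z) * (E z * h z).
  move=> qh m z; have := qh z m 0; rewrite iv0 addr0 => ->.
  have -> : idot (lift01 c.1) 0 = 0.
    by rewrite /idot big1 // => j _; rewrite [X in _ * X]mxE mulr0.
  rewrite !EE dotDr mulrDr cexpD /cm sub0r rmorphN /=.
  set X := cexp (- (2 * ipi) * dot (half_char R c.1) z).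
  set Y := cexp (- (2 * ipi) * dot (half_char R c.1) (tau *m iv R m)).
  have -> : cexp (ipi * (- qform tau (iv R m) - 2 * dot (iv R m) z - (idot (lift01 c.2) m)%:~R)) =
     cexp (ipi * (- qform tau (iv R m) - (idot (lift01 c.2) m)%:~R)) * cexp (- (2 * ipi) * dot (iv R m) z).
    by rewrite -cexpD; congr cexp; ring.
  ring.
pose f2 z := k0 * (E z * theta c tau z).
have t2 : tame f2.
  have tk : tame (fun _ : 'cV[Cx R]_g => k0).
    move=> r; exists (cabs k0) => z _; split=> // v _; exists 0 => x _.
    by rewrite subrr mul0r subr0 cabs0 mulr_ge0 ?exprn_ge0 ?cabs_ge0.
  exact: tameM tk (tameM tE tth).
have p2 : periodic f2 by move=> m z; rewrite /f2 (per _ qt).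
have m2 m z : f2 (z + tau *m iv R m) = cm m * cexp (- (2 * ipi) * dot (iv R m) z) * f2 z.
  by rewrite /f2 (mul _ qt) mulrCA.
have mean : null (fun N => gavg (fun k : {ffun 'I_g -> 'I_N.+1} => f2 (gpt R k)) - 1).
  by apply: eq_null hk => N; congr (_ - _); apply: eq_gavg => k; rewrite /f2 EE mulrA.
have cm0 m : cm m != 0 by rewrite mulf_neq0 ?cexp_neq0.
have H := tame_proportional (tameM tE tf) t2 (per _ qf) p2 cm0 (mul _ qf) m2 mean.
have [w hw] := theta_neq0 c hs.
exists (f w / theta c tau w) => z.
have alg1 (k b a t x u : Cx R) : t != 0 ->
    a * x * (k * (b * u)) = k * (b * (a * t)) * (x / t * u) by move=> tn0; field.
have alg2 (k b a t x : Cx R) : b * x * (k * (a * t)) = k * (b * (a * t)) * x by ring.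
have := H z w; rewrite /f2 (alg2 k0 (E z) (E w) (theta c tau w) (f z)).
rewrite (alg1 k0 (E z) (E w) (theta c tau w) (f w) (theta c tau z)) // => /mulfI; apply.
by rewrite !mulf_neq0.
Qed.

Lemma F2_intr_eq0 (n : int) : (n%:~R == 0 :> 'F_2) = ~~ odd `|n|.
Proof.
have -> : (n%:~R == 0 :> 'F_2) = ((`|n|%N)%:R == 0 :> 'F_2).
  by case: n => n //; rewrite NegzE rmorphN oppr_eq0 abszN.
by rewrite -dvdn2 (dvdn_pcharf (pchar_Fp (isT : prime 2))).
Qed.

Lemma cexp_ipi_F2 (n n' : int) : n%:~R = n'%:~R :> 'F_2 ->
  cexp (ipi * n%:~R) = cexp (ipi * n'%:~R).
Proof.
move=> h; have e : ~~ odd `|n - n'|.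
  by rewrite -F2_intr_eq0 rmorphB /= h subrr.
rewrite -[n](subrK n') rmorphD /= mulrDr cexpD cexp_ipi_int -signr_odd (negPf e).
by rewrite mul1r.
Qed.

Lemma additive_F2 (f : 'cV[int]_g -> 'F_2) : (forall a b, f (a + b) = f a + f b) ->
  forall a, f a = \sum_j (a j 0)%:~R * f (delta_mx j 0).
Proof.
move=> fD a.
have f0 : f 0 = 0 by apply: (addrI (f 0)); rewrite -fD !addr0.
have fN x : f (- x) = - f x by apply: (addrI (f x)); rewrite -fD !subrr.
have fn (n : nat) x : f (n%:Z *: x) = n%:R * f x.
  elim: n => [|n IH]; first by rewrite scale0r f0 mul0r.
  by rewrite intS scalerDl fD IH scale1r -[n.+1%:R]natr1 mulrDl mul1r addrC.
have fZ (n : int) x : f (n *: x) = n%:~R * f x.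
  case: n => n; first exact: fn.
  by rewrite NegzE scaleNr fN fn rmorphN mulNr.
have -> : a = \sum_j a j 0 *: delta_mx j 0.
  apply/matrixP => i k; rewrite (ord1 k) summxE (bigD1 i) //= !mxE !eqxx mulr1.
  by rewrite big1 ?addr0 // => j /negPf h; rewrite !mxE eq_sym h mulr0.
rewrite [LHS](big_morph f fD f0); apply: eq_bigr => j _; rewrite fZ; congr (_%:~R * _).
rewrite summxE (bigD1 j) //= !mxE !eqxx mulr1.
by rewrite big1 ?addr0 // => k /negPf h; rewrite !mxE eq_sym h mulr0.
Qed.

End ThetaCharacterization.

Section ThetaTransformation.
Variables (R : realType) (g : nat) (Ai Bi Ci Di : 'M[int]_g) (tau : 'M[Cx R]_g) (s : R).
Implicit Types (m a b : 'cV[int]_g) (c : characteristic g) (z w : 'cV[Cx R]_g).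
Local Notation ipi := (ipi R).
Local Notation toC := (map_mx (intr : int -> Cx R)).
Hypothesis spI : symplectic_blocks Ai Bi Ci Di.
Hypotheses (hs : strongly_positive tau s) (hT : tau^T = tau).
Local Notation A := (toC Ai).
Local Notation B := (toC Bi).
Local Notation C := (toC Ci).
Local Notation D := (toC Di).
Local Notation N := (cocycle C D tau).
Local Notation tau' := (act A B C D tau).

Let sp : symplectic_blocks A B C D := map_symplectic_blocks (intr : {rmorphism int -> Cx R}) spI.
Let N_unit : N \in unitmx :=
  cocycle_unit sp (cj_intr _ Ai) (cj_intr _ Bi) (cj_intr _ Ci) (cj_intr _ Di) hT hs.
Let tau'_sym : tau'^T = tau' :=
  act_sym sp (cj_intr _ Ai) (cj_intr _ Bi) (cj_intr _ Ci) (cj_intr _ Di) hT hs.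
Let S := invmx N *m C.
Let S_sym : S^T = S :=
  twist_sym sp (cj_intr _ Ai) (cj_intr _ Bi) (cj_intr _ Ci) (cj_intr _ Di) hT hs.

(* The coordinates of [tau a + b] in the lattice of [tau'], scaled by [N^-T]. *)
Definition new_a a b := Di *m a - Ci *m b.
Definition new_b a b := - (Bi *m a) + Ai *m b.

Lemma iv_mul (P : 'M[int]_g) a : iv R (P *m a) = toC P *m iv R a.
Proof. exact: map_mxM. Qed.

Lemma dot_toC (P : 'M[int]_g) x y : idot x (P *m y) = idot (P^T *m x) y.
Proof.
apply: (@intr_inj (Cx R)); rewrite -!dot_iv !iv_mul dot_mulmx.
by rewrite map_trmx.
Qed.

Lemma idotC a b : idot a b = idot b a.
Proof. by apply: eq_bigr => j _; rewrite mulrC. Qed.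

Lemma idotDl a b m : idot (a + b) m = idot a m + idot b m.
Proof. by rewrite /idot -big_split; apply: eq_bigr => j _; rewrite mxE mulrDl. Qed.

Lemma idotDr a b m : idot m (a + b) = idot m a + idot m b.
Proof. by rewrite idotC idotDl !(idotC m). Qed.

Lemma idotNl a m : idot (- a) m = - idot a m.
Proof. by rewrite /idot -sumrN; apply: eq_bigr => j _; rewrite mxE mulNr. Qed.

Lemma idotNr a m : idot m (- a) = - idot m a.
Proof. by rewrite idotC idotNl idotC. Qed.

Lemma lattice_change a b :
  (invmx N)^T *m (tau *m iv R a + iv R b) = tau' *m iv R (new_a a b) + iv R (new_b a b).
Proof.
have U : N^T \in unitmx by rewrite unitmx_tr.
rewrite trmx_inv; apply: (can_inj (mulKmx U)); rewrite mulKVmx // mulmxDr mulmxA.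
have -> : N^T *m tau' = (numerator A B tau)^T.
  by rewrite -{1}tau'_sym -trmx_mul /act mulmxKV.
have -> : N^T = tau *m C^T + D^T by rewrite /cocycle [(_ + _)^T]linearD /= trmx_mul hT.
have -> : (numerator A B tau)^T = tau *m A^T + B^T.
  by rewrite /numerator [(_ + _)^T]linearD /= trmx_mul hT.
have -> : iv R (new_a a b) = D *m iv R a - C *m iv R b by rewrite ivD ivN !iv_mul.
have -> : iv R (new_b a b) = - (B *m iv R a) + A *m iv R b by rewrite ivD ivN !iv_mul.
by rewrite symplectic_lattice.
Qed.

Lemma twist_lattice a b :
  S *m (tau *m iv R a + iv R b) = iv R a - invmx N *m iv R (new_a a b).
Proof.
apply: (can_inj (mulKmx N_unit)); rewrite /S mulmxBr mulKVmx // -mulmxA mulKVmx //.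
rewrite /new_a ivD ivN !iv_mul /cocycle mulmxDl mulmxDr !mulmxA opprB.
set X := C *m tau *m _; set Y := D *m _; set Z := C *m _.
by apply/matrixP => i j; rewrite !mxE; ring.
Qed.

(** The linear map carries the lattice of [tau] to that of [tau'], and the exponential corrects the
    quasi-periods. *)
Definition twisted c z : Cx R := cexp (- ipi * qform S z) * theta c tau' ((invmx N)^T *m z).

(** Exponent of the sign in the quasi-periods of [twisted]. Being additive modulo 2, it has the form
    prescribed by a characteristic. *)
Definition kappa c a b : int := idot (new_a a b) (new_b a b) - idot a b +
  idot (lift01 c.1) (new_b a b) - idot (lift01 c.2) (new_a a b).

Lemma twisted_quasi c z a b s' : strongly_positive tau' s' ->
  twisted c (z + tau *m iv R a + iv R b) =
  cexp (ipi * (- qform tau (iv R a) - 2 * dot (iv R a) z + (kappa c a b)%:~R)) * twisted c z.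
Proof.
move=> hs'; rewrite /twisted -addrA mulmxDr lattice_change [(invmx N)^T *m z + _]addrA.
rewrite (theta_quasi_periodic c _ _ _ hs' tau'_sym).
set a' := new_a a b; set b' := new_b a b; set w := (invmx N)^T *m z.
rewrite (qformD z) //; set lam := tau *m iv R a + iv R b.
(* Up to the integers collected in [kappa], the linear and quadratic parts of the exponential
   exchange the factors for [tau'] with those for [tau]. *)
have e1 : dot z (S *m lam) = dot (iv R a) z - dot (iv R a') w.
  rewrite twist_lattice dotDr dotNr [dot z (iv R a)]dotC; congr (_ - _).
  by rewrite dot_mulmx dotC.
have e2 : qform S lam = qform tau (iv R a) + (idot a b)%:~R - qform tau' (iv R a') - (idot a' b')%:~R.
  rewrite /qform twist_lattice dotDr dotNr {1}/lam dotDl [dot (tau *m _) _]dotC [dot (iv R b) _]dotC dot_iv.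
  rewrite [dot lam (invmx N *m _)]dot_mulmx lattice_change dotDl [dot (tau' *m _) _]dotC [dot (iv R b') _]dotC dot_iv -/a' -/b'.
  ring.
rewrite e1 e2 mulrA -cexpD mulrA -cexpD; congr (cexp _ * _).
by rewrite /kappa -/a' -/b' !rmorphB rmorphD rmorphB /=; ring.
Qed.

(** The change of lattice coordinates preserves the alternating pairing, so the polarization of the
    quadratic part is even. *)
Lemma kappaD c a1 b1 a2 b2 :
  (kappa c (a1 + a2) (b1 + b2))%:~R = (kappa c a1 b1)%:~R + (kappa c a2 b2)%:~R :> 'F_2.
Proof.
have na : new_a (a1 + a2) (b1 + b2) = new_a a1 b1 + new_a a2 b2.
  by rewrite /new_a !mulmxDr opprD addrACA.
have nb : new_b (a1 + a2) (b1 + b2) = new_b a1 b1 + new_b a2 b2.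
  by rewrite /new_b !mulmxDr opprD addrACA.
have pairing : idot (new_a a1 b1) (new_b a2 b2) - idot (new_b a1 b1) (new_a a2 b2) =
    idot a1 b2 - idot b1 a2.
  rewrite /new_a /new_b !idotDl !idotNl !idotDr !idotNr.
  rewrite !(idotC (_ *m a1)) !(idotC (_ *m b1)) !dot_toC.
  rewrite !(idotC _ a1) !(idotC _ b1) !mulmxA.
  have [h1 h2 h3 _] := spI.
  have h3' : Di^T *m Ai - Bi^T *m Ci = 1%:M.
    by have := congr1 trmx h3; rewrite trmx1 linearB /= !trmx_mul !trmxK.
  have e1 : Ai^T *m Di = 1%:M + Ci^T *m Bi by rewrite -h3 subrK.
  have e2 : Di^T *m Ai = 1%:M + Bi^T *m Ci by rewrite -h3' subrK.
  rewrite e1 e2 h1 h2 !mulmxDl !mul1mx !idotDr.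
  ring.
have -> : kappa c (a1 + a2) (b1 + b2) = kappa c a1 b1 + kappa c a2 b2 +
    2 * (idot (new_b a1 b1) (new_a a2 b2) - idot b1 a2).
  move: pairing; rewrite /kappa na nb.
  move: (new_a a1 b1) (new_a a2 b2) (new_b a1 b1) (new_b a2 b2) => p1 p2 q1 q2 pairing.
  rewrite !idotDl !idotDr (idotC p2 q1) (idotC a2 b1).
  have -> : idot p1 q2 = idot q1 p2 + (idot a1 b2 - idot b1 a2) by rewrite -pairing addrC subrK.
  ring.
by rewrite !rmorphD rmorphM /= (_ : 2%:~R = 0 :> 'F_2) ?mul0r ?addr0 //; apply/eqP.
Qed.

End ThetaTransformation.

(** * Rank of the Hessian along an orbit *)

Section HessianTransformation.
Variables (R : realType) (g : nat).
Implicit Types (S H : 'M[Cx R]_g) (z w : 'cV[Cx R]_g).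

Lemma cubic_bound_eq0 (q : Cx R) (C d : R) : 0 < d ->
  (forall t : R, 0 < t -> t <= d -> cabs (rc t ^+ 2 * q) <= C * t ^+ 3) -> q = 0.
Proof.
move=> d0 h; apply/eqP; rewrite -cabs_eq0 eq_le cabs_ge0 andbT.
apply/ler_addgt0Pr => e e0; rewrite add0r.
have C1 : 0 < `|C| + 1 by rewrite ltr_wpDl.
pose t := Num.min d (e / (`|C| + 1)).
have t0 : 0 < t by rewrite lt_min d0 divr_gt0.
have td : t <= d by rewrite ge_min lexx.
have te : t <= e / (`|C| + 1) by rewrite ge_min lexx orbT.
have := h t t0 td; rewrite cabsM cabsX cabs_rc gtr0_norm //.
rewrite (_ : C * t ^+ 3 = t ^+ 2 * (C * t)); last by ring.
rewrite ler_pM2l ?exprn_gt0 // => hq.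
rewrite (le_trans hq) // (le_trans (ler_wpM2r (ltW t0) (ler_norm C))) //.
rewrite (le_trans (ler_wpM2l (normr_ge0 _) te)) // mulrCA ler_piMr ?(ltW e0) //.
by rewrite ler_pdivrMr // mul1r lerDl.
Qed.

Lemma qform_inj S H : S^T = S -> H^T = H -> qform S =1 qform H -> S = H.
Proof.
move=> hS hH SH; apply/matrixP => i j.
have entry (T : 'M[Cx R]_g) : T i j = dot (delta_mx i 0) (T *m delta_mx j 0).
  rewrite dotC dot_delta mxE (bigD1 j) //= !mxE !eqxx mulr1 big1 ?addr0 // => k /negPf h.
  by rewrite !mxE h mulr0.
have := SH (delta_mx i 0 + delta_mx j 0); rewrite !qformD // !SH !entry.
move=> /addIr /addrI; apply: mulfI; by rewrite pnatr_eq0.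
Qed.

(* Comparing second order Taylor expansions at the origin of the two sides of
   [theta c' (tau') w = exp (q w) * K * theta c (tau) (N^T w)]. *)
Lemma hessian_transformation c c' (tau tau' N S : 'M[Cx R]_g) (K : Cx R) s s' :
  strongly_positive tau s -> tau^T = tau -> even_char c ->
  strongly_positive tau' s' -> tau'^T = tau' -> even_char c' ->
  theta_const c tau = 0 -> theta_const c' tau' = 0 ->
  (forall w, theta c' tau' w = cexp (qform S w) * (K * theta c tau (N^T *m w))) ->
  theta_hessian c' tau' = K *: (N *m theta_hessian c tau *m N^T).
Proof.
move=> hs hT ev hs' hT' ev' t0 t0' hE.
have symH := theta_hessian_sym c hs; have symH' := theta_hessian_sym c' hs'.
set H := theta_hessian c tau in symH *; set H' := theta_hessian c' tau' in symH' *.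
(* Solves the Taylor identity for the difference of the quadratic terms; the right side will be of
   third order at least. *)
have alg (r a b k x y e : Cx R) : x + 2^-1 * (r ^+ 2 * a) = e * (k * (y + 2^-1 * (r ^+ 2 * b))) ->
    r ^+ 2 * (2^-1 * (a - k * b)) = (e - 1) * (k * (2^-1 * (r ^+ 2 * b))) + e * (k * y) - x.
  move=> h; transitivity ((x + 2^-1 * (r ^+ 2 * a)) - x - k * (2^-1 * (r ^+ 2 * b))); first by ring.
  by rewrite h; ring.
apply: qform_inj; first exact: symH'.
  by rewrite linearZ /= !trmx_mul trmxK symH mulmxA.
move=> w.
have -> : qform (K *: (N *m H *m N^T)) w = K * qform H (N^T *m w).
  rewrite /qform -scalemxAl dotZr -!mulmxA dot_mulmx //.
have [C hC] := theta_taylor hs hT ev; have [C' hC'] := theta_taylor hs' hT' ev'.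
have [D D0 hD] := n1_mulmx N^T; have [P P0 hP] := cabs_qform S.
pose n := n1 w; pose nu := D * n.
have n0 : 0 <= n := n1_ge0 w.
have nu0 : 0 <= nu by rewrite mulr_ge0 // ltW.
(* Keeps t w and t N^T w in the unit ball, where both expansions hold. *)
pose d := Num.min 1 (Num.min (n + 1)^-1 (nu + 1)^-1).
have n1p : 0 < n + 1 by rewrite ltr_wpDl.
have nu1p : 0 < nu + 1 by rewrite ltr_wpDl.
have d0 : 0 < d by rewrite !lt_min !invr_gt0 n1p nu1p ltr01.
pose u := N^T *m w; pose p := P * n ^+ 2.
have p0 : 0 <= p by rewrite mulr_ge0 ?exprn_ge0 // ltW.
have un : n1 u <= nu by exact: hD.
apply/eqP; rewrite -subr_eq0; apply/eqP.
pose h := cabs (qform H u); pose k := cabs K.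
have h0 : 0 <= h := cabs_ge0 _; have k0 : 0 <= k := cabs_ge0 _.
suff : 2^-1 * (qform H' w - K * qform H u) = 0.
  by move/eqP; rewrite mulf_eq0 invr_eq0 pnatr_eq0 => /eqP.
apply: (@cubic_bound_eq0 _ (p * expR p * (k * h) + expR p * k * (`|C| * nu ^+ 3) + `|C'| * n ^+ 3) d d0).
move=> t tpos td.
have t1 : t <= 1 by rewrite (le_trans td) // ge_min lexx.
have tn : t * n <= 1.
  have <- : (n + 1)^-1 * (n + 1) = 1 by rewrite mulVf ?lt0r_neq0.
  by apply: ler_pM; rewrite ?(ltW tpos) ?lerDl // (le_trans td) // !ge_min lexx orbT.
have tnu : t * nu <= 1.
  have <- : (nu + 1)^-1 * (nu + 1) = 1 by rewrite mulVf ?lt0r_neq0.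
  by apply: ler_pM; rewrite ?(ltW tpos) ?lerDl // (le_trans td) // !ge_min lexx !orbT.
have n1t x : n1 (rc t *: x : 'cV[Cx R]_g) = t * n1 x by rewrite n1Z cabs_rc gtr0_norm.
have E' := hC' (rc t *: w); rewrite n1t in E'; have {}E' := E' tn.
have E := hC (rc t *: u); rewrite n1t in E.
have {}E := E (le_trans (ler_wpM2l (ltW tpos) un) tnu).
rewrite t0' subr0 qformZ -/H' in E'; rewrite t0 subr0 qformZ -/H in E.
set F' := theta c' tau' _ - _ in E'; set F := theta c tau _ - _ in E.
set e := cexp (qform S (rc t *: w)).
have pe : cabs (qform S (rc t *: w)) <= t ^+ 2 * p.
  by rewrite qformZ cabsM cabsX cabs_rc gtr0_norm // ler_wpM2l ?exprn_ge0 ?(ltW tpos).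
have t21 : t ^+ 2 <= 1 by rewrite exprn_ile1 // ltW.
have pe' : cabs (qform S (rc t *: w)) <= p.
  by rewrite (le_trans pe) // ler_piMl.
have e1 : cabs (e - 1) <= t ^+ 2 * p * expR p.
  rewrite (le_trans (cexp_sub1_le _)) //.
  by apply: ler_pM; rewrite ?cabs_ge0 ?expR_ge0 ?ler_expR.
have e2 : cabs e <= expR p by rewrite (le_trans (cabs_cexp_le _)) // ler_expR.
have split : rc t ^+ 2 * (2^-1 * (qform H' w - K * qform H u)) =
    (e - 1) * (K * (2^-1 * (rc t ^+ 2 * qform H u))) + e * (K * F) - F'.
  have hEt := hE (rc t *: w); rewrite -scalemxAr -/u -/e in hEt.
  by apply: alg; rewrite /F' /F !subrK.
rewrite split (le_trans (cabsB _ _)) // [leRHS]mulrDl lerD //; last first.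
  rewrite (le_trans E') // exprMn [leRHS]mulrAC -[leRHS]mulrA [leRHS]mulrCA mulrA -mulrA.
  rewrite [leLHS]mulrCA ler_wpM2l ?exprn_ge0 ?(ltW tpos) // ler_wpM2r ?exprn_ge0 ?ler_norm //.
rewrite (le_trans (cabsD _ _)) // [leRHS]mulrDl lerD //.
  rewrite cabsM (cabsM K) (cabsM 2^-1) (cabsM (_ ^+ 2)) cabsX cabs_rc gtr0_norm // cabsV cabs_nat -/h -/k.
  apply: (@le_trans _ _ (t ^+ 2 * p * expR p * (k * (t ^+ 1 * h)))).
    apply: ler_pM; rewrite ?cabs_ge0 ?mulr_ge0 ?invr_ge0 ?exprn_ge0 ?(ltW tpos) //.
    rewrite ler_wpM2l // mulrA ler_wpM2r // expr1 expr2 mulrA ler_piMl ?(ltW tpos) //; lra.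
  by rewrite le_eqVlt; apply/orP; left; apply/eqP; ring.
rewrite cabsM cabsM -/k.
apply: (@le_trans _ _ (expR p * (k * (`|C| * (t * nu) ^+ 3)))).
  apply: ler_pM; rewrite ?cabs_ge0 ?mulr_ge0 ?cabs_ge0 // ler_wpM2l // (le_trans E) //.
  apply: (@le_trans _ _ (`|C| * (t * n1 u) ^+ 3)).
    by rewrite ler_wpM2r ?ler_norm // exprn_ge0 // mulr_ge0 ?n1_ge0 // ltW.
  have tu : t * n1 u <= t * nu by rewrite ler_wpM2l // ltW.
  have tu0 : 0 <= t * n1 u by rewrite mulr_ge0 ?n1_ge0 // ltW.
  have tnu0 : 0 <= t * nu := le_trans tu0 tu.
  by rewrite ler_wpM2l // lerXn2r.
by rewrite le_eqVlt; apply/orP; left; apply/eqP; ring.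
Qed.

Lemma hessian_transformation_rank c c' (tau tau' N S : 'M[Cx R]_g) (K : Cx R) s s' :
  strongly_positive tau s -> tau^T = tau -> even_char c ->
  strongly_positive tau' s' -> tau'^T = tau' -> even_char c' ->
  theta_const c tau = 0 -> theta_const c' tau' = 0 -> K != 0 -> N \in unitmx ->
  (forall w, theta c' tau' w = cexp (qform S w) * (K * theta c tau (N^T *m w))) ->
  \rank (theta_hessian c' tau') = \rank (theta_hessian c tau).
Proof.
move=> hs hT ev hs' hT' ev' t0 t0' K0 NU hE.
rewrite (hessian_transformation hs hT ev hs' hT' ev' t0 t0' hE).
rewrite mxrank_scale_nz // mxrankMfree; last by rewrite row_free_unit unitmx_tr.
by rewrite eqmxMfull // row_full_unit.
Qed.

End HessianTransformation.

Section OrbitInvariance.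
Variables (R : realType) (g : nat).
Implicit Types (a b : 'cV[int]_g) (c : characteristic g) (tau : 'M[Cx R]_g) (z w : 'cV[Cx R]_g).
Local Notation ipi := (ipi R).

Lemma F2_opp (x : 'F_2) : - x = x.
Proof. by apply/val_inj; case: x => [[|[|]]]. Qed.

Lemma idot_lift01_F2 (e : 'cV['F_2]_g) b :
  (idot (lift01 e) b)%:~R = \sum_j (b j 0)%:~R * e j 0 :> 'F_2.
Proof.
rewrite /idot rmorph_sum /=; apply: eq_bigr => j _.
by rewrite rmorphM /= mxE mulrC -pmulrn natr_Zp.
Qed.

Lemma siegel_actionE (M : 'M[int]_(g + g)) tau : siegel_action M tau =
  act (map_mx intr (ulsubmx M)) (map_mx intr (ursubmx M))
      (map_mx intr (dlsubmx M)) (map_mx intr (drsubmx M)) tau.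
Proof.
by rewrite /siegel_action /act /cocycle /numerator map_ulsubmx map_ursubmx map_dlsubmx map_drsubmx.
Qed.

(** By [theta_unique], [twisted] is a multiple of the theta function whose characteristic is read
    off from [kappa]; inverting this relation gives the identity required by
    [hessian_transformation]. *)
Lemma orbit_theta (M : 'M[int]_(g + g)) tau s c : symplectic_group M ->
  strongly_positive tau s -> tau^T = tau -> even_char c ->
  theta_const c (siegel_action M tau) = 0 ->
  exists c', [/\ even_char c', theta_const c' tau = 0 &
    \rank (theta_hessian c (siegel_action M tau)) = \rank (theta_hessian c' tau)].
Proof.
move=> /symplectic_groupP; rewrite siegel_actionE.
move: (ulsubmx M) (ursubmx M) (dlsubmx M) (drsubmx M) => Ai Bi Ci Di spI hs hT ev.
have sp := map_symplectic_blocks (intr : {rmorphism int -> Cx R}) spI.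
have rA := cj_intr R Ai; have rB := cj_intr R Bi; have rC := cj_intr R Ci; have rD := cj_intr R Di.
have NU := cocycle_unit sp rA rB rC rD hT hs.
have t'T := act_sym sp rA rB rC rD hT hs.
have [s' hs'] := act_positive sp rA rB rC rD hT hs.
have ST := twist_sym sp rA rB rC rD hT hs.
have Fq := fun z a b => twisted_quasi spI hs hT c z a b hs'.
have kD a1 b1 a2 b2 := kappaD R spI c a1 b1 a2 b2.
have := hs'; have := t'T; have := NU; have := ST; have := Fq; rewrite /twisted.
move: (act _ _ _ _ _) => tau'; move: (cocycle _ _ _) => N; set S := invmx N *m _.
move: S => S {}Fq {}ST {}NU {}t'T {}hs' t0'.
pose F z : Cx R := cexp (- ipi * qform S z) * theta c tau' ((invmx N)^T *m z).
pose k a b := kappa Ai Bi Ci Di c a b.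
(* The minus sign in front of the delta part of the exponent is invisible in F_2. *)
pose c' : characteristic g := (\col_j (k 0 (delta_mx j 0))%:~R, \col_j (k (delta_mx j 0) 0)%:~R).
have kE a b : (k a b)%:~R = (idot (lift01 c'.1) b - idot (lift01 c'.2) a)%:~R :> 'F_2.
  have -> : (k a b)%:~R = (k a 0)%:~R + (k 0 b)%:~R :> 'F_2.
    by rewrite /k -kD addr0 add0r.
  rewrite [RHS]rmorphB /= [in RHS]F2_opp !idot_lift01_F2 addrC; congr (_ + _).
    rewrite (additive_F2 (f := fun b => (k 0 b)%:~R)) => [|x y]; last by rewrite /k -kD addr0.
    by apply: eq_bigr => j _; rewrite mxE.
  rewrite (additive_F2 (f := fun a => (k a 0)%:~R)) => [|x y]; last by rewrite /k -kD addr0.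
  by apply: eq_bigr => j _; rewrite mxE.
have qF : quasi_periodic c' tau F.
  move=> z a b; rewrite /F Fq; congr (_ * _).
  by rewrite !mulrDr !cexpD; congr (_ * _); apply: cexp_ipi_F2; exact: kE.
have tF : tame F.
  apply: tameM; last exact: tame_comp_mulmx (theta_tame c hs').
  have h : tame (fun z => cexp (qform (- ipi *: S) z)).
    by apply: tame_cexp_qform; rewrite linearZ /= ST.
  rewrite (_ : (fun z => _) = (fun z => cexp (qform (- ipi *: S) z))) //.
  by apply/funext => z; rewrite /qform -scalemxAl dotZr.
have [K hK] := theta_unique hs hT tF qF.
have NT : N^T \in unitmx by rewrite unitmx_tr.
have inv w : theta c tau' w = cexp (ipi * qform S (N^T *m w)) * (K * theta c' tau (N^T *m w)).
  rewrite -hK /F trmx_inv mulKmx // mulrA -cexpD -mulrDl subrr mul0r cexp0 mul1r //.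
have K0 : K != 0.
  have [w hw] := theta_neq0 c hs'; apply: contra_neq hw => K0.
  by rewrite inv K0 mul0r mulr0.
have F_even z : F (- z) = F z.
  have e1 : qform S (- z) = qform S z by rewrite -scaleN1r qformZ sqrrN expr1n mul1r.
  have e2 := theta_even ((invmx N)^T *m z) hs' t'T ev.
  by rewrite /F e1 mulmxN e2.
(* For odd [c'] the theta function would be odd, but also even like [F], hence zero. *)
have ev' : even_char c'.
  apply/negPn/negP => odd'; have [z hz] := theta_neq0 c' hs.
  have := F_even z; rewrite !hK (theta_odd _ hs hT odd') => /(mulfI K0)/eqP.
  by rewrite eqNr (negPf hz).
exists c'; have t0 : theta_const c' tau = 0.
  have := inv 0; rewrite mulmx0 => h; apply/eqP.
  have := t0'; rewrite /theta_const h => /eqP; rewrite !mulf_eq0 (negPf K0) /=.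
  by rewrite (negPf (cexp_neq0 _)).
have inv' w : theta c tau' w =
    cexp (qform (ipi *: (N *m S *m N^T)) w) * (K * theta c' tau (N^T *m w)).
  rewrite inv (_ : ipi * qform S (N^T *m w) = qform (ipi *: (N *m S *m N^T)) w) //.
  rewrite /qform -scalemxAl [RHS]dotZr -!mulmxA [dot w (N *m _)]dot_mulmx //.
split; [exact: ev' | exact: t0 |].
exact: hessian_transformation_rank hs hT ev' hs' t'T ev t0 t0' K0 NU inv'.
Qed.

End OrbitInvariance.

(** * Minimal vectors *)

Section IntegerMinima.
Variable n : nat.
Local Notation vec := 'cV[int]_n.+1.
Implicit Types (X m : vec) (e : 'cV['F_2]_n.+1) (i j : 'I_n.+1).

(* A large multiple of the square norm confines the minimal vectors of [qZ] to
   entries in {-1, 0, 1}; among these [off_diag] decides, and it separates the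
   sign vectors because a sum of weights 2^i with coefficients in {-1, 0, 1}
   vanishes only trivially. *)
Definition wt i : int := 2 ^+ i.
(** Differences with entry 0: [off_diag], a sum of products over pairs of distinct indices, thus
    vanishes when at most one entry differs from entry 0. *)
Definition rel_coord X i : int := X i 0 - X 0 0.
Definition off_diag X : int :=
  (\sum_i wt i * rel_coord X i) ^+ 2 - \sum_i (wt i * rel_coord X i) ^+ 2.
Definition zsq X : int := \sum_i X i 0 ^+ 2.
Definition wt_sq : int := \sum_i wt i ^+ 2.
Definition wt_rho : int := 4 * n.+1%:Z * wt_sq.
(** For minimal square norm at most n + 1, an increase of [zsq] by 3 then outweighs the values of
    [off_diag], bounded by [wt_rho * zsq]. It also exceeds [wt_rho] by at least 1, whence
    [qr_ge]. *)
Definition wt_L : int := wt_rho * (n.+1%:Z + 1) + 1.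
Definition qZ X : int := wt_L * zsq X + off_diag X.

Lemma wt_gt0 i : 0 < wt i. Proof. exact: exprn_gt0. Qed.

Lemma zsq_ge0 X : 0 <= zsq X.
Proof. by apply: sumr_ge0 => i _; exact: sqr_ge0. Qed.

Lemma le_zsq X i : X i 0 ^+ 2 <= zsq X.
Proof. by rewrite /zsq (bigD1 i) //= lerDl sumr_ge0 // => j _; rewrite sqr_ge0. Qed.

Lemma wt_sq_ge0 : 0 <= wt_sq.
Proof. by apply: sumr_ge0 => i _; exact: sqr_ge0. Qed.

Lemma sum_rel_coord_le X : \sum_i rel_coord X i ^+ 2 <= 4 * n.+1%:Z * zsq X.
Proof.
apply: (@le_trans _ _ (\sum_i (2 * X i 0 ^+ 2 + 2 * zsq X))).
  apply: ler_sum => i _; have h := le_zsq X 0; rewrite /rel_coord.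
  have h1 : 0 <= (X i 0 + X 0 0) ^+ 2 by exact: sqr_ge0.
  nia.
rewrite big_split /= -mulr_sumr -/(zsq X) sumr_const card_ord -mulr_natr natz.
have h := zsq_ge0 X; nia.
Qed.

Lemma cauchy_schwarz_int (a b : 'I_n.+1 -> int) :
  (\sum_i a i * b i) ^+ 2 <= (\sum_i a i ^+ 2) * (\sum_i b i ^+ 2).
Proof.
have E1 : (\sum_i a i * b i) ^+ 2 = \sum_i \sum_j (a i * b i) * (a j * b j).
  by rewrite expr2 mulr_suml; apply: eq_bigr => i _; rewrite mulr_sumr.
have E2 : (\sum_i a i ^+ 2) * (\sum_i b i ^+ 2) = \sum_i \sum_j a i ^+ 2 * b j ^+ 2.
  by rewrite mulr_suml; apply: eq_bigr => i _; rewrite mulr_sumr.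
have E3 : (\sum_i a i ^+ 2) * (\sum_i b i ^+ 2) = \sum_i \sum_j a j ^+ 2 * b i ^+ 2.
  by rewrite E2 exchange_big.
rewrite -(ler_pM2l (isT : 0 < 2 :> int)) mulr_natl [in leRHS]mulr_natl !mulr2n.
rewrite {1}E2 E3 E1 -!big_split; apply: ler_sum => i _; rewrite -!big_split; apply: ler_sum => j _ /=.
have := sqr_ge0 (a i * b j - a j * b i); nia.
Qed.

Lemma off_diag_bounds X : - (wt_rho * zsq X) <= off_diag X <= wt_rho * zsq X.
Proof.
have h1 : (\sum_i wt i * rel_coord X i) ^+ 2 <= wt_rho * zsq X.
  apply: (le_trans (cauchy_schwarz_int wt (rel_coord X))).
  rewrite -/wt_sq /wt_rho; have := sum_rel_coord_le X; have := wt_sq_ge0; nia.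
have h2 : \sum_i (wt i * rel_coord X i) ^+ 2 <= wt_rho * zsq X.
  apply: (@le_trans _ _ (\sum_i wt_sq * rel_coord X i ^+ 2)).
    apply: ler_sum => i _; rewrite exprMn ler_wpM2r ?sqr_ge0 //.
    by rewrite /wt_sq (bigD1 i) //= lerDl sumr_ge0 // => j _; rewrite sqr_ge0.
  rewrite -mulr_sumr /wt_rho; have := sum_rel_coord_le X; have := wt_sq_ge0; nia.
have h3 : 0 <= (\sum_i wt i * rel_coord X i) ^+ 2 by exact: sqr_ge0.
have h4 : 0 <= \sum_i (wt i * rel_coord X i) ^+ 2 by apply: sumr_ge0 => i _; exact: sqr_ge0.
by rewrite /off_diag; apply/andP; split; lia.
Qed.

(** Twice the summation vector, so that minima are studied over the integers. *)
Definition coset e m : vec := 2 *: m + lift01 e.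

Lemma cosetE e m i : coset e m i 0 = 2 * m i 0 + lift01 e i 0.
Proof. by rewrite !mxE. Qed.

Lemma lift01_bool e i : lift01 e i 0 = 0 \/ lift01 e i 0 = 1.
Proof. by rewrite mxE; case: (e i 0) => -[|[|]] //= _; [left | right]. Qed.

Lemma coset_opp e m : coset e (- m - lift01 e) = - coset e m.
Proof. by apply/matrixP => i j; rewrite !mxE; ring. Qed.

Definition weight01 e : int := \sum_i lift01 e i 0.
Definition small X := forall i, -1 <= X i 0 <= 1.

Lemma lift01_le_sq e m i : lift01 e i 0 <= coset e m i 0 ^+ 2.
Proof. by rewrite cosetE; have := lift01_bool e i; nia. Qed.

Lemma small_sq e m : small (coset e m) -> forall i, coset e m i 0 ^+ 2 = lift01 e i 0.
Proof.
move=> sm i; have := sm i; rewrite cosetE; have := lift01_bool e i => -[] -> h.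
  by have -> : m i 0 = 0 by lia.
have [-> | ->] : m i 0 = 0 \/ m i 0 = -1; [lia | by [] | by []].
Qed.

(** An even entry outside {-1, 0, 1} has square at least 4 instead of 0, an odd one at least 9
    instead of 1. *)
Lemma not_small_zsq e m : ~ small (coset e m) -> weight01 e + 3 <= zsq (coset e m).
Proof.
move=> /existsNP[i hi]; rewrite /weight01 /zsq (bigD1 i) //= [leRHS](bigD1 i) //=.
have h : \sum_(j | j != i) lift01 e j 0 <= \sum_(j | j != i) coset e m j 0 ^+ 2.
  by apply: ler_sum => j _; exact: lift01_le_sq.
have : lift01 e i 0 + 3 <= coset e m i 0 ^+ 2.
  move: hi; rewrite cosetE; have := lift01_bool e i => -[] -> hi.
    have [] : 1 <= m i 0 \/ m i 0 <= -1 by lia.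
      nia.
    nia.
  have [] : 1 <= m i 0 \/ m i 0 <= -2 by lia.
    nia.
  nia.
by move=> h'; rewrite addrAC lerD.
Qed.

Lemma small_zsq e m : small (coset e m) -> zsq (coset e m) = weight01 e.
Proof. by move=> sm; apply: eq_bigr => i _; exact: small_sq. Qed.

Lemma weight01_le e : 0 <= weight01 e <= n.+1%:Z.
Proof.
apply/andP; split; first by apply: sumr_ge0 => i _; have := lift01_bool e i; lia.
apply: (@le_trans _ _ (\sum_(i < n.+1) 1)); last by rewrite sumr_const card_ord natz.
by apply: ler_sum => i _; have := lift01_bool e i; lia.
Qed.

Lemma small_qZ_lt e m m' : small (coset e m) -> ~ small (coset e m') ->
  qZ (coset e m) < qZ (coset e m').
Proof.
move=> sm /not_small_zsq ns; rewrite /qZ (small_zsq sm).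
have /andP[_ h1] := off_diag_bounds (coset e m); rewrite (small_zsq sm) in h1.
have /andP[h2 _] := off_diag_bounds (coset e m').
have /andP[h3 h4] := weight01_le e.
have r0 : 0 <= wt_rho by rewrite /wt_rho !mulr_ge0 // wt_sq_ge0.
move: (zsq _) (weight01 e) ns h1 h2 h3 h4 => z w; rewrite /wt_L.
move: (off_diag _) (off_diag _) wt_rho r0 n.+1%:Z => a b rho r0 N ns h1 h2 h3 h4.
have k1 : rho * (N + 1) * (w + 3) <= rho * (N + 1) * z.
  by rewrite ler_wpM2l // mulr_ge0 // addr_ge0 // (le_trans h3).
have k2 : rho * (w + 3) <= rho * z by rewrite ler_wpM2l.
have k3 : rho * w <= rho * N by rewrite ler_wpM2l.
have k4 : rho * N * (w + 3) <= rho * N * z.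
  by rewrite ler_wpM2l // mulr_ge0 // (le_trans h3).
have k5 : 0 <= rho * w by rewrite mulr_ge0.
lia.
Qed.

Lemma qZN X : qZ (- X) = qZ X.
Proof.
have rN i : rel_coord (- X) i = - rel_coord X i by rewrite /rel_coord !mxE; ring.
rewrite /qZ /off_diag /zsq; congr (_ * _ + (_ - _)).
- by apply: eq_bigr => i _; rewrite mxE sqrrN.
- under eq_bigr do rewrite rN mulrN.
  by rewrite sumrN sqrrN.
- by apply: eq_bigr => i _; rewrite rN mulrN sqrrN.
Qed.

Lemma off_diag_pairs X :
  off_diag X = \sum_i \sum_(j | j != i) (wt i * rel_coord X i) * (wt j * rel_coord X j).
Proof.
rewrite /off_diag expr2 mulr_suml -sumrB; apply: eq_bigr => i _.
by rewrite (bigD1 i) //= mulrDr mulr_sumr expr2 addrC addKr.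
Qed.

Lemma off_diag_rel0 X : (forall i, rel_coord X i <= 0) ->
  0 <= off_diag X /\ forall i j, j != i ->
    wt i * rel_coord X i * (wt j * rel_coord X j) <= off_diag X.
Proof.
move=> h; have p i j : 0 <= (wt i * rel_coord X i) * (wt j * rel_coord X j).
  by rewrite mulr_le0 // mulr_ge0_le0 // ltW // wt_gt0.
rewrite off_diag_pairs; split=> [|i j ji].
  by apply: sumr_ge0 => i _; apply: sumr_ge0 => j _.
rewrite (bigD1 i) //= (bigD1 j) //= -addrA lerDl addr_ge0 //.
  by apply: sumr_ge0 => k _.
by apply: sumr_ge0 => k _; apply: sumr_ge0 => l _.
Qed.

End IntegerMinima.

(** Modulo 2 the lowest coefficient vanishes; then the sum can be halved. *)
Lemma binary_eq0 n (d : 'I_n -> int) : (forall i, -1 <= d i <= 1) ->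
  \sum_(i < n) 2 ^+ i * d i = 0 -> forall i, d i = 0.
Proof.
elim: n d => [|n IH] d hd hs i; first by case: i.
rewrite big_ord_recl expr0 mul1r in hs.
have hsplit : \sum_(i < n) 2 ^+ lift ord0 i * d (lift ord0 i) =
    2 * \sum_(i < n) 2 ^+ i * d (lift ord0 i).
  by rewrite mulr_sumr; apply: eq_bigr => k _; rewrite /= /bump /= exprS mulrA.
rewrite hsplit in hs; have d0 : d ord0 = 0 by have := hd ord0; lia.
have := IH (fun k => d (lift ord0 k)) (fun k => hd _).
rewrite d0 add0r in hs; move=> /(_ _) h.
case: (unliftP ord0 i) => [k ->|->//]; apply: h; lia.
Qed.

Section MinimalVectors.
Variable n : nat.
Local Notation vec := 'cV[int]_n.+1.
Implicit Types (X m : vec) (e : 'cV['F_2]_n.+1) (i j : 'I_n.+1).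

Lemma colN X i : (- X) i 0 = - X i 0. Proof. by rewrite mxE. Qed.
Lemma colD X m i : (X + m) i 0 = X i 0 + m i 0. Proof. by rewrite mxE. Qed.
Lemma col0 i : (0 : vec) i 0 = 0. Proof. by rewrite mxE. Qed.

Lemma small_cases e m : small (coset e m) ->
  forall i, m i 0 = 0 \/ m i 0 = - lift01 e i 0.
Proof.
by move=> sm i; have := sm i; rewrite cosetE; have := lift01_bool e i; lia.
Qed.

Lemma rel_coordE e m i :
  rel_coord (coset e m) i = 2 * (m i 0 - m 0 0) + (lift01 e i 0 - lift01 e 0 0).
Proof. by rewrite /rel_coord !cosetE; ring. Qed.

Lemma coset_small e m m0 : small (coset e m0) -> qZ (coset e m) <= qZ (coset e m0) ->
  small (coset e m).
Proof.
move=> s0 h; apply: contrapT => ns; have := small_qZ_lt s0 ns.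
by rewrite ltNge h.
Qed.

Lemma sqr_eq_int (a b : int) : a ^+ 2 = b ^+ 2 -> a = b \/ a = - b.
Proof. by move/eqP; rewrite eqf_sqr => /orP[/eqP ->|/eqP ->]; [left | right]. Qed.

(** On small vectors entry 0 is 0 and [off_diag] is the square of [v] minus a constant. Minimizers
    have equal or opposite [v], hence are equal or opposite by [binary_eq0]. *)
Lemma unique_min_base0 e : lift01 e 0 0 = 0 -> exists m0, forall m,
  qZ (coset e m) <= qZ (coset e m0) -> m = m0 \/ m = - m0 - lift01 e.
Proof.
move=> e0.
pose ms (s : {ffun 'I_n.+1 -> bool}) : vec := \col_i (if s i then 0 else - lift01 e i 0).
pose v m : int := \sum_i wt i * coset e m i 0.
pose s0 : {ffun 'I_n.+1 -> bool} := [ffun=> true].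
have [s _ smin] := @arg_minnP _ s0 xpredT (fun s => absz (v (ms s))) isT.
have ms_small s' : small (coset e (ms s')).
  by move=> i; rewrite cosetE mxE; have := lift01_bool e i; case: (s' i); lia.
exists (ms s) => m hm; have sm := coset_small (ms_small s) hm.
have off m' : small (coset e m') -> off_diag (coset e m') = v m' ^+ 2 - \sum_i wt i ^+ 2 * lift01 e i 0.
  move=> sm'; have m00 : m' 0 0 = 0 by have := small_cases sm' 0; rewrite e0; lia.
  have rE i : rel_coord (coset e m') i = coset e m' i 0.
    by rewrite rel_coordE cosetE m00 e0; ring.
  rewrite /off_diag /v; congr (_ ^+ 2 - _).
    by apply: eq_bigr => i _; rewrite rE.
  by apply: eq_bigr => i _; rewrite rE exprMn small_sq.
have vle : v m ^+ 2 <= v (ms s) ^+ 2.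
  move: hm; rewrite /qZ !small_zsq // !off //; lia.
have [s' hs'] : exists s', m = ms s'.
  exists [ffun i => m i 0 == 0]; apply/matrixP => i j; rewrite (ord1 j) mxE ffunE.
  by case: eqP => [->//|h]; have [] := small_cases sm i.
have vge : v (ms s) ^+ 2 <= v m ^+ 2.
  rewrite -[leLHS]real_normK ?num_real // -[leRHS]real_normK ?num_real //.
  by rewrite lerXn2r ?nnegrE // -!abszE lez_nat hs' smin.
have wtE (x y : vec) : (forall i, -1 <= x i 0 + y i 0 <= 1) ->
    \sum_i wt i * (x i 0 + y i 0) = 0 -> forall i, x i 0 + y i 0 = 0.
  by move=> h1 h2; exact: binary_eq0 h1 h2.
have [h|h] : v m = v (ms s) \/ v m = - v (ms s) by apply: sqr_eq_int; lia.
- left; apply/matrixP => i j; rewrite (ord1 j).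
  have H := wtE m (- ms s) _ _ i.
  suff : m i 0 + (- ms s) i 0 = 0 by rewrite colN; lia.
  apply: H => [k|].
    rewrite colN; have := small_cases sm k; have := small_cases (ms_small s) k.
    have := lift01_bool e k; lia.
  have E : 2 * \sum_k wt k * (m k 0 + (- ms s) k 0) = v m - v (ms s).
    rewrite /v -sumrB mulr_sumr; apply: eq_bigr => k _; rewrite !cosetE colN; ring.
  by move: E; rewrite h subrr => /eqP; rewrite mulf_eq0 => /eqP.
- right; apply/matrixP => i j; rewrite (ord1 j).
  have H := wtE m (ms s + lift01 e) _ _ i.
  suff : m i 0 + (ms s + lift01 e) i 0 = 0 by rewrite !(colD, colN); lia.
  apply: H => [k|].
    rewrite colD; have := small_cases sm k; have := small_cases (ms_small s) k.
    have := lift01_bool e k; lia.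
  have E : 2 * \sum_k wt k * (m k 0 + (ms s + lift01 e) k 0) = v m + v (ms s).
    rewrite /v -big_split mulr_sumr; apply: eq_bigr => k _; rewrite !cosetE colD /=; ring.
  by move: E; rewrite h addNr => /eqP; rewrite mulf_eq0 => /eqP.
Qed.

Lemma coset_head e m : lift01 e 0 0 = 1 -> small (coset e m) ->
  coset e m 0 0 = 1 \/ coset e (- m - lift01 e) 0 0 = 1.
Proof.
move=> e0 sm; rewrite coset_opp colN cosetE e0.
by have := small_cases sm 0; rewrite e0; lia.
Qed.

Lemma small_opp e m : small (coset e m) -> small (coset e (- m - lift01 e)).
Proof. by move=> sm i; rewrite coset_opp colN; have := sm i; lia. Qed.

Lemma oppC_coset e m : - (- m - lift01 e) - lift01 e = m.
Proof. by rewrite opprD !opprK addrK. Qed.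

(** With entry 0 normalized to 1, the relative coordinate at [i0] is -1. Turning another entry from
    1 to -1 moves its coordinate from 0 to -2 and strictly increases its product with the one at
    [i0]. *)
Lemma unique_min_base1 e i0 : lift01 e 0 0 = 1 -> lift01 e i0 0 = 0 -> forall m,
  qZ (coset e m) <= qZ (coset e 0) -> m = 0 \/ m = - 0 - lift01 e.
Proof.
move=> e0 ei0.
have s0 : small (coset e 0).
  by move=> i; rewrite cosetE mxE; have := lift01_bool e i; lia.
have key m : small (coset e m) -> coset e m 0 0 = 1 -> off_diag (coset e m) <= off_diag (coset e 0) ->
    m = 0.
  move=> sm X0 hle; have m0 : m 0 0 = 0 by move: X0; rewrite cosetE e0; lia.
  have r0 i : rel_coord (coset e 0) i = lift01 e i 0 - 1 by rewrite rel_coordE !col0 e0; ring.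
  have r i : rel_coord (coset e m) i = 2 * m i 0 + (lift01 e i 0 - 1) by rewrite rel_coordE m0 e0; ring.
  apply: contrapT => mn0.
  have [i mi] : exists i, m i 0 != 0.
    apply: contrapT => h; apply: mn0; apply/matrixP => i j; rewrite (ord1 j) [RHS]mxE.
    by apply/eqP/negPn/negP => hi; apply: h; exists i.
  have ii0 : i0 != i.
    by apply: contraNneq mi => <-; have := small_cases sm i0; rewrite ei0 => h; apply/eqP; lia.
  move: hle; rewrite !off_diag_pairs leNgt => /negP; apply.
  have mono k l : wt k * rel_coord (coset e 0) k * (wt l * rel_coord (coset e 0) l) <=
      wt k * rel_coord (coset e m) k * (wt l * rel_coord (coset e m) l).
    rewrite mulrACA [leRHS]mulrACA ler_wpM2l ?mulr_ge0 ?(ltW (wt_gt0 _)) //.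
    rewrite !r0 !r; have := lift01_bool e k; have := lift01_bool e l.
    have := small_cases sm k; have := small_cases sm l; nia.
  rewrite (bigD1 i) //= [ltRHS](bigD1 i) //= ltr_leD //; last first.
    by apply: ler_sum => k _; apply: ler_sum => l _.
  rewrite (bigD1 i0) //= [ltRHS](bigD1 i0) //= ltr_leD //; last by apply: ler_sum => l _.
  rewrite mulrACA [ltRHS]mulrACA ltr_pM2l ?mulr_gt0 ?wt_gt0 // !r0 !r ei0.
  have := small_cases sm i0; have := small_cases sm i; have := lift01_bool e i; nia.
move=> m hm; have sm := coset_small s0 hm.
have hoff : off_diag (coset e m) <= off_diag (coset e 0).
  by move: hm; rewrite /qZ !small_zsq // lerD2l.
have [h|h] := coset_head e0 sm; first by left; exact: key.
right; rewrite oppr0 add0r.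
have sm' := small_opp sm.
have hoff' : off_diag (coset e (- m - lift01 e)) <= off_diag (coset e 0).
  have : qZ (coset e (- m - lift01 e)) = qZ (coset e m) by rewrite coset_opp qZN.
  by rewrite /qZ !small_zsq // => /addrI ->.
have h0 := key _ sm' h hoff'.
by rewrite -[m](oppC_coset e) h0 oppr0 add0r.
Qed.

Lemma unique_min e i0 : lift01 e i0 0 = 0 -> exists m0, forall m,
  qZ (coset e m) <= qZ (coset e m0) -> m = m0 \/ m = - m0 - lift01 e.
Proof.
move=> ei0; have [e0|e0] := lift01_bool e 0; first exact: unique_min_base0.
by exists 0; exact: (unique_min_base1 e0 ei0).
Qed.

(** For epsilon all ones, [coset e (flip i)] is the sign vector v_i; index 0 stands for the
    unchanged vector. *)
Definition flip i : vec := if i == 0 then 0 else - delta_mx i 0.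

Lemma flipE i j : flip i j 0 = if (j == i) && (i != 0) then -1 else 0.
Proof.
rewrite /flip; case: eqVneq => [_|h]; first by rewrite mxE andbF.
by rewrite !mxE ?eqxx !andbT; case: (j == i).
Qed.

Lemma flip_small e i : (forall j, lift01 e j 0 = 1) -> small (coset e (flip i)).
Proof. by move=> e1 j; rewrite cosetE e1 flipE; case: ifP. Qed.

Lemma qZ_flip e i : (forall j, lift01 e j 0 = 1) -> qZ (coset e (flip i)) = wt_L n * n.+1%:Z.
Proof.
move=> e1; rewrite /qZ small_zsq; last exact: flip_small.
have -> : weight01 e = n.+1%:Z.
  by rewrite /weight01 (eq_bigr (fun=> 1)) ?sumr_const ?card_ord ?natz.
rewrite -[RHS]addr0; congr (_ + _).
have r0 j : j != i -> rel_coord (coset e (flip i)) j = 0.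
  move=> ji; rewrite rel_coordE !e1 !flipE (negPf ji) /= eq_sym.
  by case: eqVneq.
rewrite /off_diag (bigD1 i) //= [X in _ - X](bigD1 i) //= !big1 ?addr0 ?subrr //.
  by move=> j ji; rewrite r0 // mulr0 expr0n.
by move=> j ji; rewrite r0 // mulr0.
Qed.

(** With entry 0 equal to 1 the relative coordinates are 0 or -2, and two of them equal to -2 make
    [off_diag] positive. *)
Lemma min_flip e m : (forall j, lift01 e j 0 = 1) -> qZ (coset e m) <= wt_L n * n.+1%:Z ->
  exists i, m = flip i \/ m = - flip i - lift01 e.
Proof.
move=> e1 hm.
have key m' : small (coset e m') -> coset e m' 0 0 = 1 -> off_diag (coset e m') <= 0 ->
    exists i, m' = flip i.
  move=> sm X0 hle; have m0 : m' 0 0 = 0 by move: X0; rewrite cosetE e1; lia.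
  have r i : rel_coord (coset e m') i = 2 * m' i 0 by rewrite rel_coordE m0 !e1; ring.
  have mc i : m' i 0 = 0 \/ m' i 0 = -1 by rewrite -(e1 i); exact: small_cases.
  have rle i : rel_coord (coset e m') i <= 0 by rewrite r; have := mc i; lia.
  have [_ pair] := off_diag_rel0 rle.
  have [[i mi]|h] := pselect (exists i, m' i 0 != 0).
    exists i; apply/matrixP => j k; rewrite (ord1 k) flipE.
    have i0 : i != 0 by apply: contraNneq mi => ->; rewrite m0.
    rewrite i0 andbT; case: eqVneq => [->|ji].
      by have [h|//] := mc i; rewrite h eqxx in mi.
    have [//|mj] := mc j; have mi' : m' i 0 = -1 by have [h|//] := mc i; rewrite h eqxx in mi.
    have := pair i j ji; rewrite !r mj mi' => h.
    have := wt_gt0 i; have := wt_gt0 j; nia.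
  exists 0; apply/matrixP => j k; rewrite (ord1 k) /flip eqxx [RHS]mxE.
  by apply/eqP/negPn/negP => hj; apply: h; exists j.
have sm : small (coset e m).
  by apply: (@coset_small e m (flip 0)); [exact: flip_small | rewrite qZ_flip].
have hoff m' : small (coset e m') -> qZ (coset e m') <= wt_L n * n.+1%:Z -> off_diag (coset e m') <= 0.
  move=> sm'; rewrite /qZ small_zsq //.
  have -> : weight01 e = n.+1%:Z.
    by rewrite /weight01 (eq_bigr (fun=> 1)) ?sumr_const ?card_ord ?natz.
  by rewrite gerDl.
have [h|h] := coset_head (e1 0) sm.
  by have [i ->] := key m sm h (hoff m sm hm); exists i; left.
have sm' := small_opp sm.
have [|i hi] := key _ sm' h.
  by apply: hoff => //; rewrite coset_opp qZN.
by exists i; right; rewrite -[LHS](oppC_coset e) hi.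
Qed.

End MinimalVectors.

(** * Asymptotics for a family of period matrices *)

Section MatrixFamily.
Variables (R : realType) (n : nat).
Local Notation rvec := 'cV[R]_n.+1.
Implicit Types (x u : rvec) (m : 'cV[int]_n.+1) (e : 'cV['F_2]_n.+1)
  (c : characteristic n.+1) (i j : 'I_n.+1) (t p : R).
Local Notation ipi := (ipi R).

Definition rwt i : R := 2 ^+ i.
Definition qr x : R := (wt_L n)%:~R * sqnorm x + (\sum_i rwt i * (x i 0 - x 0 0)) ^+ 2 -
  \sum_i (rwt i * (x i 0 - x 0 0)) ^+ 2.
Definition pr x : R := - (2 * x 0 0 * \sum_j x j 0).

Definition rank1 u : 'M[R]_n.+1 := u *m u^T.
Definition dvec i : rvec := delta_mx i 0 - delta_mx 0 0.
Definition Qmat : 'M[R]_n.+1 := ((wt_L n)%:~R)%:M + rank1 (\sum_i rwt i *: dvec i) -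
  \sum_i rank1 (rwt i *: dvec i).
(** Uses a^2 + b^2 - (a + b)^2 = -2 a b, with a = x_0 and b the sum of the entries. *)
Definition Pmat : 'M[R]_n.+1 := rank1 (delta_mx 0 0) + rank1 (const_mx 1) -
  rank1 (delta_mx 0 0 + const_mx 1).
Definition Ymat t p : 'M[R]_n.+1 := t *: Qmat + p *: Pmat.

Lemma scale_colE a u i : (a *: u) i 0 = a * u i 0.
Proof. by rewrite mxE. Qed.

Lemma rcX (a : R) k : rc (a ^+ k) = rc a ^+ k.
Proof. by elim: k => // k IH; rewrite !exprS rcM IH. Qed.

Lemma xr_coset e m i : xr R e m i 0 = (coset e m i 0)%:~R / 2.
Proof. by rewrite cosetE !mxE rmorphD rmorphM /= -pmulrn; field. Qed.

Lemma rformD (A B : 'M[R]_n.+1) x : rform (A + B) x = rform A x + rform B x.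
Proof. by rewrite /rform mulmxDr mulmxDl mxE. Qed.

Lemma rformZ a (A : 'M[R]_n.+1) x : rform (a *: A) x = a * rform A x.
Proof. by rewrite /rform -scalemxAr -scalemxAl mxE. Qed.

Lemma rformN (A : 'M[R]_n.+1) x : rform (- A) x = - rform A x.
Proof. by rewrite -scaleN1r rformZ mulN1r. Qed.

Lemma rform_sum (F : 'I_n.+1 -> 'M[R]_n.+1) x : rform (\sum_i F i) x = \sum_i rform (F i) x.
Proof.
by rewrite /rform mulmx_sumr mulmx_suml summxE.
Qed.

Lemma rform_rank1 u x : rform (rank1 u) x = (\sum_i u i 0 * x i 0) ^+ 2.
Proof.
rewrite /rform /rank1 mulmxA -mulmxA mxE big_ord1 expr2; congr (_ * _).
  by rewrite mxE; apply: eq_bigr => i _; rewrite mxE mulrC.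
by rewrite mxE; apply: eq_bigr => i _; rewrite mxE.
Qed.

Lemma sum_delta j x : \sum_i (delta_mx j 0 : rvec) i 0 * x i 0 = x j 0.
Proof.
rewrite (bigD1 j) //= mxE !eqxx mul1r big1 ?addr0 // => i /negPf h.
by rewrite mxE h mul0r.
Qed.

Lemma sum_dvec i x : \sum_k dvec i k 0 * x k 0 = x i 0 - x 0 0.
Proof.
rewrite -(sum_delta i x) -(sum_delta 0 x) -sumrB; apply: eq_bigr => k _.
by rewrite [dvec i k 0]mxE [(- delta_mx _ _) _ _]mxE mulrBl.
Qed.

Lemma rform_Qmat x : rform Qmat x = qr x.
Proof.
rewrite /Qmat !rformD rformN rform_sum !rform_rank1 /qr; congr (_ + _ ^+ 2 - _).
- rewrite /rform mul_mx_scalar -scalemxAl mxE; congr (_ * _).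
  by rewrite mxE /sqnorm; apply: eq_bigr => i _; rewrite mxE expr2.
- transitivity (\sum_i \sum_k rwt k * (dvec k i 0 * x i 0)).
    apply: eq_bigr => i _; rewrite summxE mulr_suml; apply: eq_bigr => k _.
    by rewrite scale_colE mulrA.
  rewrite exchange_big; apply: eq_bigr => k _ /=.
  by rewrite -mulr_sumr sum_dvec.
- apply: eq_bigr => i _; rewrite rform_rank1; congr (_ ^+ 2).
  rewrite -sum_dvec mulr_sumr; apply: eq_bigr => k _.
  by rewrite scale_colE mulrA.
Qed.

Lemma rform_Pmat x : rform Pmat x = pr x.
Proof.
rewrite /Pmat !rformD rformN !rform_rank1 sum_delta /pr.
have E1 : \sum_i (const_mx 1 : rvec) i 0 * x i 0 = \sum_i x i 0.
  by apply: eq_bigr => i _; rewrite mxE mul1r.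
have E2 : \sum_i (delta_mx 0 0 + const_mx 1 : rvec) i 0 * x i 0 = x 0 0 + \sum_i x i 0.
  rewrite -E1 -[x 0 0](sum_delta 0 x) -big_split; apply: eq_bigr => i _ /=.
  by rewrite [(delta_mx 0 0 + _) i 0]mxE mulrDl.
rewrite E1 E2; ring.
Qed.

Lemma rform_Ymat t p x : rform (Ymat t p) x = t * qr x + p * pr x.
Proof. by rewrite /Ymat rformD !rformZ rform_Qmat rform_Pmat. Qed.

Lemma Ymat_sym t p : (Ymat t p)^T = Ymat t p.
Proof.
have r1 u : (rank1 u)^T = rank1 u by rewrite /rank1 trmx_mul trmxK.
have rs : (\sum_i rank1 (rwt i *: dvec i))^T = \sum_i rank1 (rwt i *: dvec i).
  by rewrite linear_sum; apply: eq_bigr => i _; exact: r1.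
have hQ : Qmat^T = Qmat by rewrite /Qmat linearB /= linearD /= tr_scalar_mx r1 rs.
have hP : Pmat^T = Pmat by rewrite /Pmat linearB /= linearD /= !r1.
by rewrite /Ymat linearD /= !linearZ /= hQ hP.
Qed.

Lemma qr_xr e m : qr (xr R e m) = (qZ (coset e m))%:~R / 4.
Proof.
have rE i : rwt i * (xr R e m i 0 - xr R e m 0 0) = (wt i * rel_coord (coset e m) i)%:~R / 2.
  rewrite !xr_coset /rel_coord rmorphM rmorphB /= /rwt /wt rmorphXn /=; ring.
have E1 : sqnorm (xr R e m) = (zsq (coset e m))%:~R / 4.
  rewrite /sqnorm /zsq rmorph_sum mulr_suml; apply: eq_bigr => i _.
  by rewrite xr_coset rmorphXn /=; field.
have E2 : \sum_i rwt i * (xr R e m i 0 - xr R e m 0 0) =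
    (\sum_i wt i * rel_coord (coset e m) i)%:~R / 2.
  by rewrite rmorph_sum mulr_suml; apply: eq_bigr => i _; rewrite rE.
have E3 : \sum_i (rwt i * (xr R e m i 0 - xr R e m 0 0)) ^+ 2 =
    (\sum_i (wt i * rel_coord (coset e m) i) ^+ 2)%:~R / 4.
  by rewrite rmorph_sum mulr_suml; apply: eq_bigr => i _; rewrite rE rmorphXn /=; field.
rewrite /qr E1 E2 E3 /qZ /off_diag.
move: (wt_L n) (zsq _) (\sum_i _) (\sum_i _) => a b c d.
by rewrite intrD intrM intrB rmorphXn /=; field.
Qed.

Lemma le_sqnorm x i : x i 0 ^+ 2 <= sqnorm x.
Proof. by rewrite /sqnorm (bigD1 i) //= lerDl sumr_ge0 // => j _; rewrite sqr_ge0. Qed.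

Lemma qr_ge x : sqnorm x <= qr x.
Proof.
have h : \sum_i (rwt i * (x i 0 - x 0 0)) ^+ 2 <= (wt_rho n)%:~R * sqnorm x.
  apply: (@le_trans _ _ (\sum_i rwt i ^+ 2 * (4 * sqnorm x))).
    apply: ler_sum => i _; rewrite exprMn ler_wpM2l ?sqr_ge0 //.
    have h1 := le_sqnorm x i; have h2 := le_sqnorm x 0.
    have h3 : 0 <= (x i 0 + x 0 0) ^+ 2 by exact: sqr_ge0.
    have -> : (x i 0 - x 0 0) ^+ 2 = 2 * x i 0 ^+ 2 + 2 * x 0 0 ^+ 2 - (x i 0 + x 0 0) ^+ 2 by ring.
    lra.
  rewrite -mulr_suml mulrA ler_wpM2r ?sqnorm_ge0 //.
  have -> : \sum_i rwt i ^+ 2 = (wt_sq n)%:~R.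
    by rewrite rmorph_sum; apply: eq_bigr => i _; rewrite !rmorphXn.
  rewrite -[4]/((4 : int)%:~R) -intrM ler_int /wt_rho; have := wt_sq_ge0 n; nia.
have h0 : 0 <= (\sum_i rwt i * (x i 0 - x 0 0)) ^+ 2 by exact: sqr_ge0.
have hL : ((wt_rho n)%:~R + 1) * sqnorm x <= (wt_L n)%:~R * sqnorm x.
  rewrite ler_wpM2r ?sqnorm_ge0 // /wt_L rmorphD rmorphM /= lerD2r ler_peMr //.
    by rewrite ler0z /wt_rho !mulr_ge0 // wt_sq_ge0.
  by rewrite rmorphD /= lerDr.
by rewrite /qr; lra.
Qed.

Lemma pr_le x : `|pr x| <= n.+2%:R * sqnorm x.
Proof.
rewrite /pr normrN mulr_sumr (le_trans (ler_norm_sum _ _ _)) //.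
apply: (@le_trans _ _ (\sum_i (x 0 0 ^+ 2 + x i 0 ^+ 2))).
  apply: ler_sum => i _; rewrite ler_norml.
  have h1 : 0 <= (x i 0 + x 0 0) ^+ 2 by exact: sqr_ge0.
  have h2 : 0 <= (x i 0 - x 0 0) ^+ 2 by exact: sqr_ge0.
  by apply/andP; split; nra.
rewrite big_split /= -/(sqnorm x) sumr_const card_ord -[x 0 0 ^+ 2 *+ _]mulr_natl.
by rewrite -[n.+2%:R]natr1 mulrDl mul1r lerD // ler_wpM2l // le_sqnorm.
Qed.

Definition tau_of t p : 'M[Cx R]_n.+1 := map_mx (fun y : R => 0 +i* y : Cx R) (Ymat t p).

Lemma imag_tau t p : imag (tau_of t p) = Ymat t p.
Proof. by apply/matrixP => i j; rewrite !mxE. Qed.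

Lemma tau_sym t p : (tau_of t p)^T = tau_of t p.
Proof. by rewrite /tau_of map_trmx Ymat_sym. Qed.

(** The product offsets the largest negative contribution of p P for |p| <= n + 1; the 1 leaves a
    lower bound [sqnorm x]. *)
Definition t_base : R := 1 + n.+1%:R * n.+2%:R.

Lemma form_ge t p x : t_base <= t -> `|p| <= n.+1%:R ->
  sqnorm x <= t * qr x + p * pr x.
Proof.
move=> ht hp; have h1 := qr_ge x; have h2 := pr_le x; have h3 := sqnorm_ge0 x.
have t0 : 0 <= t by rewrite (le_trans _ ht) // addr_ge0 // mulr_ge0.
have h4 : `|p * pr x| <= n.+1%:R * n.+2%:R * sqnorm x.
  by rewrite normrM -mulrA ler_pM.
have h5 : t_base * sqnorm x <= t * qr x.
  by apply: ler_pM => //; rewrite addr_ge0 // mulr_ge0.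
move: h4; rewrite ler_norml => /andP[h4 _].
rewrite /t_base mulrDl mul1r in h5; lra.
Qed.

Lemma tau_positive t p : t_base <= t -> `|p| <= n.+1%:R -> strongly_positive (tau_of t p) 1.
Proof.
by move=> ht hp; split=> // x; rewrite imag_tau rform_Ymat mul1r form_ge.
Qed.

(** The sign of a theta term is exp (pi i (m + epsilon/2) . delta); evenness of the characteristic
    makes the division by 2 exact. *)
Definition sg_exp c m : int := idot m (lift01 c.2) + (idot (lift01 c.1) (lift01 c.2) %/ 2)%Z.
Definition sg c m : R := (-1) ^+ `|sg_exp c m|.

Lemma even_idot c : even_char c ->
  idot (lift01 c.1) (lift01 c.2) = 2 * (idot (lift01 c.1) (lift01 c.2) %/ 2)%Z.
Proof. rewrite even_charE; lia. Qed.

Lemma sg_opp c m : even_char c -> sg c (- m - lift01 c.1) = sg c m.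
Proof.
move=> ev; rewrite /sg; congr (_ ^+ _).
have -> : sg_exp c (- m - lift01 c.1) = - sg_exp c m; last by rewrite abszN.
by rewrite /sg_exp idotDl !idotNl {1}(even_idot ev); ring.
Qed.

Lemma norm_sg c m : `|sg c m| = 1.
Proof. by rewrite /sg normrX normrN1 expr1n. Qed.

Lemma xr_opp e m : xr R e (- m - lift01 e) = - xr R e m.
Proof.
apply/matrixP => i j; rewrite (ord1 j) [RHS]mxE !xr_coset coset_opp colN.
by rewrite intrN mulNr.
Qed.

Lemma pr_opp x : pr (- x) = pr x.
Proof.
rewrite /pr mxE; congr (- _).
rewrite (eq_bigr (fun j => - x j 0)) => [|j _]; last by rewrite mxE.
by rewrite sumrN; ring.
Qed.

Definition gterm c t p m : R := sg c m * expR (- pi * (t * qr (xr R c.1 m) + p * pr (xr R c.1 m))).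

Lemma tauE t p i j : tau_of t p i j = (0 +i* 1) * rc (Ymat t p i j).
Proof.
rewrite /tau_of mxE.
by apply/eqP; rewrite eq_complex /=; apply/andP; split; apply/eqP; ring.
Qed.

Lemma map_colE (x : rvec) i : map_mx (@rc R) x i 0 = rc (x i 0).
Proof. by rewrite mxE. Qed.

Lemma theta_term_tau c t p m : even_char c -> theta_term c (tau_of t p) 0 m = rc (gterm c t p m).
Proof.
move=> ev; rewrite theta_termE add0r mulrDr cexpD mulrC /gterm rcM; congr (_ * _).
  rewrite /sg rcX rcN rc1 -cexp_ipi_int; congr (cexp (_ * _)).
  rewrite half_char_lift dotZr mulrA mulfV ?pnatr_eq0 // mul1r /xc dotDl half_char_lift dotZl !dot_iv.
  by rewrite /sg_exp rmorphD /= {1}(even_idot ev) rmorphM /= mulrA mulVf ?mul1r // pnatr_eq0.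
have -> : qform (tau_of t p) (xc R c.1 m) = (0 +i* 1) * rc (rform (Ymat t p) (xr R c.1 m)).
  rewrite xcE qformE rformE rc_sum mulr_sumr; apply: eq_bigr => i _.
  rewrite rc_sum mulr_sumr; apply: eq_bigr => j _; rewrite !rcM tauE !map_colE.
  move: (rc _) (rc _) (rc _) => a b d; ring.
rewrite rform_Ymat; set r := _ + _.
have -> : ipi * ((0 +i* 1) * rc r) = rc (- pi * r).
  by apply/eqP; rewrite eq_complex /=; apply/andP; split; apply/eqP; ring.
by rewrite /cexp /= cos0 sin0 mulr1 mulr0.
Qed.

(* As [t] grows, a weighted theta series is dominated by the vectors [m]
   at which [qr] is minimal on its coset. *)
Lemma dominance c (w : 'cV[int]_n.+1 -> Cx R) (s : seq 'cV[int]_n.+1) (mu : int) :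
  even_char c -> exp_growth c w -> uniq s ->
  (forall m, m \in s -> qZ (coset c.1 m) = mu) ->
  (forall m, m \notin s -> mu < qZ (coset c.1 m)) ->
  exists C : R, forall t p, t_base <= t -> `|p| <= n.+1%:R ->
    cabs (rc (expR (pi * (t * (mu%:~R / 4)))) * wsum w c (tau_of t p) 0 -
      \sum_(m <- s) w m * rc (sg c m * expR (- pi * (p * pr (xr R c.1 m))))) <=
    C * expR (- pi * ((t - t_base) / 4)).
Proof.
move=> ev gw0 us hmu hgap; have [K [a [K0 a0 hK]]] := gw0.
have p0 : 0 < pi :> R := pi_gt0 R.
have [B hB] := @gw_bounded R n.+1 pi a p0.
set M : R := mu%:~R / 4.
exists (expR (pi * (t_base * M)) * K * B) => t p ht hp.
have hs := has_sumZ (rc (expR (pi * (t * M)))) (wsum_has_sum 0 (tau_positive ht hp) gw0).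
have t0 : 0 <= t - t_base by rewrite subr_ge0.
pose S := [fset x in s]%fset.
have sumS (F : 'cV[int]_n.+1 -> Cx R) : \sum_(m <- S) F m = \sum_(m <- s) F m.
  by apply: perm_big; apply: uniq_perm => // x; rewrite !inE.
have -> : \sum_(m <- s) w m * rc (sg c m * expR (- pi * (p * pr (xr R c.1 m)))) =
    \sum_(m <- S) rc (expR (pi * (t * M))) * (w m * theta_term c (tau_of t p) 0 m).
  rewrite sumS; apply: eq_big_seq => m ms; rewrite theta_term_tau // /gterm qr_xr hmu // -/M.
  rewrite [RHS]mulrCA -rcM; congr (_ * rc _); rewrite [RHS]mulrCA -expRD; congr (_ * expR _); ring.
apply: (has_sum_close hs) => J dJ.
apply: (@le_trans _ _ (\sum_(m <- J) expR (- pi * ((t - t_base) / 4)) * (expR (pi * (t_base * M)) * K) * gw pi a c.1 m)); last first.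
  rewrite -mulr_sumr [leRHS]mulrC -[leLHS]mulrA ler_wpM2l ?expR_ge0 // ler_wpM2l //.
  by rewrite mulr_ge0 ?expR_ge0.
rewrite big_seq [leRHS]big_seq; apply: ler_sum => m mJ.
have ms : m \notin s by have := fdisjointP dJ m mJ; rewrite inE.
rewrite theta_term_tau // cabsM (cabsM (w m)) !cabs_rc /gterm normrM norm_sg mul1r.
rewrite !(ger0_norm (expR_ge0 _)).
(* [qZ] is integral, so outside [s] the form exceeds its minimum by at least 1/4. *)
have q4 : M + 4^-1 <= qr (xr R c.1 m).
  have : (mu + 1)%:~R <= (qZ (coset c.1 m))%:~R :> R by rewrite ler_int lezD1 hgap.
  rewrite qr_xr /M intrD; lra.
have f0 := form_ge (xr R c.1 m) (lexx t_base) hp.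
set Q := qr _ in q4 f0 *; set P := pr _ in f0 *.
rewrite /gw -/(sqnorm _) -/(rn1 _).
(* The part t - t_base produces the decay, the part t_base the summable Gaussian weight. *)
have E1 : expR (pi * (t * M)) * expR (- pi * (t * Q + p * P)) <=
    expR (- pi * ((t - t_base) / 4)) * expR (pi * (t_base * M)) * expR (- pi * sqnorm (xr R c.1 m)).
  rewrite -!expRD ler_expR.
  have -> : pi * (t * M) + - pi * (t * Q + p * P) = - pi * ((t - t_base) * (Q - M) + (t_base * Q + p * P) - t_base * M) by ring.
  have -> : - pi * ((t - t_base) / 4) + pi * (t_base * M) + - pi * sqnorm (xr R c.1 m) =
    - pi * ((t - t_base) / 4 + sqnorm (xr R c.1 m) - t_base * M) by ring.
  rewrite !mulNr lerN2 ler_pM2l // lerD2r lerD // ler_wpM2l //; lra.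
rewrite expRD mulrCA.
apply: (@le_trans _ _ ((K * expR (a * rn1 (xr R c.1 m))) *
  (expR (- pi * ((t - t_base) / 4)) * expR (pi * (t_base * M)) * expR (- pi * sqnorm (xr R c.1 m))))).
  by apply: ler_pM; rewrite ?cabs_ge0 ?mulr_ge0 ?expR_ge0 ?hK.
by rewrite le_eqVlt; apply/orP; left; apply/eqP; ring.
Qed.

End MatrixFamily.

(** * Limits of theta series as t tends to infinity *)

Section Asymptotics.
Variables (R : realType) (n : nat).
Local Notation rvec := 'cV[R]_n.+1.
Implicit Types (m : 'cV[int]_n.+1) (e : 'cV['F_2]_n.+1)
  (c : characteristic n.+1) (i j : 'I_n.+1) (t p : R).

Lemma exp_decay (C t0 eta : R) : 0 < eta ->
  \forall t \near +oo, C * expR (- pi * ((t - t0) / 4)) <= eta.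
Proof.
move=> eta0; have pi0 : 0 < pi :> R := pi_gt0 R.
near=> t.
have ht : t0 + 4 * (`|C| / eta / pi) <= t by near: t; apply: nbhs_pinfty_ge; exact: num_real.
have h : `|C| / eta <= expR (pi * ((t - t0) / 4)).
  apply: le_trans (le_expR _); rewrite -ler_pdivrMl // mulrC; lra.
rewrite mulNr expRN ler_pdivrMr ?expR_gt0 // mulrC -ler_pdivrMr //.
by rewrite (le_trans _ h) // ler_pM2r ?invr_gt0 // ler_norm.
Unshelve. all: by end_near. Qed.

Lemma dominance_near c (w : 'cV[int]_n.+1 -> Cx R) (s : seq 'cV[int]_n.+1) (mu : int) (eta : R) :
  even_char c -> exp_growth c w -> uniq s ->
  (forall m, m \in s -> qZ (coset c.1 m) = mu) ->
  (forall m, m \notin s -> mu < qZ (coset c.1 m)) -> 0 < eta ->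
  \forall t \near +oo, forall p, `|p| <= n.+1%:R ->
    cabs (rc (expR (pi * (t * (mu%:~R / 4)))) * wsum w c (tau_of n t p) 0 -
      \sum_(m <- s) w m * rc (sg R c m * expR (- pi * (p * pr (xr R c.1 m))))) <= eta.
Proof.
move=> ev gw0 us h1 h2 eta0; have [C hC] := dominance ev gw0 us h1 h2.
apply: filterS2 (nbhs_pinfty_ge (num_real (t_base R n))) (exp_decay C (t_base R n) eta0) => t ht hE p hp.
exact: le_trans (hC _ _ ht hp) hE.
Qed.

Lemma theta_const_wsum c (tau : 'M[Cx R]_n.+1) : theta_const c tau = wsum (fun=> 1) c tau 0.
Proof. exact: thetaE. Qed.

(** The minimal vector and its opposite contribute equal terms, so nothing cancels; [L] bounds their
    size below, uniformly in [p]. *)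
Lemma theta_const_neq0 c i0 : even_char c -> lift01 c.1 i0 0 = 0 ->
  \forall t \near +oo, forall p, `|p| <= n.+1%:R -> theta_const c (tau_of n t p) != 0.
Proof.
move=> ev ei0; have [m0 hm0] := unique_min ei0.
(* The two indices coincide when the minimal vector is zero. *)
pose s := undup [:: m0; - m0 - lift01 c.1].
pose P := pr (xr R c.1 m0); pose L : R := expR (- pi * (n.+1%:R * `|P|)).
have L0 : 0 < L := expR_gt0 _.
have h1 m : m \in s -> qZ (coset c.1 m) = qZ (coset c.1 m0).
  rewrite mem_undup !inE => /orP[] /eqP -> //; by rewrite coset_opp qZN.
have h2 m : m \notin s -> qZ (coset c.1 m0) < qZ (coset c.1 m).
  apply: contraNT; rewrite -leNgt => /hm0 h.
  by rewrite mem_undup !inE; case: h => ->; rewrite eqxx ?orbT.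
have L2 : 0 < L / 2 by rewrite divr_gt0.
have H := dominance_near ev (exp_growth1 R c) (undup_uniq _) h1 h2 L2.
apply: filterS H => t h p hp; move: (h p hp); apply: contraTneq; rewrite theta_const_wsum => ->.
rewrite mulr0 sub0r cabsN -ltNge.
have E m : m \in s -> 1 * rc (sg R c m * expR (- pi * (p * pr (xr R c.1 m)))) =
    rc (sg R c m0 * expR (- pi * (p * P))).
  rewrite mul1r mem_undup !inE => /orP[] /eqP -> //.
  by rewrite sg_opp // xr_opp pr_opp.
rewrite (eq_big_seq _ E) big_const_seq count_predT iter_addr_0 /rc -rmorphMn -/(rc _) cabs_rc.
rewrite normrMn normrM norm_sg mul1r ger0_norm ?expR_ge0 //.
have hs : (1 <= size s)%N.
  have mm : m0 \in s by rewrite mem_undup mem_head.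
  by rewrite lt0n size_eq0; apply: contraTneq mm => ->.
have hL : L <= expR (- pi * (p * P)).
  rewrite ler_expR !mulNr lerN2 ler_pM2l ?pi_gt0 // (le_trans (ler_norm _)) //.
  by rewrite normrM ler_wpM2r.
have hs1 : 1 <= (size s)%:R :> R by rewrite ler1n.
rewrite (@lt_le_trans _ _ L) //; first by lra.
by rewrite (le_trans hL) // -mulr_natl ler_peMl ?expR_ge0.
Qed.

Definition chi c i : R := (-1) ^+ (c.2 i 0 : nat).

Lemma flip0 : flip (0 : 'I_n.+1) = 0. Proof. by rewrite /flip eqxx. Qed.

Lemma flip_inj : injective (@flip n).
Proof.
move=> i j h; apply/eqP; apply: contraT => ij.
have := congr1 (fun X : 'cV[int]_n.+1 => X i 0) h.
have := congr1 (fun X : 'cV[int]_n.+1 => X j 0) h.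
rewrite !flipE !eqxx (negPf ij) eq_sym (negPf ij) /=.
by case: (eqVneq i 0) ij => [->|//]; case: (eqVneq j 0).
Qed.

Lemma signz_add (a b : int) : (-1 : R) ^+ `|a + b| = (-1) ^+ `|a| * (-1) ^+ `|b|.
Proof.
have E (x : int) : (-1 : R) ^+ `|x| = (-1) ^ x.
  by case: x => k //; transitivity ((-1)^-1 ^+ k.+1 : R); [rewrite invrN1 | rewrite exprVn].
by rewrite !E expfzDr // oppr_eq0 oner_eq0.
Qed.

Lemma idot_flip e i : i != 0 -> idot (flip i) (lift01 e) = - lift01 e i 0.
Proof.
move=> i0; rewrite /idot (bigD1 i) //= flipE eqxx i0 /= mulN1r big1 ?addr0 // => j ji.
by rewrite flipE (negPf ji) mul0r.
Qed.

Lemma idot0 (a : 'cV[int]_n.+1) : idot 0 a = 0.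
Proof. by rewrite /idot big1 // => j _; rewrite col0 mul0r. Qed.

Lemma sg_flip c i : i != 0 -> sg R c (flip i) = sg R c 0 * chi c i.
Proof.
move=> i0; rewrite /sg /sg_exp idot_flip // addrC signz_add abszN.
rewrite idot0 add0r.
by rewrite /chi; congr (_ * _ ^+ _); rewrite mxE.
Qed.

Lemma xr_flip e i j : (forall j, lift01 e j 0 = 1) ->
  xr R e (flip i) j 0 = 1 / 2 - ((j == i) && (i != 0))%:R.
Proof.
move=> e1; rewrite xr_coset cosetE e1 flipE; case: ifP => _; rewrite ?mulr0 ?add0r ?subr0 //.
rewrite (_ : 2 * -1 + 1 = -1 :> int) // mulrN1z /=; lra.
Qed.

Lemma pr_flip e i : (forall j, lift01 e j 0 = 1) ->
  pr (xr R e (flip i)) = (i != 0)%:R - n.+1%:R / 2.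
Proof.
move=> e1; rewrite /pr; under eq_bigr do rewrite xr_flip //.
rewrite sumrB sumr_const card_ord xr_flip //.
have -> : \sum_j ((j == i) && (i != 0))%:R = (i != 0)%:R :> R.
  by rewrite (bigD1 i) //= eqxx big1 ?addr0 // => j /negPf ->.
have -> : (0 == i) && (i != 0) = false by rewrite eq_sym; case: eqP.
by rewrite -mulr_natl; case: (i != 0) => /=; field.
Qed.

(** Normalizes the contribution of v_0/2 to 1: it undoes the sign and the exponentials of t Q and p
    P there, and the 1/2 accounts for opposite vectors. *)
Definition nf c t p : R := sg R c 0 * expR (pi * (t * ((wt_L n * n.+1%:Z)%:~R / 4))) *
  expR (- (pi * (p * (n.+1%:R / 2)))) / 2.

(* When every entry of [epsilon] is [1], the dominant terms come from the
   vectors with entries [1/2] except for at most one [-1/2], and their opposites. *)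
Lemma ones_asymptotic c (w : 'cV[int]_n.+1 -> Cx R) (eta : R) :
  even_char c -> (forall j, lift01 c.1 j 0 = 1) -> exp_growth c w ->
  (forall m, w (- m - lift01 c.1) = w m) -> 0 < eta ->
  \forall t \near +oo, forall p, `|p| <= n.+1%:R ->
    cabs (rc (nf c t p) * wsum w c (tau_of n t p) 0 -
      (w 0 + rc (expR (- (pi * p))) * \sum_(i | i != 0) w (flip i) * rc (chi c i))) <= eta.
Proof.
move=> ev e1 gw0 wsym eta0.
pose s1 := [seq flip i | i <- index_enum ('I_n.+1 : finType)].
pose s2 := [seq - flip i - lift01 c.1 | i <- index_enum ('I_n.+1 : finType)].
(* Entry 0 is 0 in the first list and -1 in the second. *)
have us : uniq (s1 ++ s2).
  have inj2 : injective (fun i => - flip i - lift01 c.1).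
    by move=> i j h; apply: flip_inj; apply: oppr_inj; apply: addIr h.
  rewrite cat_uniq (map_inj_uniq flip_inj) (map_inj_uniq inj2) !index_enum_uniq andbT /=.
  apply/hasPn => m /mapP[i _ ->]; apply/mapP => -[j _ h].
  have := congr1 (fun X : 'cV[int]_n.+1 => X 0 0) h.
  rewrite !(colD, colN) e1 !flipE ![0 == _]eq_sym.
  by case: (i == 0); case: (j == 0).
have h1 m : m \in s1 ++ s2 -> qZ (coset c.1 m) = wt_L n * n.+1%:Z.
  rewrite mem_cat => /orP[] /mapP[i _ ->]; first exact: qZ_flip.
  by rewrite coset_opp qZN qZ_flip.
have h2 m : m \notin s1 ++ s2 -> wt_L n * n.+1%:Z < qZ (coset c.1 m).
  apply: contraNT; rewrite -leNgt => /(min_flip e1)[i hi].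
  rewrite mem_cat; apply/orP; case: hi => ->; [left | right]; apply/mapP; exists i => //; exact: mem_index_enum.
pose K : R := expR (pi * (n.+1%:R * (n.+1%:R / 2))).
have K0 : 0 < K := expR_gt0 _.
have H := dominance_near ev gw0 us h1 h2 (divr_gt0 eta0 K0).
apply: filterS H => t h p hp; move: (h p hp).
set E := expR _; set W := wsum _ _ _ _; set S := \sum_(m <- s1 ++ s2) _ => hS.
pose a : R := expR (- (pi * (p * (n.+1%:R / 2)))).
have sg2 : sg R c 0 * sg R c 0 = 1.
  by rewrite /sg -exprMn mulrNN mulr1 expr1n.
have termE i : w (flip i) * rc (sg R c (flip i) * expR (- pi * (p * pr (xr R c.1 (flip i))))) =
   rc (sg R c 0 / a) * (if i == 0 then w 0 else rc (expR (- (pi * p))) * (w (flip i) * rc (chi c i))).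
  rewrite pr_flip //; case: eqVneq => [->|i0] /=.
    rewrite flip0 mulrC; congr (rc (_ * _) * _).
    by rewrite /a -expRN opprK; congr expR; ring.
  rewrite sg_flip //.
  have -> : expR (- pi * (p * (1%:R - n.+1%:R / 2))) = a^-1 * expR (- (pi * p)).
    by rewrite /a -expRN opprK -expRD; congr expR; ring.
  rewrite !rcM; move: (w _) (rc _) (rc _) (rc _) (rc (chi _ _)) => x1 x2 x3 x4 x5; ring.
have opE i : w (- flip i - lift01 c.1) *
    rc (sg R c (- flip i - lift01 c.1) * expR (- pi * (p * pr (xr R c.1 (- flip i - lift01 c.1))))) =
  w (flip i) * rc (sg R c (flip i) * expR (- pi * (p * pr (xr R c.1 (flip i))))).
  by rewrite wsym sg_opp // xr_opp pr_opp.
have SE : S = 2 * (rc (sg R c 0 / a) * (w 0 + rc (expR (- (pi * p))) * \sum_(i | i != 0) w (flip i) * rc (chi c i))).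
  rewrite /S big_cat !big_map.
  rewrite [X in X + _ = _](eq_bigr _ (fun i _ => termE i)).
  rewrite [X in _ + X = _](eq_bigr _ (fun i _ => etrans (opE i) (termE i))) -mulr_sumr -mulr2n -[LHS]mulr_natl.
  congr (_ * (_ * _)); rewrite (bigD1 0) //= mulr_sumr; congr (_ + _).
  by apply: eq_bigr => i /negPf ->.
have a0 : a != 0 by rewrite gt_eqF ?expR_gt0.
have aK : a <= K.
  rewrite /a /K ler_expR -mulrN ler_pM2l ?pi_gt0 // -mulNr ler_wpM2r ?divr_ge0 //.
  by rewrite (le_trans (ler_norm _)) // normrN.
have -> : rc (nf c t p) * W - (w 0 + rc (expR (- (pi * p))) * \sum_(i | i != 0) w (flip i) * rc (chi c i)) =
    rc (sg R c 0 * a / 2) * (rc E * W - S).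
  rewrite SE mulrBr; congr (_ - _).
    by rewrite mulrA -rcM; congr (rc _ * _); rewrite /nf -/E -/a; ring.
  move: (w 0 + _) => Z; rewrite -[2 : Cx R](rc_nat R 2) !mulrA -!rcM.
  have -> : sg R c 0 * a / 2 * 2%:R * (sg R c 0 / a) = 1; last by rewrite rc1 mul1r.
  by transitivity (sg R c 0 * sg R c 0 * (a / a)); [field | rewrite sg2 divff // mulr1].
rewrite cabsM cabs_rc normrM normrM norm_sg mul1r !ger0_norm ?invr_ge0 ?expR_ge0 //.
apply: (@le_trans _ _ (K * (eta / K))); last by rewrite mulrCA divff ?mulr1 ?gt_eqF.
apply: ler_pM; rewrite ?cabs_ge0 ?divr_ge0 ?expR_ge0 //.
by rewrite ler_pdivrMr // (le_trans aK) // ler_peMr ?ler1n // ltW.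
Qed.

End Asymptotics.

(** * Nondegeneracy of the limiting Hessian *)

Section PerturbedMatrix.
Variables (R : realType) (n : nat).
Implicit Types (i j k : 'I_n.+1).

Definition flip_entry i j : R := 1 - 2 * ((j == i) && (i != 0))%:R.
Definition gram (y : R) j k : R :=
  flip_entry 0 j * flip_entry 0 k - y * \sum_(i | i != 0) flip_entry i j * flip_entry i k.

Lemma sum_neq0 (V : nmodType) (x : V) : \sum_(i : 'I_n.+1 | i != 0) x = x *+ n.
Proof.
rewrite sumr_const; congr (_ *+ _).
by have := cardC1 (0 : 'I_n.+1); rewrite card_ord.
Qed.

Lemma sum_neq0_eq j : \sum_(i | i != 0) ((j == i) && (i != 0))%:R = (j != 0)%:R :> R.
Proof.
have [->|j0] := eqVneq j 0.
  by rewrite big1 // => i i0; rewrite eq_sym (negPf i0).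
rewrite (bigD1 j) //= eqxx j0 big1 ?addr0 // => i /andP[_ ij].
by rewrite eq_sym (negPf ij).
Qed.

Lemma gramE y j k : gram y j k = (1 - n%:R * y) + 2 * y * (j != 0)%:R + 2 * y * (k != 0)%:R -
  4 * y * ((j != 0) && (j == k))%:R.
Proof.
have E i : flip_entry i j * flip_entry i k =
    1 - 2 * ((j == i) && (i != 0))%:R - 2 * ((k == i) && (i != 0))%:R +
    4 * (((j == i) && (i != 0)) && (j == k))%:R.
  rewrite /flip_entry; case: (eqVneq j i) => [->|ji] /=; last first.
    by ring.
  by case: (eqVneq k i) => _; case: (i != 0) => /=; ring.
rewrite /gram (eq_bigr _ (fun i _ => E i)) !big_split /= !sumrN -!mulr_sumr !sum_neq0_eq sum_neq0.
have -> : \sum_(i | i != 0) (((j == i) && (i != 0)) && (j == k))%:R = ((j != 0) && (j == k))%:R :> R.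
  by case: (j == k); rewrite ?andbT -?sum_neq0_eq; [apply: eq_bigr => i _; rewrite andbT | rewrite andbF big1 // => i _; rewrite andbF].
by rewrite /flip_entry eqxx /= !andbF /=; ring.
Qed.

Lemma gram_sum (y : R) (u : 'I_n.+1 -> Cx R) k :
  \sum_j u j * rc (gram y j k) = rc (1 - n%:R * y) * (\sum_j u j) +
    rc (2 * y) * (\sum_j u j - u 0) + rc (2 * y * (k != 0)%:R) * (\sum_j u j) -
    rc (4 * y * (k != 0)%:R) * u k.
Proof.
have E j : u j * rc (gram y j k) = rc (1 - n%:R * y) * u j + rc (2 * y) * (u j * (j != 0)%:R) +
    rc (2 * y * (k != 0)%:R) * u j - rc (4 * y) * (u j * ((j != 0) && (j == k))%:R).
  rewrite gramE !(rcD, rcN, rcM, rc_nat).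
  move: (u j) (rc y) (_%:R) (_%:R) (_%:R) => a b x1 x2 x3; ring.
rewrite (eq_bigr _ (fun i _ => E i)) !big_split /= sumrN -!mulr_sumr.
congr (_ + _ * _ + _ - _).
  rewrite [RHS]addrC (bigD1 0) //= [in RHS](bigD1 0) //= ?eqxx /= mulr0 add0r addKr.
  by apply: eq_bigr => j ->; rewrite mulr1.
rewrite [rc (4 * y * _)]rcM rc_nat -mulrA; congr (_ * _).
rewrite (bigD1 k) //= eqxx andbT big1 ?addr0 1?mulrC // => j /negPf ->.
by rewrite andbF mulr0.
Qed.

(** For u in the kernel with entry sum sigma, equation 0 makes sigma - u_0 small, and subtracting it
    from equation k makes sigma - 2 u_k small. Summing over k gives a small n sigma, hence small
    entries: in total N <= 4 n (n + 2) eta N < N for the l1 norm N of u. *)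
Lemma perturbed_rank (H : 'M[Cx R]_n.+1) (y eta : R) : (0 < n)%N ->
  (forall j k, cabs (H j k - rc (gram y j k)) <= eta) -> `|1 - n%:R * y| <= eta ->
  1 <= 2 * n%:R * y -> 4 * n%:R * n.+2%:R * eta < 1 -> \rank H = n.+1.
Proof.
move=> n0 hH ha hy heta.
have n1 : 1 <= n%:R :> R by rewrite ler1n.
have eta0 : 0 <= eta by rewrite (le_trans _ ha).
apply/eqP; rewrite -[_ == _]/(row_free H) row_free_unit unitmxE unitfE; apply/det0P => -[u un0 uH].
pose sigma : Cx R := \sum_j u 0 j; pose N : R := \sum_j cabs (u 0 j).
pose r k : Cx R := \sum_j u 0 j * (H j k - rc (gram y j k)).
have N0 : 0 < N.
  rewrite lt_neqAle sumr_ge0 ?andbT => [|j _]; last exact: cabs_ge0.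
  apply: contraNneq un0 => /esym/eqP; rewrite psumr_eq0 => [/allP h|j _]; last exact: cabs_ge0.
  by apply/eqP/matrixP => i j; rewrite (ord1 i) mxE; apply/eqP; rewrite -cabs_eq0; exact: (h j (mem_index_enum _)).
have hr k : cabs (r k) <= eta * N.
  rewrite (le_trans (cabs_sum _ _ _)) // mulr_sumr; apply: ler_sum => j _.
  by rewrite cabsM mulrC ler_wpM2r ?cabs_ge0.
have hsig : cabs sigma <= N by exact: cabs_sum.
have eqk k : \sum_j u 0 j * rc (gram y j k) = - r k.
  rewrite /r; under [in RHS]eq_bigr do rewrite mulrBr.
  rewrite sumrB opprB -[LHS]subr0; congr (_ - _).
  by have := congr1 (fun M : 'rV[Cx R]_n.+1 => M 0 k) uH; rewrite !mxE => ->.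
pose beta : R := 2 * n%:R * eta * N.
have y0 : 0 < y.
  have : 0 < 2 * n%:R * y by rewrite (lt_le_trans _ hy).
  by rewrite pmulr_rgt0 // mulr_gt0 // (lt_le_trans _ n1).
have small (z : Cx R) : cabs (rc (2 * y) * z) <= 2 * eta * N -> cabs z <= beta.
  have y2 : 0 <= 2 * y by lra.
  rewrite cabsM cabs_rc ger0_norm // => h.
  have h1 : y * cabs z <= eta * N by lra.
  have h2 : 2 * n%:R * y * cabs z <= 2 * n%:R * (eta * N).
    by rewrite -mulrA ler_wpM2l // mulr_ge0 // ltW // (lt_le_trans _ n1).
  rewrite /beta -[_ * eta * N]mulrA (le_trans _ h2) //.
  by rewrite ler_peMl ?cabs_ge0.
have hs0 : cabs (sigma - u 0 0) <= beta.
  apply: small; have := eqk 0; rewrite gram_sum eqxx /= !mulr0 rc0 !mul0r subr0 addr0 -/sigma.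
  move=> /(canRL (addKr _)) ->; rewrite (le_trans (cabsD _ _)) // !cabsN cabsM cabs_rc.
  have : `|1 - n%:R * y| * cabs sigma <= eta * N by apply: ler_pM; rewrite ?cabs_ge0.
  by have := hr 0; lra.
have hsk k : k != 0 -> cabs (sigma - 2 * u 0 k) <= beta.
  move=> k0; apply: small; have := eqk k; have := eqk 0.
  rewrite !gram_sum eqxx k0 /= !mulr0 rc0 !mul0r subr0 addr0 !mulr1 -/sigma => -> e.
  have -> : rc (2 * y) * (sigma - 2 * u 0 k) = r 0 - r k.
    rewrite -e [rc (4 * y)](_ : _ = rc (2 * y) * 2).
      by move: (rc _) => a; ring.
    by rewrite -(rc_nat R 2) -rcM; congr rc; ring.
  by rewrite (le_trans (cabsB _ _)) //; have := hr 0; have := hr k; lra.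
have hsigma : cabs sigma <= 3 * beta.
  have E : n%:R * sigma = \sum_(k | k != 0) (sigma - 2 * u 0 k) + 2 * (sigma - u 0 0).
    have -> : sigma - u 0 0 = \sum_(k | k != 0) u 0 k by rewrite /sigma (bigD1 0) //= addrAC subrr add0r.
    by rewrite sumrB sum_neq0 -[sigma *+ n]mulr_natl -mulr_sumr subrK.
  have : cabs (n%:R * sigma) <= n%:R * beta + 2 * beta.
    rewrite E (le_trans (cabsD _ _)) // lerD //.
      rewrite (le_trans (cabs_sum _ _ _)) // mulr_natl -sum_neq0; exact: ler_sum.
    by rewrite cabsM cabs_nat ler_pM2l.
  rewrite cabsM cabs_nat => h.
  have b0 : 0 <= beta by rewrite (le_trans _ hs0) // cabs_ge0.
  have : n%:R * cabs sigma <= n%:R * (3 * beta).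
    rewrite (le_trans h) //; have : 2 * beta <= n%:R * (2 * beta) by rewrite ler_peMl // mulr_ge0.
    lra.
  by rewrite ler_pM2l // (lt_le_trans _ n1).
have hu0 : cabs (u 0 0) <= 4 * beta.
  have -> : u 0 0 = sigma - (sigma - u 0 0) by rewrite subKr.
  by rewrite (le_trans (cabsB _ _)) //; lra.
have huk k : k != 0 -> cabs (u 0 k) <= 2 * beta.
  move=> k0; have : cabs (2 * u 0 k) <= 4 * beta.
    have -> : 2 * u 0 k = sigma - (sigma - 2 * u 0 k) by rewrite subKr.
    by rewrite (le_trans (cabsB _ _)) //; have := hsk k k0; lra.
  by rewrite cabsM cabs_nat; lra.
have : N <= 4 * beta + n%:R * (2 * beta).
  by rewrite /N (bigD1 0) //= lerD // mulr_natl -sum_neq0; exact: ler_sum.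
have -> : 4 * beta + n%:R * (2 * beta) = 4 * n%:R * n.+2%:R * eta * N.
  by rewrite /beta -[n.+2]addn2 natrD; ring.
by apply/negP; rewrite -ltNge gtr_pMl.
Qed.

End PerturbedMatrix.

(** * A zero of one theta constant by the intermediate value theorem *)

Section SpecialPoint.
Variables (R : realType) (n : nat).
Implicit Types (m : 'cV[int]_n.+1) (e : 'cV['F_2]_n.+1)
  (c : characteristic n.+1) (i j k : 'I_n.+1) (t p : R).

Lemma has_sum_real (I : choiceType) (f : I -> R) (l : Cx R) :
  has_sum (fun x : I => rc (f x)) l -> l = rc (complex.Re l).
Proof.
move=> h; rewrite [LHS]complex_split; suff -> : complex.Im l = 0 by rewrite rc0 mulr0 addr0.
apply/eqP; rewrite -normr_eq0 eq_le normr_ge0 andbT; apply/ler_addgt0Pr => x x0; rewrite add0r.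
have [J hJ] := h _ x0; have := hJ J (fsubset_refl _); apply: le_trans.
apply: le_trans (Im_le_cabs _); rewrite -rc_sum ImD.
have -> : complex.Im (- l) = - complex.Im l by case: (l).
by rewrite /= add0r normrN.
Qed.

Definition rtheta c t p : R := complex.Re (theta_const c (tau_of n t p)).

Lemma gterm_has_sum c t p : even_char c -> t_base R n <= t -> `|p| <= n.+1%:R ->
  has_sum (fun m => rc (gterm c t p m)) (theta_const c (tau_of n t p)).
Proof.
move=> ev ht hp; apply: eq_has_sum (theta_has_sum c 0 (tau_positive ht hp)) => m.
exact: theta_term_tau.
Qed.

Lemma rthetaE c t p : even_char c -> t_base R n <= t -> `|p| <= n.+1%:R ->
  theta_const c (tau_of n t p) = rc (rtheta c t p).
Proof. by move=> ev ht hp; apply: (has_sum_real (gterm_has_sum ev ht hp)). Qed.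

Lemma expR_lipschitz (a b M : R) : expR a <= M -> expR b <= M ->
  `|expR a - expR b| <= `|a - b| * M.
Proof.
wlog ab : a b / b <= a => [H ha hb|ha hb].
  have [/H h|/ltW/H h] := leP b a; first exact: h.
  by rewrite distrC [X in X * _]distrC; exact: h.
rewrite !ger0_norm ?subr_ge0 ?ler_expR //.
have -> : expR a - expR b = expR a * (1 - expR (b - a)).
  by rewrite mulrBr mulr1 -expRD [a + _]addrC subrK.
rewrite mulrC; have h := expR_ge1Dx (b - a).
apply: (@le_trans _ _ ((a - b) * expR a)); last by rewrite ler_wpM2l // subr_ge0.
by rewrite ler_wpM2r ?expR_ge0 //; lra.
Qed.

(** Applying [form_ge] at p - 1 or p + 1 gains [|pr x|], which absorbs the factor [pr x] when terms
    are compared for two values of [p]. *)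
Lemma form_ge_pr t p (x : 'cV[R]_n.+1) : t_base R n <= t -> `|p| <= n%:R ->
  sqnorm x + `|pr x| <= t * qr x + p * pr x.
Proof.
move=> ht hp; move: (hp); rewrite ler_norml => /andP[p1 p2].
have N : n.+1%:R = n%:R + 1 :> R by rewrite -natr1.
have [x0|x0] := lerP 0 (pr x); [rewrite ger0_norm // | rewrite ltr0_norm //].
  have hq : `|p - 1| <= n.+1%:R by rewrite ler_norml N; apply/andP; split; lra.
  by have := form_ge x ht hq; lra.
have hq : `|p + 1| <= n.+1%:R by rewrite ler_norml N; apply/andP; split; lra.
by have := form_ge x ht hq; lra.
Qed.

Lemma rtheta_lipschitz c : even_char c -> exists B : R, forall t p q,
  t_base R n <= t -> `|p| <= n%:R -> `|q| <= n%:R ->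
  `|rtheta c t p - rtheta c t q| <= `|p - q| * B.
Proof.
move=> ev; have p0 : 0 < pi :> R := pi_gt0 R.
have [B hB] := @gw_bounded R n.+1 pi 0 p0; exists B => t p q ht hp hq.
have wd (x : R) : `|x| <= n%:R -> `|x| <= n.+1%:R by move=> h; rewrite (le_trans h) // ler_nat.
have := has_sumB (gterm_has_sum ev ht (wd _ hp)) (gterm_has_sum ev ht (wd _ hq)).
rewrite !rthetaE ?wd // => hs; rewrite -cabs_rc rcD rcN; apply: (has_sum_le hs) => J.
apply: (@le_trans _ _ (\sum_(m <- J) `|p - q| * gw pi 0 c.1 m)); last by rewrite -mulr_sumr ler_wpM2l.
apply: ler_sum => m _; rewrite -rcN -rcD cabs_rc /gterm -mulrBr normrM norm_sg mul1r.
set x := xr R c.1 m; set M := expR (- pi * (sqnorm x + `|pr x|)).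
have hM y : `|y| <= n%:R -> expR (- pi * (t * qr x + y * pr x)) <= M.
  by move=> hy; rewrite ler_expR !mulNr lerN2 ler_pM2l // form_ge_pr.
rewrite (le_trans (expR_lipschitz (hM p hp) (hM q hq))) //.
have -> : - pi * (t * qr x + p * pr x) - - pi * (t * qr x + q * pr x) = - (pi * ((p - q) * pr x)) by ring.
rewrite normrN !normrM (gtr0_norm p0) mulrCA -mulrA ler_wpM2l // /gw -/x mul0r addr0.
rewrite /M mulrDr expRD mulrCA ler_piMr ?expR_ge0 // mulNr expRN ler_pdivrMr ?expR_gt0 // mul1r.
exact: le_expR.
Qed.

Lemma rtheta_continuous c t : even_char c -> t_base R n <= t -> (0 < n)%N ->
  {within `[-1, n%:R], continuous (rtheta c t)}.
Proof.
move=> ev ht n0; have [B hB] := rtheta_lipschitz ev.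
have rng (x : R) : x \in `[-1, n%:R]%R -> `|x| <= n%:R.
  rewrite in_itv /= ler_norml => /andP[h1 ->]; rewrite andbT (le_trans _ h1) // lerN2.
  by rewrite ler1n.
apply/subspace_continuousP => x /= xA; apply/cvgrPdist_le => e e0.
rewrite near_withinE; near=> y => yA; apply: (le_trans (hB _ _ _ ht (rng _ xA) (rng _ yA))).
have h : `|x - y| <= e / (`|B| + 1).
  by near: y; apply: cvgr_dist_le; [exact: cvg_id | rewrite divr_gt0 // ltr_wpDl].
apply: (@le_trans _ _ (`|x - y| * (`|B| + 1))).
  by rewrite ler_wpM2l // (le_trans (ler_norm _)) // lerDl.
by rewrite -ler_pdivlMr // ltr_wpDl.
Unshelve. all: by end_near. Qed.

Lemma rtheta_asymptotic c (eta : R) : even_char c -> (forall j, lift01 c.1 j 0 = 1) -> 0 < eta ->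
  \forall t \near +oo, forall p, `|p| <= n.+1%:R ->
    `|nf c t p * rtheta c t p - (1 + expR (- (pi * p)) * \sum_(i | i != 0) chi R c i)| <= eta.
Proof.
move=> ev e1 eta0.
have H := ones_asymptotic ev e1 (exp_growth1 R c) (fun=> erefl) eta0.
apply: filterS2 H (nbhs_pinfty_ge (num_real (t_base R n))) => t h ht p hp; rewrite -cabs_rc.
move: (h p hp); rewrite -theta_const_wsum rthetaE //; apply: le_trans.
rewrite rcD rcN rcM rcD rcM rc_sum rc1; under [in leRHS]eq_bigr do rewrite mul1r.
exact: lexx.
Qed.

(* Entry 0 of [delta] is determined by the others and the evenness. *)
Definition null_char : characteristic n.+1 :=
  (const_mx 1, \col_i (if i == 0 then n%:R else 1)).

Lemma F2D (x : 'F_2) : x + x = 0.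
Proof. exact: addrr_pchar2 (pchar_Fp (isT : prime 2)) x. Qed.

Lemma ones_even c : (forall j, lift01 c.1 j 0 = 1) ->
  even_char c = (c.2 0 0 == \sum_(i | i != 0) c.2 i 0).
Proof.
move=> e1; have c1 j : c.1 j 0 = 1.
  by have := e1 j; rewrite mxE; case: (c.1 j 0) => -[|[|]] //= h _; apply: val_inj.
rewrite /even_char mxE (bigD1 0) //= mxE c1 mul1r.
rewrite (eq_bigr (fun i => c.2 i 0)) => [|i _]; last by rewrite mxE c1 mul1r.
set s := \sum_(i | _) _; rewrite -[in RHS]subr_eq0; congr (_ + _ == _).
by apply/eqP; rewrite -subr_eq0 opprK F2D.
Qed.

Lemma null_char1 j : lift01 null_char.1 j 0 = 1.
Proof. by rewrite /= !mxE. Qed.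

Lemma null_char2 i : i != 0 -> null_char.2 i 0 = 1.
Proof. by move=> /negPf h; rewrite /= mxE h. Qed.

Lemma null_char_even : even_char null_char.
Proof.
rewrite ones_even; last exact: null_char1.
by rewrite (eq_bigr _ null_char2) sum_neq0 /= mxE eqxx.
Qed.

Lemma null_char_uniq c : even_char c -> (forall j, lift01 c.1 j 0 = 1) ->
  (forall i, i != 0 -> c.2 i 0 = 1) -> c = null_char.
Proof.
move=> ev e1 h; rewrite [c]surjective_pairing /null_char; congr (_, _).
  apply/matrixP => j k; rewrite (ord1 k) mxE.
  by have := e1 j; rewrite mxE; case: (c.1 j 0) => -[|[|]] //= h' _; apply: val_inj.
apply/matrixP => j k; rewrite (ord1 k) [RHS]mxE; case: eqVneq => [->|]; last exact: h.
by move: ev; rewrite ones_even // (eq_bigr _ h) sum_neq0 => /eqP.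
Qed.

Lemma chi_null i : i != 0 -> chi R null_char i = -1.
Proof. by move=> i0; rewrite /chi null_char2. Qed.

Lemma chi_ge c i : -1 <= chi R c i.
Proof. by rewrite /chi; case: (c.2 i 0) => -[|[|]] //= _; rewrite ?expr0 ?expr1 // lerN10. Qed.

Lemma sum_chi_null : \sum_(i | i != 0) chi R null_char i = - n%:R.
Proof. by rewrite (eq_bigr _ chi_null) sum_neq0 mulNrn. Qed.

(** By [null_char_uniq] at least one of the n signs is +1. *)
Lemma sum_chi_ge c : even_char c -> (forall j, lift01 c.1 j 0 = 1) -> c != null_char ->
  2 - n%:R <= \sum_(i | i != 0) chi R c i.
Proof.
move=> ev e1 cn; have [i i0 ci] : exists2 i, i != 0 & c.2 i 0 != 1.
  apply: contrapT => h; move/eqP: cn; apply; apply: null_char_uniq => // i i0.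
  by apply/eqP/negPn/negP => hi; apply: h; exists i.
have chi1 : chi R c i = 1.
  have : (c.2 i 0 : nat) != 1%N by apply: contra ci => /eqP h; apply/eqP/val_inj.
  by rewrite /chi; case: (c.2 i 0 : nat) (ltn_ord (c.2 i 0)) => [|[|]].
have := sum_neq0 n (-1 : R); rewrite mulNrn => <-.
rewrite (bigD1 i) //= [leRHS](bigD1 i) //= chi1.
have : \sum_(j | (j != 0) && (j != i)) -1 <= \sum_(j | (j != 0) && (j != i)) chi R c j.
  by apply: ler_sum => j _; exact: chi_ge.
by lra.
Qed.

(** The limit 1 - n exp (- pi p) is at most -2 at p = -1 and at least 1/2 at p = n, which an error
    of 1/4 does not affect. *)
Lemma null_char_zero : (0 < n)%N -> \forall t \near +oo, exists2 p : R, `|p| <= n%:R &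
  theta_const null_char (tau_of n t p) = 0.
Proof.
move=> n0; have h4 : 0 < 1 / 4 :> R by lra.
have H := rtheta_asymptotic null_char_even null_char1 h4.
have pi2 := pi_ge2 R.
have n1 : 1 <= n%:R :> R by rewrite ler1n.
apply: filterS2 H (nbhs_pinfty_ge (num_real (t_base R n))) => t Ht ht.
have wd (x : R) : `|x| <= n%:R -> `|x| <= n.+1%:R by move=> h; rewrite (le_trans h) // ler_nat.
(* [nf] is this sign times a positive number; only the sign is kept in [f]. *)
have [s0 s0E] : exists s0, s0 = sg R null_char 0 by eexists.
pose f p := s0 * rtheta null_char t p.
have nfE p : exists2 a : R, 0 < a & nf null_char t p = s0 * a.
  exists (expR (pi * (t * ((wt_L n * n.+1%:Z)%:~R / 4))) * expR (- (pi * (p * (n.+1%:R / 2)))) / 2).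
    by rewrite !mulr_gt0 ?expR_gt0 ?invr_gt0.
  by rewrite /nf s0E !mulrA.
have f1 : f (-1) < 0.
  have hn : `|-1 : R| <= n.+1%:R by rewrite normrN1 ler1n.
  have [a a0 aE] := nfE (-1).
  have := Ht _ hn; rewrite sum_chi_null aE mulrN1 opprK ler_norml => /andP[_ h].
  have h1 := expR_ge1Dx (pi : R).
  have h2 : 3 <= expR pi * n%:R :> R.
    have h3 : 1 * 3 <= n%:R * expR pi :> R by apply: ler_pM => //; lra.
    by rewrite mulrC; lra.
  have : a * f (-1) < 0 by rewrite /f; lra.
  by rewrite pmulr_rlt0.
have fn : 0 < f n%:R.
  have hn : `|n%:R : R| <= n.+1%:R by rewrite normr_nat ler_nat.
  have [a a0 aE] := nfE n%:R.
  have := Ht _ hn; rewrite sum_chi_null aE ler_norml => /andP[h _].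
  have h1 := expR_ge1Dx (pi * n%:R : R).
  have h2 : expR (- (pi * n%:R)) * n%:R <= 1 / 2 :> R.
    rewrite expRN mulrC ler_pdivrMr ?expR_gt0 //.
    have : 2 * n%:R <= pi * n%:R :> R by rewrite ler_wpM2r.
    lra.
  have : 0 < a * f n%:R by rewrite /f; lra.
  by rewrite pmulr_rgt0.
have ab : -1 <= n%:R :> R by rewrite (le_trans _ (le_trans ler01 n1)) // lerN10.
have fc := rtheta_continuous null_char_even ht n0.
have mm : Num.min (rtheta null_char t (-1)) (rtheta null_char t n%:R) <= 0 <=
    Num.max (rtheta null_char t (-1)) (rtheta null_char t n%:R).
  move: f1 fn; rewrite /f {f fc}; move: (rtheta _ _ (-1)) (rtheta _ _ n%:R) => x1 x2.
  rewrite ge_min le_max.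
  have [s00|s00|->] := ltrgt0P s0; last by rewrite mul0r ltxx.
    by rewrite pmulr_rlt0 // pmulr_rgt0 // => /ltW -> /ltW ->; rewrite orbT.
  by rewrite nmulr_rlt0 // nmulr_rgt0 // => /ltW -> /ltW ->; rewrite orbT.
have [p pI fp] := IVT ab fc mm.
have hp : `|p| <= n%:R.
  by move: pI; rewrite in_itv /= ler_norml => /andP[h ->]; rewrite andbT (le_trans _ h) // lerN2.
by exists p => //; rewrite (rthetaE null_char_even ht (wd _ hp)) fp.
Qed.

End SpecialPoint.

Section SpecialMatrix.
Variables (R : realType) (n : nat).
Hypothesis n_gt0 : (0 < n)%N.
Implicit Types (m : 'cV[int]_n.+1) (c : characteristic n.+1) (i j k : 'I_n.+1) (t p : R).
Local Notation ipi := (ipi R).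

Lemma null_char_y (eta : R) : 0 < eta ->
  \forall t \near +oo, forall p, `|p| <= n.+1%:R -> theta_const (null_char n) (tau_of n t p) = 0 ->
    `|1 - n%:R * expR (- (pi * p))| <= eta.
Proof.
move=> eta0; have H := rtheta_asymptotic (null_char_even n) (@null_char1 n) eta0.
apply: filterS2 H (nbhs_pinfty_ge (num_real (t_base R n))) => t h ht p hp.
rewrite (rthetaE (null_char_even n) ht hp) => /(congr1 (@complex.Re R)) /= h0.
by have := h p hp; rewrite h0 mulr0 sub0r normrN sum_chi_null mulrN [_ * n%:R]mulrC.
Qed.

(** At a zero of the chosen theta constant y is close to 1/n, so for other characteristics with
    epsilon all ones 1 + y (2 - n) is close to 2/n. There are finitely many characteristics, so one
    [t] serves all. *)
Lemma other_neq0 : \forall t \near +oo, forall c p, `|p| <= n.+1%:R ->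
  theta_const (null_char n) (tau_of n t p) = 0 -> even_char c -> c != null_char n ->
  theta_const c (tau_of n t p) != 0.
Proof.
apply: filter_forall => c.
have [ev|] := boolP (even_char c); last by move=> _; apply: nearW.
have [->|cn] := eqVneq c (null_char n); first by apply: nearW.
have [[i0 ei0]|e1] := pselect (exists i0, lift01 c.1 i0 0 = 0).
  have H := @theta_const_neq0 R n c i0 ev ei0.
  by apply: filterS H => t h p hp _ _ _; exact: h.
have c1 j : lift01 c.1 j 0 = 1.
  by have [h|//] := lift01_bool c.1 j; case: e1; exists j.
have n1 : 1 <= n%:R :> R by rewrite ler1n.
(* A zero of both would give y <= eta, hence n y <= 1/8, against n y >= 1 - eta. *)
pose eta : R := (8 * n%:R)^-1.
have eta0 : 0 < eta by rewrite invr_gt0; lra.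
have etaE : n%:R * eta = 1 / 8 by rewrite /eta; field; lra.
have H1 := null_char_y eta0; have H2 := rtheta_asymptotic ev c1 eta0.
apply: filterS3 H1 H2 (nbhs_pinfty_ge (num_real (t_base R n))) => t h1 h2 ht p hp th0 _ _.
apply/eqP; rewrite (rthetaE ev ht hp) => /(congr1 (@complex.Re R)) /= h0.
have := h1 p hp th0; have := h2 p hp; rewrite h0 mulr0 sub0r normrN.
have := sum_chi_ge R ev c1 cn; have := expR_ge0 (- (pi * p)).
move: (expR _) (\sum_(_ | _) _) etaE eta0 => y S etaE eta0 y0 hS; rewrite !ler_norml => /andP[_ a1] /andP[a2 a3].
have b1 : y * (2 - n%:R) <= y * S by rewrite ler_wpM2l.
have b2 : 2 * y <= 2 * eta by lra.
have b3 : n%:R * (2 * y) <= n%:R * (2 * eta) by rewrite ler_wpM2l //; lra.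
have b4 : 1 * eta <= n%:R * eta by rewrite ler_wpM2r // ltW.
lra.
Qed.

Lemma lin_deltaE c k m : lin c (delta_mx k 0) m = ipi * rc (2 * xr R c.1 m k 0).
Proof.
by rewrite /lin dot_delta xcE map_colE rcM rc_nat mulrA [2 * _]mulrC.
Qed.

Definition hess_weight c j k m : Cx R := lin c (delta_mx k 0) m * lin c (delta_mx j 0) m.

Lemma hess_weight_sym c j k m : hess_weight c j k (- m - lift01 c.1) = hess_weight c j k m.
Proof.
have E x : (- xr R c.1 m) x 0 = - xr R c.1 m x 0 by rewrite mxE.
by rewrite /hess_weight !lin_deltaE xr_opp !E !mulrN !rcN !mulrN mulNr opprK.
Qed.

Lemma hess_weight_flip c i j k : (forall j, lift01 c.1 j 0 = 1) ->
  hess_weight c j k (flip i) = ipi ^+ 2 * rc (flip_entry R i j * flip_entry R i k).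
Proof.
move=> c1; have E x : 2 * xr R c.1 (flip i) x 0 = flip_entry R i x.
  by rewrite xr_flip // /flip_entry mulrBr; congr (_ - _); field.
rewrite /hess_weight !lin_deltaE !E rcM.
by rewrite [rc _ * rc _]mulrC mulrACA -expr2.
Qed.

Lemma ipi2 : ipi ^+ 2 = - rc (pi ^+ 2).
Proof.
by rewrite expr2; apply/eqP; rewrite eq_complex /=; apply/andP; split; apply/eqP; ring.
Qed.

(** The weight is even and equals (pi i)^2 times the entry of v_i v_i^T at v_i/2; dividing by (pi
    i)^2 does not increase the error since pi^2 >= 1. *)
Lemma hessian_asymptotic (eta : R) j k : 0 < eta ->
  \forall t \near +oo, forall p, `|p| <= n.+1%:R ->
    cabs ((rc (nf (null_char n) t p) / ipi ^+ 2) * theta_hessian (null_char n) (tau_of n t p) j k -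
      rc (gram (expR (- (pi * p))) j k)) <= eta.
Proof.
move=> eta0; have gr : exp_growth (null_char n) (hess_weight (null_char n) j k).
  by apply: exp_growth_lin; exact: exp_growth_lin1.
have H := ones_asymptotic (null_char_even n) (@null_char1 n) gr (hess_weight_sym _ j k) eta0.
apply: filterS2 H (nbhs_pinfty_ge (num_real (t_base R n))) => t h ht p hp.
move: (h p hp); rewrite (theta_hessianE (null_char n) j k (tau_positive ht hp)) -/(hess_weight _ j k).
set W := wsum _ _ _ _; set y := expR _.
have -> : hess_weight (null_char n) j k 0 + rc y *
    (\sum_(i | i != 0) hess_weight (null_char n) j k (flip i) * rc (chi R (null_char n) i)) =
    ipi ^+ 2 * rc (gram y j k).
  rewrite -(flip0 n) hess_weight_flip; last exact: null_char1.
  rewrite /gram rcD rcN [rc (y * _)]rcM rc_sum [RHS]mulrBr; congr (_ + _).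
  rewrite mulrCA -mulrN; congr (_ * _); rewrite mulr_sumr -sumrN; apply: eq_bigr => i i0.
  rewrite hess_weight_flip ?chi_null //; last exact: null_char1.
  by rewrite rcN rc1 mulrN1.
have pi2 : 1 <= pi ^+ 2 :> R.
  by rewrite expr_ge1 // (le_trans _ (pi_ge2 R)) // ler1n.
have pi0 : 0 < pi ^+ 2 :> R by rewrite (lt_le_trans _ pi2).
have cipi : cabs (ipi ^+ 2) = pi ^+ 2 by rewrite ipi2 cabsN cabs_rc gtr0_norm.
have ipi0 : ipi ^+ 2 != 0 by rewrite -cabs_gt0 cipi.
move=> {}h; rewrite -(ler_pM2l pi0) -{1}cipi -cabsM.
have -> : ipi ^+ 2 * (rc (nf (null_char n) t p) / ipi ^+ 2 * W - rc (gram y j k)) =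
    rc (nf (null_char n) t p) * W - ipi ^+ 2 * rc (gram y j k).
  by rewrite mulrBr mulrA [ipi ^+ 2 * (_ / _)]mulrC divfK.
by rewrite (le_trans h) // ler_peMl // ltW.
Qed.

Lemma hessian_rank : \forall t \near +oo, forall p, `|p| <= n.+1%:R ->
  theta_const (null_char n) (tau_of n t p) = 0 ->
  \rank (theta_hessian (null_char n) (tau_of n t p)) = n.+1.
Proof.
have n1 : 1 <= n%:R :> R by rewrite ler1n.
have N2 : n.+2%:R = n%:R + 2 :> R by rewrite -addn2 natrD.
(* Gives 4 n (n + 2) eta <= 1/2, as [perturbed_rank] requires a value below 1. *)
pose eta : R := (8 * n.+2%:R ^+ 2)^-1.
have q0 : 1 <= n.+2%:R :> R by rewrite ler1n.
have q2 : 1 <= n.+2%:R ^+ 2 :> R by rewrite expr_ge1.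
have eta0 : 0 < eta by rewrite invr_gt0; lra.
have etaE : eta * n.+2%:R ^+ 2 = 1 / 8 by rewrite /eta; field; lra.
have H1 := null_char_y eta0.
have H2 : \forall t \near +oo, forall jk : 'I_n.+1 * 'I_n.+1, forall p, `|p| <= n.+1%:R ->
    cabs ((rc (nf (null_char n) t p) / ipi ^+ 2) * theta_hessian (null_char n) (tau_of n t p) jk.1 jk.2 -
      rc (gram (expR (- (pi * p))) jk.1 jk.2)) <= eta.
  by apply: filter_forall => -[j k]; exact: hessian_asymptotic.
apply: filterS2 H1 H2 => t h1 h2 p hp th0.
set H := theta_hessian _ _; set a := rc (nf (null_char n) t p) / ipi ^+ 2.
have hr : \rank (a *: H) = n.+1.
  apply: (@perturbed_rank R n (a *: H) (expR (- (pi * p))) eta n_gt0) => //.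
  - by move=> j k; rewrite mxE; exact: (h2 (j, k)).
  - exact: h1.
  - have := h1 p hp th0; rewrite ler_norml => /andP[_ b].
    have e1 : eta * 1 <= eta * n.+2%:R ^+ 2 by rewrite ler_wpM2l // ltW.
    move: (expR _) b e1 etaE => y b e1 etaE; lra.
  - have e1 : n%:R * n.+2%:R * eta <= n.+2%:R ^+ 2 * eta.
      by rewrite ler_wpM2r ?(ltW eta0) // expr2 ler_wpM2r // N2; lra.
    have -> : 4 * n%:R * n.+2%:R * eta = 4 * (n%:R * n.+2%:R * eta) by ring.
    by move: e1; rewrite mulrC [n.+2%:R ^+ 2 * _]mulrC etaE mulrC; lra.
by apply/eqP; rewrite eqn_leq rank_leq_row -{1}hr mxrank_scale.
Qed.

Lemma special_matrix : exists tau : 'M[Cx R]_n.+1,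
  [/\ strongly_positive tau 1, tau^T = tau, theta_const (null_char n) tau = 0 &
    forall c, even_char c -> theta_const c tau = 0 -> \rank (theta_hessian c tau) = n.+1].
Proof.
have H1 := null_char_zero R n_gt0; have H2 := other_neq0; have H3 := hessian_rank.
have H4 : \forall t \near +oo, t_base R n <= t by apply: nbhs_pinfty_ge; exact: num_real.
have [t [[h1 h2] [h3 h4]]] := filter_ex (filterI (filterI H1 H2) (filterI H3 H4)).
have [p hp th0] := h1.
have hp1 : `|p| <= n.+1%:R by rewrite (le_trans hp) // ler_nat.
exists (tau_of n t p); split=> //; [exact: tau_positive | exact: tau_sym | move=> c ev c0].
have [->|cn] := eqVneq c (null_char n); first exact: h3.
by have := h2 c p hp1 th0 ev cn; rewrite c0 eqxx.
Qed.

End SpecialMatrix.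

(** * From the special matrix to its orbit in the moduli space *)

Lemma strongly_positive_siegel (R : realType) (g : nat) (tau : 'M[Cx R]_g) (a : R) :
  strongly_positive tau a -> tau^T = tau -> siegel_upper_half_space tau.
Proof.
move=> [a0 h] ts; split=> // x x0; apply: lt_le_trans (h x); rewrite mulr_gt0 //.
rewrite lt_neqAle sqnorm_ge0 andbT eq_sym; apply: contraNneq x0 => /eqP.
rewrite psumr_eq0 => [/allP hx|j _]; last exact: sqr_ge0.
apply/eqP/matrixP => i j; rewrite (ord1 j) mxE; apply/eqP.
by have := hx i (mem_index_enum i); rewrite /= sqrf_eq0.
Qed.

Lemma siegel_action1 (R : realType) (g : nat) (tau : 'M[Cx R]_g) :
  symplectic_group (1%:M : 'M[int]_(g + g)) /\ siegel_action 1%:M tau = tau.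
Proof.
split; first by rewrite /symplectic_group /= mul1mx trmx1 mulmx1.
rewrite /siegel_action map_mx1 scalar_mx_block.
rewrite block_mxKul block_mxKur block_mxKdl block_mxKdr mul1mx addr0 mul0mx add0r.
by rewrite invmx1 mulmx1.
Qed.

Theorem theorem3 (R : realType) (g : nat) (hg : (2 <= g)%N) :
  theta_null_rank R g (g - 1)%N `<` theta_null R g.
Proof.
(* Here n = g - 1 counts the vectors v_i with i >= 1; at least one is required for the change of
   sign. *)
case: g hg => [//|n] hn; have n0 : (0 < n)%N by [].
split=> [q [qA [tau [qt [c [ev c0 _]]]]]|sub].
  by split=> //; exists tau; split=> //=; rewrite (bigD1 c) //= c0 mul0r.
have [tau [pos ts nz full]] := special_matrix R n0.
have sA : siegel_upper_half_space tau by exact: strongly_positive_siegel pos ts.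
have [M1 act1] := siegel_action1 tau.
have [] : theta_null_rank R n.+1 (n.+1 - 1) (siegel_orbit tau).
  apply: sub; split; first by exists tau.
  exists tau; split; first by exists 1%:M.
  by rewrite /= (bigD1 (null_char n)) ?null_char_even //= nz mul0r.
move=> _ [_ [[M MS <-] [c [ev c0]]]].
(* The representative witnessing small rank may be any M tau; its Hessian has the rank of one at
   [tau], which is n + 1 > n. *)
have [c' [ev' c'0 ->]] := orbit_theta MS pos ts ev c0.
by rewrite full // subn1 ltnn.
Qed.
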